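(* Consider the estimators computed in the trigonometric basis on $I=[0,1]$, and assume $0<f_0\leqslant f(x)\leqslant\|f\|_\infty<\infty$ for every $x\in[0,1]$, $\mathbb E[b'(X_1)^4]<\infty$ and $\mathbb E(Y_1^4)<\infty$. If $b\in W^{\rm per}(\beta,L)$ with $\beta>1$ an integer and $L>0$, $b(0)=b(1)$, and $m_{\rm opt}=n^{1/(2\beta+1)}$ (understood as an odd integer of this order), then, for $i=1,2$, $$\mathbb E\left[\|\widetilde b_{m_{\rm opt}}^{\prime,i}-b'\|_n^2\right]\leqslant\mathfrak c_i(L,\beta,\|f\|_\infty,f_0,\sigma^2)\,n^{-2(\beta-1)/(2\beta+1)},$$ where $\mathfrak c_i(L,\beta,\|f\|_\infty,f_0,\sigma^2)>0$ is a constant not depending on $n$.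
   Context: Model: $Y_i=b(X_i)+\varepsilon_i$, $i=1,\dots,n$ ($n\geqslant2$), where $b$ is an unknown continuously differentiable function, $X_1,\dots,X_n$ are i.i.d. real random variables with density $f$ with respect to Lebesgue measure, and $\varepsilon_1,\dots,\varepsilon_n$ are i.i.d., centered, with variance $\sigma^2$, and independent of $X_1,\dots,X_n$. Estimation takes place on $I=[0,1]$: $b$ and $b'$ stand for $b\mathbf 1_I$ and $b'\mathbf 1_I$. $\|\psi\|_n^2=\frac1n\sum_{i=1}^n\psi(X_i)^2$. Trigonometric basis: $\varphi_1(x)=1$, $\varphi_{2j}(x)=\sqrt2\cos(2\pi jx)$, $\varphi_{2j+1}(x)=\sqrt2\sin(2\pi jx)$ on $[0,1]$ (extended by $0$ outside $[0,1]$), $j\geqslant1$; only odd dimensions $m$ are considered, so that $\varphi_1',\dots,\varphi_m'\in{\rm span}\{\varphi_1,\dots,\varphi_m\}$. Let $\Delta_{m,m}$ be the $m\times m$ matrix with $\varphi_j'=\sum_{k=1}^m[\Delta_{m,m}]_{j,k}\varphi_k$. Here $\mathfrak L(m)=\sup_{x\in[0,1]}\sum_{j=1}^m\varphi_j(x)^2=m$. Let $\widehat\Phi_m=(\varphi_j(X_i))_{1\leqslant i\leqslant n,1\leqslant j\leqslant m}$, $\widehat\Psi_m=\frac1n\widehat\Phi_m^*\widehat\Phi_m$ ($M^*$ is the transpose of $M$), $\mathbf Y=(Y_1,\dots,Y_n)^*$, $\widehat\theta_m^1=\frac1n\widehat\Psi_m^{-1}\widehat\Phi_m^*\mathbf Y$,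 $\widehat\theta_m^2=-\frac1n\Delta_{m,m}\widehat\Psi_m^{-1}\widehat\Phi_m^*\mathbf Y$, $\widehat b_m^{\prime,1}=\sum_{j=1}^m[\widehat\theta_m^1]_j\varphi_j'$, $\widehat b_m^{\prime,2}=\sum_{j=1}^m[\widehat\theta_m^2]_j\varphi_j$. Truncated estimators: $\widetilde b_m^{\prime,i}=\widehat b_m^{\prime,i}\mathbf 1_{\Lambda_m}$ with $\Lambda_m=\{\mathfrak L(m)(\|\widehat\Psi_m^{-1}\|_{\rm op}\vee1)\leqslant\mathfrak c\,n/\log(n)\}$, $\mathfrak c=(3\log(3/2)-1)/9$, where the operator norm of the inverse of a singular matrix is $+\infty$. $W^{\rm per}(\beta,L)$ is the set of $g\in C^\beta([0,1];\mathbb R)$ such that $g^{(\beta-1)}$ is absolutely continuous, $\int_0^1g^{(\beta)}(x)^2dx\leqslant L^2$ and $g^{(j)}(0)=g^{(j)}(1)$ for all $j=0,\dots,\beta-1$. *)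

(* Defs.v *)
From HB Require Import structures.
From mathcomp Require Import all_boot all_order all_algebra.
From mathcomp Require Import all_classical all_reals all_analysis.

Set Implicit Arguments.
Unset Strict Implicit.
Unset Printing Implicit Defensive.

Import Order.TTheory GRing.Theory Num.Theory.
Import numFieldNormedType.Exports.

Local Open Scope classical_set_scope.
Local Open Scope ring_scope.

Section calculus_on_I.
Context {R : realType}.
Implicit Types (g : R -> R) (x : R) (k m : nat).

Definition I01 : set R := `[0, 1]%classic.

Definition rateI g x (y : R) : R := (g y - g x) / (y - x).

(* Derivative of g relative to [0, 1]: two-sided inside, one-sided at 0 and 1.
   For x in [0, 1] it depends only on the restriction of g to [0, 1]. *)
Definition derivI g x : R := lim (rateI g x @ within I01 x^').

Definition derivableI g x : Prop := cvg (rateI g x @ within I01 x^').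

Definition derivnI k g : R -> R := iter k derivI g.

(* g restricted to [0, 1] belongs to C^k([0, 1]; R). *)
Definition CkI k g : Prop :=
  (forall j, (j < k)%N -> forall x, I01 x -> derivableI (derivnI j g) x) /\
  {within I01, continuous (derivnI k g)}.

Definition abs_continuousI g : Prop :=
  forall e : R, 0 < e -> exists2 delta : R, 0 < delta &
  forall (k : nat) (u v : 'I_k -> R),
    (forall i, 0 <= u i /\ u i <= v i /\ v i <= 1) ->
    (forall i j, i != j -> v i <= u j \/ v j <= u i) ->
    \sum_(i < k) (v i - u i) < delta ->
    \sum_(i < k) `|g (v i) - g (u i)| < e.

Definition Wper (beta : nat) (L : R) g : Prop :=
  [/\ CkI beta g,
      abs_continuousI (derivnI beta.-1 g),
      (\int[lebesgue_measure]_(x in I01) (derivnI beta g x ^+ 2)%:E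
         <= (L ^+ 2)%:E)%E &
      forall j, (j < beta)%N -> derivnI j g 0 = derivnI j g 1].

(* Trigonometric basis, indexed from 1; the index 0 is never used. *)
Definition phi (j : nat) x : R :=
  \1_I01 x *
  (if j == 1%N then 1
   else if odd j then Num.sqrt 2 * sin (2 * pi * (j./2)%:R * x)
   else Num.sqrt 2 * cos (2 * pi * (j./2)%:R * x)).

(* The jump of phi j at the end points of [0, 1] is not seen by derivI. *)
Definition phi' (j : nat) x : R := \1_I01 x * derivI (phi j) x.

Definition is_Delta m (D : 'M[R]_m) : Prop :=
  forall (j : 'I_m) x, I01 x ->
    phi' j.+1 x = \sum_(k < m) D j k * phi k.+1 x.

(* For odd m there is exactly one matrix satisfying is_Delta. *)
Definition Delta m : 'M[R]_m := xget 0 [set D | is_Delta D].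

Definition frakL m : R := sup [set \sum_(j < m) phi j.+1 x ^+ 2 | x in I01].

End calculus_on_I.

Section matrix_norm.
Context {R : realType}.

Definition norm2 m (v : 'cV[R]_m) : R := Num.sqrt (\sum_(i < m) v i 0 ^+ 2).

(* Spectral norm; the matrix norm `|M| of the library is the entrywise sup. *)
Definition opnorm m (M : 'M[R]_m) : R :=
  sup [set norm2 (M *m v) | v in [set v : 'cV[R]_m | norm2 v <= 1]].

Definition opnorm_inv m (M : 'M[R]_m) : \bar R :=
  if M \in unitmx then (opnorm (invmx M))%:E else +oo%E.

End matrix_norm.

Section independence.
Context {d : measure_display} {T : measurableType d} {R : realType}.
Variables (P : probability T R) (n : nat).
Implicit Types Z : 'I_n -> {RV P >-> R}.

Definition mutually_independent Z : Prop :=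
  forall A : 'I_n -> set R, (forall i, measurable (A i)) ->
    P (\bigcap_i (Z i @^-1` A i)) = (\prod_(i < n) P (Z i @^-1` A i))%E.

Definition identically_distributed Z : Prop :=
  forall (i j : 'I_n) (A : set R), measurable A ->
    P (Z i @^-1` A) = P (Z j @^-1` A).

(* Sigma-algebra generated by the whole family Z. *)
Definition sigma_family Z : set (set T) :=
  <<s \bigcup_i preimage_set_system setT (Z i) measurable >>.

Definition independent_families Z Z' : Prop :=
  forall E F : set T, sigma_family Z E -> sigma_family Z' F ->
    P (E `&` F) = (P E * P F)%E.

End independence.

Section model.
Context {d : measure_display} {T : measurableType d} {R : realType}.
Variables (P : probability T R) (n : nat).
Variables (X eps : 'I_n -> {RV P >-> R}) (b : R -> R).

Definition has_density (Z : {RV P >-> R}) (f : R -> R) : Prop :=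
  [/\ measurable_fun setT f, (forall x, 0 <= f x) &
      forall A : set R, measurable A ->
        P (Z @^-1` A) = (\int[lebesgue_measure]_(x in A) (f x)%:E)%E].

Record regression_model (f : R -> R) (sigma2 : R) : Prop := RegressionModel {
  b_derivable : forall x, derivable b x 1;
  b_C1 : continuous (derive1 b);
  X_indep : mutually_independent X;
  X_density : forall i, has_density (X i) f;
  eps_indep : mutually_independent eps;
  eps_ident : identically_distributed eps;
  eps_centered : forall i, ('E_P[eps i])%E = 0%E;
  eps_variance : forall i, ('V_P[eps i])%E = sigma2%:E;
  X_eps_indep : independent_families X eps }.

Definition Yobs (i : 'I_n) (w : T) : R := b (X i w) + eps i w.

(* b' 1_I *)
Definition b' (x : R) : R := \1_I01 x * derive1 b x.

(* Square of the empirical norm. *)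
Definition sqnormn (psi : R -> R) (w : T) : R :=
  n%:R^-1 * \sum_(i < n) psi (X i w) ^+ 2.

Variable m : nat.

Definition Phihat (w : T) : 'M[R]_(n, m) := \matrix_(i, j) phi j.+1 (X i w).

Definition Psihat (w : T) : 'M[R]_m :=
  n%:R^-1 *: ((Phihat w)^T *m Phihat w).

Definition Yvec (w : T) : 'cV[R]_n := \col_i Yobs i w.

(* invmx M = M for a singular M, but the truncated estimators vanish where
   Psihat is singular. *)
Definition theta1 (w : T) : 'cV[R]_m :=
  n%:R^-1 *: (invmx (Psihat w) *m (Phihat w)^T *m Yvec w).

Definition theta2 (w : T) : 'cV[R]_m :=
  - (n%:R^-1 *: (Delta m *m invmx (Psihat w) *m (Phihat w)^T *m Yvec w)).

Definition bhat'1 (w : T) (x : R) : R :=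
  \sum_(j < m) theta1 w j 0 * phi' j.+1 x.

Definition bhat'2 (w : T) (x : R) : R :=
  \sum_(j < m) theta2 w j 0 * phi j.+1 x.

Definition frakc : R := (3 * ln (3 / 2) - 1) / 9.

Definition Lambda : set T :=
  [set w | ((frakL m)%:E * maxe (opnorm_inv (Psihat w)) 1
              <= (frakc * n%:R / ln n%:R)%:E)%E].

Definition btilde'1 (w : T) (x : R) : R := bhat'1 w x * \1_Lambda w.

Definition btilde'2 (w : T) (x : R) : R := bhat'2 w x * \1_Lambda w.

Definition risk (est : T -> R -> R) : \bar R :=
  expectation P (fun w => sqnormn (fun x => est w x - b' x) w).

End model.

(* Main.v *)
(* Since phi_j' = w_j phi_tau(j) with w_tau(j) = - w_j, the matrix Delta is
   antisymmetric and the two estimators coincide.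
   The bias is the remainder of the Fourier series. Pointwise convergence, by
   the Dirichlet kernel and Bessel's inequality, and Fatou's lemma bound its
   L^2 norm by the tail of the squared coefficients; integrating by parts beta
   times gives m^(-2 (beta - r)) L^2 for the r-th derivative.
   Compare Psihat with its mean Psi, which satisfies f0 <= Psi <= finf. If all
   entries of Psihat - Psi are at most t = f0 / (2 m), then Psihat >= f0 / 2 and
   the coefficients of the estimator differ from those of the Fourier partial
   sum by at most (2 / f0) times the projected residuals. Otherwise the
   truncation gives a bound polynomial in n and m, and by exponential moments
   the probability of this case is at most 2 m^2 exp (- n t^2 / 128).
   With y = n^(1 / (2 beta + 1)), n = y^(2 beta + 1) and m of order y: bias and
   noise are of order y^(- 2 (beta - 1)), and the exponential term is negligible.
   The truncation rejects a well-conditioned sample only for bounded y. *)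

Require Import Defs.
From HB Require Import structures.
From mathcomp Require Import all_boot all_order all_algebra.
From mathcomp Require Import all_classical all_reals all_analysis.
From mathcomp Require Import measurable_realfun.
From mathcomp Require Import ring lra zify.

Set Implicit Arguments.
Unset Strict Implicit.
Unset Printing Implicit Defensive.

Import Order.TTheory GRing.Theory Num.Theory.
Import numFieldNormedType.Exports.

Local Open Scope classical_set_scope.
Local Open Scope ring_scope.

(** * The inner product of L^2([0, 1]) on bounded functions *)

Section inner_product_on_I.
Context {R : realType}.
Local Notation mu := (@lebesgue_measure R).
Local Notation I := (@I01 R).
Implicit Types (f g h : R -> R) (a : R).

(** Differentiation multiplies the error on the coefficients by frequencies of order m. The squared
    bias m^(-2 beta) and the noise m / n of the coefficients both gain a factor m^2, and m of order
    y balances m^(-2 (beta - 1)) against m^3 / n. Comparing [Psihat] with its mean entry by entry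
    costs a factor m in the quadratic form and m^2 in the union bound. This is affordable: t is of
    order 1 / m, so n t^2 is of order n / m^2, hence at least of order y, and the exponential beats
    every power of y, in particular those lost in the crude bound on the bad event. The bad event is
    determined by the design alone. It is thus independent of the noise, and its probability
    multiplies [sigma2] directly in the expectation. The crude bound asks for the bias at every
    point, not only in mean square: a uniform bound on the Fourier remainder of b is drawn from the
    L^2 bound on the remainder of b'. The constants are chosen before n, m and the law, so every
    term, including the loss when the truncation rejects, is compared with an explicit multiple of
    y^(-2 (beta - 1)). *)

Lemma measurable_I01 : measurable I.
Proof. exact: measurable_itv. Qed.

Lemma mu_I01 : mu I = 1%E.
Proof. by rewrite /I01 lebesgue_measure_itv/= lte_fin ltr01 oppr0 adde0. Qed.

(** A class stable under sums and products whose members are integrable on [0, 1]: every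
    integrability condition on an inner product reduces to membership in it. *)
Definition bndI g := measurable_fun I g /\ exists M, forall x, I x -> `|g x| <= M.

Lemma bndI_integrable g : bndI g -> mu.-integrable I (EFin \o g).
Proof.
move=> [mg [M gM]]; apply: measurable_bounded_integrable => //.
- exact: measurable_I01.
- by rewrite [X in (X < _)%E]mu_I01 ltry.
- by exists M; split; [exact: num_real|move=> y My x Ix; exact: le_trans (gM _ Ix) (ltW My)].
Qed.

Lemma bndI_cst a : bndI (cst a).
Proof. by split; [exact: measurable_cst|exists `|a|]. Qed.

Lemma bndID f g : bndI f -> bndI g -> bndI (fun x => f x + g x).
Proof.
move=> [mf [M fM]] [mg [N gN]]; split; first exact: measurable_funD.
by exists (M + N) => x Ix; rewrite (le_trans (ler_normD _ _))// lerD// ?fM ?gN.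
Qed.

Lemma bndIM f g : bndI f -> bndI g -> bndI (fun x => f x * g x).
Proof.
move=> [mf [M fM]] [mg [N gN]]; split; first exact: measurable_funM.
by exists (M * N) => x Ix; rewrite normrM ler_pM// ?fM ?gN.
Qed.

Lemma bndIZ a g : bndI g -> bndI (fun x => a * g x).
Proof. exact: (bndIM (bndI_cst a)). Qed.

Lemma bndIB f g : bndI f -> bndI g -> bndI (fun x => f x - g x).
Proof.
move=> bf bg; rewrite (_ : (fun x => _) = fun x => f x + (-1) * g x).
  by apply: bndID => //; exact: bndIZ.
by apply/funext => x; rewrite mulN1r.
Qed.

Lemma bndI_sum (J : eqType) (s : seq J) (F : J -> R -> R) :
  (forall i, bndI (F i)) -> bndI (fun x => \sum_(i <- s) F i x).
Proof.
move=> bF; elim: s => [|i s IH].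
  by under eq_fun do rewrite big_nil; exact: bndI_cst.
by under eq_fun do rewrite big_cons; exact: bndID.
Qed.

Lemma bndI_continuous g : {within I, continuous g} -> bndI g.
Proof.
move=> cg; split.
  by apply: subspace_continuous_measurable_fun => //; exact: measurable_I01.
have cN : {within I, continuous (fun x => `|g x|)}.
  by move=> x; apply: continuous_comp; [exact: cg|exact: norm_continuous].
have [c _ Hc] := EVT_max (@ler01 R) cN.
by exists `|g c| => x Ix; exact: Hc.
Qed.

Definition ipI f g : R := \int[mu]_(x in I) (f x * g x).

Lemma eq_ipI f f' g g' : (forall x, I x -> f x = f' x) ->
  (forall x, I x -> g x = g' x) -> ipI f g = ipI f' g'.
Proof. by move=> ff gg; apply: eq_Rintegral => x /[!inE] Ix; rewrite ff ?gg. Qed.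

Lemma ipIC f g : ipI f g = ipI g f.
Proof. by apply: eq_Rintegral => x _; rewrite mulrC. Qed.

Lemma ipIDr f g h : bndI f -> bndI g -> bndI h ->
  ipI f (fun x => g x + h x) = ipI f g + ipI f h.
Proof.
move=> bf bg bh; rewrite /ipI -RintegralD//; last 3 first.
- exact: measurable_I01.
- exact/bndI_integrable/bndIM.
- exact/bndI_integrable/bndIM.
by apply: eq_Rintegral => x _; rewrite mulrDr.
Qed.

Lemma ipIZr a f g : bndI f -> bndI g -> ipI f (fun x => a * g x) = a * ipI f g.
Proof.
move=> bf bg; rewrite /ipI -RintegralZl//; last 2 first.
- exact: measurable_I01.
- exact/bndI_integrable/bndIM.
by apply: eq_Rintegral => x _; rewrite mulrCA.
Qed.

Lemma ipIBr f g h : bndI f -> bndI g -> bndI h ->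
  ipI f (fun x => g x - h x) = ipI f g - ipI f h.
Proof.
move=> bf bg bh; rewrite -mulN1r -ipIZr// -ipIDr//; last exact: bndIZ.
by apply: eq_ipI => // x _; rewrite mulN1r.
Qed.

Lemma ipI_sumr (J : eqType) (s : seq J) (F : J -> R -> R) f : bndI f ->
  (forall i, bndI (F i)) ->
  ipI f (fun x => \sum_(i <- s) F i x) = \sum_(i <- s) ipI f (F i).
Proof.
move=> bf bF; elim: s => [|i s IH].
  rewrite big_nil -[RHS](mul0r (ipI f f)) -ipIZr//.
  by apply: eq_ipI => // x _; rewrite big_nil mul0r.
rewrite big_cons -IH -ipIDr//; last exact: bndI_sum.
by apply: eq_ipI => // x _; rewrite big_cons.
Qed.

Lemma ipI_ge0 f : 0 <= ipI f f.
Proof. by apply: Rintegral_ge0 => x _; rewrite -expr2 sqr_ge0. Qed.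

Lemma ipI_EFin f g : bndI f -> bndI g ->
  (\int[mu]_(x in I) (f x * g x)%:E)%E = (ipI f g)%:E.
Proof.
move=> bf bg; rewrite /ipI /Rintegral fineK//; apply: integrable_fin_num.
  exact: measurable_I01.
exact/bndI_integrable/bndIM.
Qed.

Lemma ipI_bound f M : bndI f -> (forall x, I x -> `|f x| <= M) -> ipI f f <= M ^+ 2.
Proof.
move=> bf fM; rewrite /ipI (le_trans (y := \int[mu]_(x in I) (M ^+ 2)))//.
  apply: le_Rintegral => //; first exact: measurable_I01.
  - exact/bndI_integrable/bndIM.
  - exact/bndI_integrable/bndI_cst.
  move=> x Ix; rewrite -expr2 -real_normK ?num_real//.
  by rewrite lerXn2r ?nnegrE ?fM// (le_trans _ (fM _ Ix)).
by rewrite Rintegral_cst; [rewrite [X in fine X]mu_I01 mulr1|exact: measurable_I01].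
Qed.

Section orthonormal.
Variables (e : nat -> R -> R).
Hypothesis be : forall i, bndI (e i).
Hypothesis oe : forall i j, ipI (e i) (e j) = (i == j)%:R.

Lemma ipI_orthonormal_sum (s : seq nat) (a : nat -> R) j : uniq s ->
  ipI (e j) (fun x => \sum_(i <- s) a i * e i x) = if j \in s then a j else 0.
Proof.
move=> us; rewrite ipI_sumr//; last by move=> i; exact: bndIZ.
under eq_bigr do rewrite ipIZr// oe.
case: ifPn => js.
  rewrite (bigD1_seq j)//= eqxx mulr1 big1 ?addr0// => i ij.
  by rewrite eq_sym (negbTE ij) mulr0.
rewrite big_seq big1// => i is_; have [ji|] := eqVneq j i; last by rewrite mulr0.
by rewrite ji is_ in js.
Qed.

Lemma sqnorm_orthonormal_sum (s : seq nat) (a : nat -> R) : uniq s ->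
  ipI (fun x => \sum_(i <- s) a i * e i x) (fun x => \sum_(i <- s) a i * e i x)
    = \sum_(i <- s) a i ^+ 2.
Proof.
move=> us; have bae i : bndI (fun x => a i * e i x) by exact: bndIZ.
rewrite [LHS]ipI_sumr//; last exact: bndI_sum.
rewrite big_seq [RHS]big_seq; apply: eq_bigr => i is_.
by rewrite ipIZr//; [rewrite ipIC ipI_orthonormal_sum// is_|exact: bndI_sum].
Qed.

Lemma bessel (s : seq nat) f : uniq s -> bndI f ->
  \sum_(i <- s) ipI f (e i) ^+ 2 <= ipI f f.
Proof.
move=> us bf; pose a i := ipI f (e i).
pose S x := \sum_(i <- s) a i * e i x.
have bS : bndI S by apply: bndI_sum => i; exact: bndIZ.
have fS : ipI f S = \sum_(i <- s) a i ^+ 2.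
  rewrite ipI_sumr//; last by move=> i; exact: bndIZ.
  by apply: eq_bigr => i _; rewrite ipIZr.
have := ipI_ge0 (fun x => f x - S x).
rewrite ipIBr//; last exact: bndIB.
rewrite (ipIC _ f) (ipIC _ S) !ipIBr// (ipIC S f) fS sqnorm_orthonormal_sum//.
by rewrite subrr subr0 subr_ge0.
Qed.

End orthonormal.

End inner_product_on_I.

(** * Integration by parts on [0, 1] *)

Section C1_on_I.
Context {R : realType}.
Local Notation mu := (@lebesgue_measure R).
Local Notation I := (@I01 R).

(** The two-sided derivative is required only inside (0, 1), because functions known on [0, 1] have
    no derivative across the end points; there [dh] is given by continuity. *)
Definition C1I (h dh : R -> R) := [/\ {within I, continuous h},
  {within I, continuous dh} & forall x : R, x \in `]0, 1[ -> is_derive x (1 : R) h (dh x)].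

Lemma C1I_oo h dh : C1I h dh -> derivable_oo_LRcontinuous h 0 1.
Proof.
move=> [ch _ dh01]; have [_ h0 h1] := (continuous_within_itvP h (@ltr01 R)).1 ch.
by split => // x /dh01 [].
Qed.

Lemma ibpI F f G g : C1I F f -> C1I G g ->
  ipI F g = F 1 * G 1 - F 0 * G 0 - ipI f G.
Proof.
move=> CF CG; have [_ cf dF] := CF; have [_ cg dG] := CG.
apply: Rintegration_by_parts => //.
- exact: C1I_oo CF.
- by move=> x /dF [_ <-]; rewrite derive1E.
- exact: C1I_oo CG.
- by move=> x /dG [_ <-]; rewrite derive1E.
Qed.

Lemma C1I_cst (a : R) : C1I (cst a) (cst 0).
Proof.
split; [by move=> x; exact: cvg_cst..|].
by move=> x _; exact: is_derive_cst.
Qed.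

End C1_on_I.

(** * Fourier series of C^1 periodic functions *)

Section trigonometric_system.
Context {R : realType}.
Local Notation I := (@I01 R).
Local Notation phi := (@phi R).
Implicit Types (x : R) (j k : nat).

(* The system phi without the indicator of [0, 1], indexed from 0. *)
Definition trig j x : R :=
  if j == 0 then 1
  else if odd j then Num.sqrt 2 * cos (2 * pi * (j.+1)./2%:R * x)
  else Num.sqrt 2 * sin (2 * pi * (j.+1)./2%:R * x).

(* trig j and trig (tau j) have the same frequency, and
   (trig j)' = tw j * trig (tau j). *)
Definition tau j := if j == 0 then 0 else if odd j then j.+1 else j.-1.

Definition tw j : R :=
  if odd j then - (2 * pi * (j.+1)./2%:R) else 2 * pi * (j.+1)./2%:R.

Lemma phiE j x : phi j.+1 x = \1_I x * trig j x.
Proof.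
rewrite /Defs.phi /trig eqSS /=; case: eqP => // _.
by case: (odd j).
Qed.

(** Index 0 is the constant function, [k.*2.+1] the cosine and [k.*2.+2] the sine of frequency k +
    1. *)
Lemma nat_pairs_ind (Q : nat -> Prop) : Q 0 -> (forall k, Q k.*2.+1) ->
  (forall k, Q k.*2.+2) -> forall j, Q j.
Proof.
move=> Q0 Q1 Q2 [//|j]; rewrite -(odd_double_half j).
by case: (odd j); [rewrite add1n; exact: Q2|rewrite add0n; exact: Q1].
Qed.

Lemma tau_cos k : tau k.*2.+1 = k.*2.+2.
Proof. by rewrite /tau /= odd_double. Qed.

Lemma tau_sin k : tau k.*2.+2 = k.*2.+1.
Proof. by rewrite /tau /= odd_double. Qed.

Lemma tau0 : tau 0 = 0%N. Proof. by []. Qed.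

Lemma tw0 : tw 0 = 0. Proof. by rewrite /tw /= mulr0. Qed.

Lemma tw_cos k : tw k.*2.+1 = - (2 * pi * k.+1%:R).
Proof. by rewrite /tw /= odd_double /= ?uphalf_double ?doubleK. Qed.

Lemma tw_sin k : tw k.*2.+2 = 2 * pi * k.+1%:R.
Proof. by rewrite /tw /= odd_double /= ?uphalf_double ?doubleK. Qed.

Lemma trig0 x : trig 0 x = 1. Proof. by []. Qed.

Lemma trig_cos k x : trig k.*2.+1 x = Num.sqrt 2 * cos (2 * pi * k.+1%:R * x).
Proof. by rewrite /trig /= odd_double /= ?uphalf_double ?doubleK. Qed.

Lemma trig_sin k x : trig k.*2.+2 x = Num.sqrt 2 * sin (2 * pi * k.+1%:R * x).
Proof. by rewrite /trig /= odd_double /= ?uphalf_double ?doubleK. Qed.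

Lemma tauK : involutive tau.
Proof. by elim/nat_pairs_ind => // k; rewrite ?tau_cos ?tau_sin ?tau_cos. Qed.

Lemma tw_tau j : tw (tau j) = - tw j.
Proof.
elim/nat_pairs_ind: j => [|k|k]; first by rewrite tau0 tw0 oppr0.
- by rewrite tau_cos tw_sin tw_cos opprK.
- by rewrite tau_sin tw_sin tw_cos.
Qed.

Lemma is_derive_trig j x : is_derive x (1 : R) (trig j) (tw j * trig (tau j) x).
Proof.
have dl (a : R) : is_derive x (1 : R) ( *%R a) a.
  rewrite (_ : *%R a = a \*: (id : R -> R))//.
  by apply: is_derive_eq; rewrite /GRing.scale/= mulr1.
elim/nat_pairs_ind: j => [|k|k].
- rewrite tw0 mul0r (_ : trig 0 = cst 1); first exact: is_derive_cst.
  by apply/funext => y; rewrite trig0.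
- rewrite (_ : trig _ = Num.sqrt 2 \*o (cos \o *%R (2 * pi * k.+1%:R))); last first.
    by apply/funext => y; rewrite trig_cos.
  apply: is_derive_eq; rewrite tau_cos trig_sin tw_cos /GRing.scale/=; ring.
- rewrite (_ : trig _ = Num.sqrt 2 \*o (sin \o *%R (2 * pi * k.+1%:R))); last first.
    by apply/funext => y; rewrite trig_sin.
  apply: is_derive_eq; rewrite tau_sin trig_cos tw_sin /GRing.scale/=; ring.
Qed.

Lemma continuous_trig j : continuous (trig j).
Proof.
move=> x; apply: differentiable_continuous; apply/derivable1_diffP.
by have [] := is_derive_trig j x.
Qed.

Lemma bndI_trig j : bndI (trig j).
Proof. by apply/bndI_continuous/continuous_subspaceT/continuous_trig. Qed.

Lemma C1I_trig j : C1I (trig j) (fun x => tw j * trig (tau j) x).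
Proof.
split; first exact/continuous_subspaceT/continuous_trig.
- apply: continuous_subspaceT => x.
  by apply: cvgM; [exact: cvg_cst|exact: continuous_trig].
- by move=> x _; exact: is_derive_trig.
Qed.

Lemma cos_2piM k : cos (2 * pi * k%:R : R) = 1.
Proof.
rewrite [X in cos X](_ : _ = 0 + (pi *+ 2) *+ k); last first.
  by rewrite add0r -mulrnA -[RHS]mulr_natl natrM mulrAC.
by rewrite (periodicn (@cosD2pi R)) cos0.
Qed.

Lemma sin_2piM k : sin (2 * pi * k%:R : R) = 0.
Proof.
rewrite [X in sin X](_ : _ = 0 + (pi *+ 2) *+ k); last first.
  by rewrite add0r -mulrnA -[RHS]mulr_natl natrM mulrAC.
by rewrite (periodicn (@sinD2pi R)) sin0.
Qed.

Lemma trig_periodic j : trig j 1 = trig j 0.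
Proof.
elim/nat_pairs_ind: j => [//|k|k].
- by rewrite !trig_cos mulr1 mulr0 cos_2piM cos0.
- by rewrite !trig_sin mulr1 mulr0 sin_2piM sin0.
Qed.

Lemma sqr_trigDtau j x : trig j x ^+ 2 + trig (tau j) x ^+ 2 = 2.
Proof.
have H (a : R) : (Num.sqrt 2 * cos a) ^+ 2 + (Num.sqrt 2 * sin a) ^+ 2 = 2.
  by rewrite !exprMn -mulrDr cos2Dsin2 sqr_sqrtr ?mulr1.
elim/nat_pairs_ind: j => [|k|k].
- by rewrite tau0 trig0 expr1n.
- by rewrite tau_cos trig_cos trig_sin H.
- by rewrite tau_sin trig_cos trig_sin addrC H.
Qed.

Lemma sqr_trig_le2 j x : trig j x ^+ 2 <= 2.
Proof. by rewrite -(sqr_trigDtau j x) lerDl sqr_ge0. Qed.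

(** [- tw j ^+ 2] is the eigenvalue of [trig j] for the second derivative; each eigenvalue belongs
    to one cosine and sine pair only. *)
Lemma sqr_tw_inj j k : tw j ^+ 2 = tw k ^+ 2 -> k = j \/ k = tau j.
Proof.
have H (a b : nat) : (2 * pi * a%:R : R) ^+ 2 = (2 * pi * b%:R) ^+ 2 -> a = b.
  move=> /eqP; rewrite eqrXn2// ?mulr_ge0 ?pi_ge0//.
  have p0 : (2 * pi : R) != 0 by rewrite mulf_neq0// gt_eqF// pi_gt0.
  by move=> /eqP/(mulfI p0)/eqP; rewrite eqr_nat => /eqP.
have H0 (a : nat) : (0 : R) ^+ 2 = (2 * pi * a.+1%:R) ^+ 2 -> False.
  by rewrite -(mulr0 (2 * pi : R)) => /(H 0%N).
elim/nat_pairs_ind: j => [|j|j]; elim/nat_pairs_ind: k => [|k|k];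
  rewrite ?tau_cos ?tau_sin ?tau0 ?tw_cos ?tw_sin ?tw0 ?sqrrN//.
- by left.
- by move=> /H0.
- by move=> /H0.
- by move=> /esym/H0.
- by move=> /H[->]; left.
- by move=> /H[->]; right.
- by move=> /esym/H0.
- by move=> /H[->]; right.
- by move=> /H[->]; left.
Qed.

(** Differentiation is antisymmetric on periodic functions ([IBP]), so eigenfunctions of the second
    derivative with different eigenvalues are orthogonal ([G2]). Within a pair, [GG] makes the two
    norms equal and [sqr_trigDtau] gives their sum, while antisymmetry makes the mixed product equal
    to its opposite. *)
Lemma trig_orthonormal j k : ipI (trig j) (trig k) = (j == k)%:R.
Proof.
pose G j k := ipI (trig j) (trig k); rewrite -/(G j k).
have IBP a b : tw b * G a (tau b) = - (tw a * G (tau a) b).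
  rewrite /G -ipIZr; [|exact: bndI_trig..].
  rewrite (ibpI (C1I_trig a) (C1I_trig b)) !trig_periodic subrr sub0r.
  by rewrite ipIC ipIZr ?(ipIC (trig b))//; exact: bndI_trig.
have GG a b : tw b * G a b = tw a * G (tau a) (tau b).
  by have := IBP a (tau b); rewrite tauK tw_tau mulNr => /oppr_inj.
have G2 a b : (tw b ^+ 2 - tw a ^+ 2) * G a b = 0.
  have := GG (tau a) (tau b); rewrite !tauK !tw_tau !mulNr => /oppr_inj E.
  transitivity (tw b * (tw b * G a b - tw a * G (tau a) (tau b)) +
    tw a * (tw b * G (tau a) (tau b) - tw a * G a b)); first by ring.
  by rewrite E GG !subrr !mulr0 addr0.
have GC a b : G a b = G b a by rewrite /G ipIC.
have [/(@sqr_tw_inj j k)|ne] := eqVneq (tw j ^+ 2) (tw k ^+ 2); last first.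
  have /eqP := G2 j k; rewrite mulf_eq0 subr_eq0 eq_sym (negbTE ne)/= => /eqP -> .
  by case: eqP => // jk; rewrite jk eqxx in ne.
have tw_eq0 a : (tw a == 0) = (a == 0%N).
  elim/nat_pairs_ind: a => [|a|a]; rewrite ?tw0 ?eqxx// ?tw_cos ?tw_sin ?oppr_eq0;
  by rewrite !mulf_eq0 !(gt_eqF (pi_gt0 _)) ?pnatr_eq0.
have G1 a : G a a = 1.
  have sum2 : G a a + G (tau a) (tau a) = 2.
    rewrite /G /ipI -RintegralD; last 3 first.
    - exact: measurable_I01.
    - by apply: bndI_integrable; apply: bndIM; exact: bndI_trig.
    - by apply: bndI_integrable; apply: bndIM; exact: bndI_trig.
    rewrite (@eq_Rintegral _ _ _ _ _ (cst 2)); last first.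
      by move=> x _; rewrite -!expr2 sqr_trigDtau.
    by rewrite /= Rintegral_cst; [rewrite [X in fine X]mu_I01 mulr1|exact: measurable_I01].
  have [a0|a0] := eqVneq a 0%N; first by move: sum2; rewrite a0 tau0; lra.
  have : tw a != 0 by rewrite tw_eq0.
  by move=> /mulfI /(_ _ _ (GG a a)); lra.
case=> ->; first by rewrite eqxx G1.
have [tj|tj] := eqVneq; first by rewrite -tj G1.
have j0 : tw j != 0 by rewrite tw_eq0; apply: contra_neq tj => ->.
apply: (mulfI j0); rewrite mulr0.
by have := IBP j j; rewrite (GC (tau j)); lra.
Qed.

Lemma natr_le_normr_tw j : (j%:R : R) <= `|tw j|.
Proof.
have H (a : nat) : (a.*2.+2)%:R <= (2 * pi * a.+1%:R : R).
  rewrite -doubleS -mul2n natrM mulrAC ler_peMr//.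
  by have := @pi_ge2 R; lra.
have H' (a : nat) : 0 <= (2 * pi * a.+1%:R : R) by rewrite !mulr_ge0// pi_ge0.
elim/nat_pairs_ind: j => [|j|j]; first exact: normr_ge0.
- by rewrite tw_cos normrN ger0_norm// (le_trans _ (H j))// ler_nat.
- by rewrite tw_sin ger0_norm.
Qed.

Lemma sqr_tw_le j : tw j ^+ 2 <= (8 * j%:R) ^+ 2.
Proof.
have pi4 : (pi : R) <= 4 by have := @pihalf_02 R; lra.
have pi0 := @pi_ge0 R.
elim/nat_pairs_ind: j => [|j|j]; first by rewrite tw0 mulr0.
- rewrite tw_cos sqrrN lerXn2r ?nnegrE ?mulr_ge0//.
  by apply: ler_pM; rewrite ?mulr_ge0 ?ler_nat//; [lra|lia].
- rewrite tw_sin lerXn2r ?nnegrE ?mulr_ge0//.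
  by apply: ler_pM; rewrite ?mulr_ge0 ?ler_nat//; [lra|lia].
Qed.

(** An odd dimension holds the constant and whole cosine and sine pairs, so [tau] permutes the
    indices below it. *)
Lemma tau_lt N j : odd N -> (tau j < N)%N = (j < N)%N.
Proof.
move=> oN; elim/nat_pairs_ind: j => [//|k|k]; rewrite ?tau_cos ?tau_sin; lia.
Qed.

End trigonometric_system.

(** * Pointwise convergence of the Fourier series inside (0, 1) *)

Section pointwise_fourier.
Context {R : realType}.
Local Notation mu := (@lebesgue_measure R).
Local Notation I := (@I01 R).

Lemma measurable_invr : measurable_fun [set: R] (@GRing.inv R).
Proof.
rewrite -(setvU [set (0 : R)]); apply/measurable_funU => //.
  by apply: measurableC.
split; last exact: measurable_fun_set1.
apply: subspace_continuous_measurable_fun; first by apply: measurableC.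
apply: continuous_in_subspaceT => x /[!inE] /eqP x0.
exact: inv_continuous.
Qed.

(* sin v = 4 sin(v/4) cos(v/4) cos(v/2) and sin(v/4) >= (v/4) cos(v/4) *)
Lemma sin_ge_linear (V v : R) : 0 <= v <= V -> V < pi ->
  v * cos (V / 2) ^+ 3 <= sin v.
Proof.
move=> /andP[v0 vV] Vpi.
have cosge (t : R) : 0 <= t <= V / 2 -> cos (V / 2) <= cos t.
  move=> /andP[t0 tV]; have [->|neq] := eqVneq t (V / 2); first by [].
  rewrite ltW// ltr_cos ?in_itv/= ?lt_neqAle ?neq ?tV//.
  - by apply/andP; split; lra.
  - by apply/andP; split; lra.
have c0 : 0 <= cos (V / 2).
  by apply/ltW/cos_gt0_pihalf/andP; split; lra.
have c2 : cos (V / 2) <= cos (v / 2) by apply: cosge; lra.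
have c4 : cos (V / 2) <= cos (v / 4) by apply: cosge; lra.
have s4 : v / 4 * cos (V / 2) <= sin (v / 4).
  have v4 : 0 <= v / 4 by lra.
  have cs : {within `[0, v / 4], continuous (@sin R)}.
    exact/continuous_subspaceT/continuous_sin.
  have [c ci] := MVT_segment v4 (fun x _ => is_derive_sin x) cs.
  rewrite sin0 !subr0 => ->; rewrite mulrC ler_wpM2r//.
  apply: cosge; move: ci; rewrite in_itv/= => /andP[ci0 ci4]; lra.
have dbl (t : R) : sin t = 2 * (sin (t / 2) * cos (t / 2)).
  rewrite [in LHS](_ : t = (t / 2) *+ 2); last by rewrite -mulr_natr mulfVK.
  by rewrite sin_mulr2n mulrC -mulr_natl.
have -> : sin v = 4 * (sin (v / 4) * cos (v / 4) * cos (v / 2)).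
  rewrite dbl (dbl (v / 2)) (_ : v / 2 / 2 = v / 4); last by field.
  by ring.
have -> : v * cos (V / 2) ^+ 3 = 4 * (v / 4 * cos (V / 2) * cos (V / 2) * cos (V / 2)).
  by field.
rewrite ler_pM2l//; apply: ler_pM => //; first by rewrite !mulr_ge0//; lra.
by apply: ler_pM => //; rewrite !mulr_ge0//; lra.
Qed.

Section lipschitz.
Variables h dh : R -> R.
Hypothesis Ch : C1I h dh.

Lemma lipschitz_C1I M : (forall x, I x -> `|dh x| <= M) ->
  forall x y, I x -> I y -> `|h x - h y| <= M * `|x - y|.
Proof.
case: Ch => ch cdh dh01 dhM.
suff H x y : I x -> I y -> x <= y -> `|h x - h y| <= M * `|x - y|.
  move=> x y Ix Iy; have [|/ltW] := leP x y; first exact: H.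
  by rewrite distrC (distrC x); exact: H.
rewrite /I01/= !in_itv/= => /andP[x_0 x_1] /andP[y_0 y_1] xy.
have dxy z : z \in `]x, y[ -> is_derive z 1 h (dh z).
  rewrite in_itv/= => /andP[xz zy]; apply: dh01.
  by rewrite in_itv/=; apply/andP; split; lra.
have cxy : {within `[x, y], continuous h}.
  by apply: continuous_subspaceW ch; apply: subset_itv; rewrite bnd_simp.
have [c] := MVT_segment xy dxy cxy.
rewrite in_itv/= => /andP[xc cy] E.
rewrite distrC E normrM (distrC x) ler_wpM2r// dhM// /I01/= in_itv/=.
by apply/andP; split; lra.
Qed.

End lipschitz.

Section at_point.
Variable x0 : R.
Hypothesis x001 : x0 \in `]0, 1[.

Definition dirichlet K (x : R) : R := \sum_(j < K.*2.+1) trig j x * trig j x0.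

Lemma dirichlet_cos n (x : R) :
  trig n.*2.+1 x * trig n.*2.+1 x0 + trig n.*2.+2 x * trig n.*2.+2 x0
    = 2 * cos (2 * pi * n.+1%:R * (x - x0)).
Proof.
rewrite !trig_cos !trig_sin mulrBr cosB -[X in X * (_ + _)](@sqr_sqrtr R 2)//.
by ring.
Qed.

(** The closed form of the Dirichlet kernel, stated as a product so that it also holds where the
    sine vanishes. *)
Lemma dirichletE K (x : R) : dirichlet K x * sin (pi * (x - x0))
  = sin (K.*2.+1%:R * (pi * (x - x0))).
Proof.
elim: K => [|K IH]; first by rewrite /dirichlet big_ord1 !trig0 !mul1r.
have -> : dirichlet K.+1 x = dirichlet K x + 2 * cos (2 * pi * K.+1%:R * (x - x0)).
  by rewrite /dirichlet doubleS big_ord_recr big_ord_recr /= -addrA dirichlet_cos.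
rewrite mulrDl IH.
set u := pi * (x - x0).
have -> : K.*2.+1%:R * u = 2 * pi * K.+1%:R * (x - x0) - u.
  by rewrite /u -!natr1 -mul2n natrM; ring.
have -> : K.*2.+3%:R * u = 2 * pi * K.+1%:R * (x - x0) + u.
  by rewrite /u -!natr1 -mul2n natrM; ring.
rewrite sinB sinD; ring.
Qed.

(** The numerator of the Dirichlet kernel, normalized. These functions have half-integer frequencies
    and are not 1-periodic, but a product of two of them is a difference of cosines of integer
    frequencies, whence an orthonormal system on [0, 1]. *)
Definition odd_sine K (x : R) : R := Num.sqrt 2 * sin (K.*2.+1%:R * (pi * (x - x0))).

Lemma odd_sineE K (x : R) : odd_sine K x =
  Num.sqrt 2 * (dirichlet K x * sin (pi * (x - x0))).
Proof. by rewrite dirichletE. Qed.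

Lemma bndI_dirichlet K : bndI (dirichlet K).
Proof.
apply: bndI_sum => j; under eq_fun do rewrite mulrC.
by apply: bndIZ; exact: bndI_trig.
Qed.

Lemma continuous_sinpi : continuous (fun x : R => sin (pi * (x - x0))).
Proof.
move=> x; apply: continuous_comp; last exact: continuous_sin.
by apply: cvgM; [exact: cvg_cst|apply: cvgB; [exact: cvg_id|exact: cvg_cst]].
Qed.

Lemma bndI_odd_sine K : bndI (odd_sine K).
Proof.
rewrite (_ : odd_sine K = fun x => Num.sqrt 2 * (dirichlet K x * sin (pi * (x - x0)))).
  apply: bndIZ; apply: bndIM; first exact: bndI_dirichlet.
  exact/bndI_continuous/continuous_subspaceT/continuous_sinpi.
by apply/funext => x; rewrite odd_sineE.
Qed.

Let ip1cos n : ipI (cst 1) (fun x => cos (2 * pi * n.+1%:R * (x - x0))) = 0.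
Proof.
rewrite (@eq_ipI _ (cst 1) (trig 0) _ (fun x =>
   2^-1 * (trig n.*2.+1 x0 * trig n.*2.+1 x + trig n.*2.+2 x0 * trig n.*2.+2 x)))//; last first.
  by move=> x _; rewrite (mulrC (trig _ x0)) (mulrC (trig n.*2.+2 x0)) dirichlet_cos mulKf.
have b0 := @bndI_trig R 0.
rewrite ipIZr//; last by apply: bndID; apply: bndIZ; exact: bndI_trig.
rewrite ipIDr//; [|apply: bndIZ; exact: bndI_trig..].
by rewrite !ipIZr//; [|exact: bndI_trig..]; rewrite !trig_orthonormal/= !mulr0 addr0 mulr0.
Qed.

Let bcos n : bndI (fun x => cos (2 * pi * n%:R * (x - x0)) : R).
Proof.
apply/bndI_continuous/continuous_subspaceT => x; apply: continuous_comp; last exact: continuous_cos.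
by apply: cvgM; [exact: cvg_cst|apply: cvgB; [exact: cvg_id|exact: cvg_cst]].
Qed.

Lemma odd_sine_orthonormal K K' : ipI (odd_sine K) (odd_sine K') = (K == K')%:R.
Proof.
wlog KK' : K K' / (K <= K')%N.
  move=> H; have [/H//|/ltnW/H] := leqP K K'.
  by rewrite ipIC eq_sym.
pose c n (x : R) : R := cos (2 * pi * n%:R * (x - x0)).
have -> : ipI (odd_sine K) (odd_sine K') =
    ipI (cst 1) (fun x => c (K' - K)%N x - c (K' + K).+1 x).
  apply: eq_Rintegral => x _; rewrite /odd_sine (mulrACA (Num.sqrt 2)) -expr2 sqr_sqrtr//.
  rewrite /= mul1r /c.
  set u := pi * (x - x0).
  have -> : 2 * pi * (K' - K)%:R * (x - x0) = K'.*2.+1%:R * u - K.*2.+1%:R * u.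
    by rewrite natrB// /u -!natr1 -!mul2n !natrM; ring.
  have -> : 2 * pi * (K' + K).+1%:R * (x - x0) = K'.*2.+1%:R * u + K.*2.+1%:R * u.
    by rewrite /u -!natr1 -!mul2n !natrM natrD; ring.
  by rewrite cosB cosD; ring.
rewrite ipIBr; [|exact: bndI_cst|exact: bcos|exact: bcos].
rewrite ip1cos subr0; have [->|ne] := eqVneq K K'.
  rewrite /c subnn.
  rewrite (@eq_ipI _ (cst 1) (trig 0) _ (trig 0)) ?trig_orthonormal//.
  by move=> x _; rewrite mulr0 mul0r cos0.
have -> : (K' - K)%N = (K' - K).-1.+1 by lia.
exact: ip1cos.
Qed.

Variables h dh : R -> R.
Hypothesis Ch : C1I h dh.

Let bh : bndI h. Proof. by case: Ch => /bndI_continuous. Qed.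

Let g x : R := (h x - h x0) / sin (pi * (x - x0)).

(** As x0 is interior, pi |x - x0| stays below some V < pi on [0, 1], so x0 is the only zero of the
    sine. Together with the Lipschitz bound on h this makes the quotient [g] bounded. *)
Let normr_sinpi_ge : exists2 c : R, 0 < c &
  forall x, I x -> c * `|x - x0| <= `|sin (pi * (x - x0))|.
Proof.
move: x001; rewrite in_itv/= => /andP[x00 x01].
have pi0 := @pi_gt0 R.
pose V := pi * Num.max x0 (1 - x0).
have Vpi : V < pi by rewrite /V gtr_pMr// gt_max x01/=; lra.
have V0 : 0 < V by rewrite mulr_gt0// lt_max x00.
have c0 : 0 < cos (V / 2) by apply/cos_gt0_pihalf/andP; split; lra.
exists (pi * cos (V / 2) ^+ 3); first by rewrite mulr_gt0// exprn_gt0.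
move=> x; rewrite /I01/= in_itv/= => /andP[x_0 x_1].
have -> : `|sin (pi * (x - x0))| = `|sin (pi * `|x - x0|)|.
  have [_|_] := ger0P (x - x0); first by [].
  by rewrite mulrN sinN normrN.
have Hx : 0 <= pi * `|x - x0| <= V.
  rewrite mulr_ge0 ?(ltW pi0)//= /V ler_wpM2l ?(ltW pi0)// le_max.
  by have [_|_] := ger0P (x - x0); apply/orP; [right|left]; lra.
rewrite (le_trans _ (ler_norm _))//.
by have := sin_ge_linear Hx Vpi; rewrite mulrAC.
Qed.

Let bg : bndI g.
Proof.
split.
  apply: measurable_funM; first by apply: measurable_funB => //; case: bh.
  apply: measurableT_comp; first exact: measurable_invr.
  by apply: measurable_funTS; apply: continuous_measurable_fun; exact: continuous_sinpi.
have [M dhM] : exists M, forall x, I x -> `|dh x| <= M.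
  by case: Ch => _ /bndI_continuous[].
have hM := lipschitz_C1I Ch dhM.
have M0 : 0 <= M.
  by apply: le_trans (dhM 0 _) => //; rewrite /I01/= in_itv/= lexx ler01.
have [c c0 sc] := normr_sinpi_ge.
exists (M / c) => x Ix; rewrite /g normrM normfV.
have [->|xx0] := eqVneq x x0; first by rewrite subrr normr0 mul0r divr_ge0// ltW.
have xx00 : 0 < `|x - x0| by rewrite normr_gt0 subr_eq0.
rewrite ler_pdivrMr; last first.
  by rewrite (lt_le_trans _ (sc _ Ix))// mulr_gt0.
rewrite (le_trans (hM _ _ Ix _))//; first exact: subset_itv_oo_cc.
by rewrite -mulrA ler_wpM2l// ler_pdivlMl// sc.
Qed.

(** The Dirichlet kernel has integral 1, so the error at x0 is its inner product with h - h x0.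
    Moving the sine from the kernel to h - h x0 turns this into a coefficient of [g] in the system
    [odd_sine]. *)
Lemma partial_fourierE K :
  \sum_(j < K.*2.+1) ipI h (trig j) * trig j x0 =
  h x0 + (Num.sqrt 2)^-1 * ipI g (odd_sine K).
Proof.
transitivity (ipI h (dirichlet K)).
  rewrite ipI_sumr//; last first.
    by move=> j; under eq_fun do rewrite mulrC; apply: bndIZ; exact: bndI_trig.
  apply: eq_bigr => j _; rewrite mulrC -ipIZr//; last exact: bndI_trig.
  by apply: eq_ipI => // x _; rewrite mulrC.
have D1 : ipI (cst 1) (dirichlet K) = 1.
  rewrite (@eq_ipI _ (cst 1) (trig 0) _
    (fun x => \sum_(0 <= j < K.*2.+1) trig j x0 * trig j x))//; last first.
    by move=> x _; rewrite big_mkord; apply: eq_bigr => j _; rewrite mulrC.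
  rewrite (ipI_orthonormal_sum bndI_trig trig_orthonormal (fun j => trig j x0)).
    by rewrite mem_index_iota.
  exact: iota_uniq.
have bD := bndI_dirichlet K.
have D0 : h x0 = ipI (dirichlet K) (cst (h x0)).
  transitivity (h x0 * ipI (cst 1) (dirichlet K)); first by rewrite D1 mulr1.
  rewrite -ipIZr//; last exact: bndI_cst.
  by apply: eq_Rintegral => x _; rewrite /= mul1r mulrC.
apply/eqP; rewrite addrC -subr_eq [X in _ - X]D0 ipIC -ipIBr//; last exact: bndI_cst.
rewrite -(ipIZr (Num.sqrt 2)^-1 bg); last exact: bndI_odd_sine.
apply/eqP; apply: eq_Rintegral => x H /=.
rewrite odd_sineE mulKf; last by rewrite gt_eqF// sqrtr_gt0.
rewrite /g mulrCA.
have [xx0|xx0] := eqVneq x x0; first by rewrite xx0 !subrr !mul0r mulr0.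
rewrite mulrVK// unitfE; have [c c0 sc] := normr_sinpi_ge.
rewrite -normr_gt0 (lt_le_trans _ (sc x _))//; last by rewrite inE in H.
by rewrite mulr_gt0// normr_gt0 subr_eq0.
Qed.

(* Bessel's inequality for the system odd_sine makes the coefficients of
   (h - h x0) / sin (pi (x - x0)), a bounded function, tend to 0. *)
Lemma cvg_fourier :
  \sum_(j < K.*2.+1) ipI h (trig j) * trig j x0 @[K --> \oo] --> h x0.
Proof.
under eq_fun do rewrite partial_fourierE.
suff : h x0 + (Num.sqrt 2)^-1 * ipI g (odd_sine K) @[K --> \oo]
    --> h x0 + (Num.sqrt 2)^-1 * 0 by rewrite mulr0 addr0.
apply: cvgD; first exact: cvg_cst.
apply: cvgM; first exact: cvg_cst.
have : ipI g (odd_sine K) ^+ 2 @[K --> \oo] --> 0.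
  apply: cvg_series_cvg_0; apply: nondecreasing_is_cvgn.
    by apply: nondecreasing_series => k _ _; exact: sqr_ge0.
  exists (ipI g g) => _ [n _ <-]; rewrite /series/=.
  apply: (bessel bndI_odd_sine odd_sine_orthonormal) => //.
  exact: iota_uniq.
move=> /cvgrPdist_lt H; apply/cvgrPdist_lt => e e0.
have e20 : 0 < e ^+ 2 by rewrite exprn_gt0.
near=> K; have : `|0 - ipI g (odd_sine K) ^+ 2| < e ^+ 2 by near: K; exact: H.
by rewrite !sub0r !normrN normrX ltr_pXn2r// nnegrE ltW.
Unshelve. all: by end_near. Qed.

End at_point.

Variables h dh : R -> R.
Hypothesis Ch : C1I h dh.

Definition fcoef (h : R -> R) j := ipI h (trig j).

Definition fsum (h : R -> R) m (x : R) : R := \sum_(j < m) fcoef h j * trig j x.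

Lemma bndI_fsum k m : bndI (fsum k m).
Proof. by apply: bndI_sum => j; apply: bndIZ; exact: bndI_trig. Qed.

(** Fatou's lemma applied to the squared blocks [s K], which converge pointwise to the remainder.
    The integral is first moved to the open interval, since at the end points the series may miss
    h. *)
Lemma sqnorm_fourier_remainder m B :
  (forall M, (m <= M)%N -> odd M -> \sum_(m <= j < M) fcoef h j ^+ 2 <= B) ->
  ipI (fun x => h x - fsum h m x) (fun x => h x - fsum h m x) <= B.
Proof.
move=> HB; set r := fun x => h x - fsum h m x.
have br : bndI r by apply: bndIB; [case: Ch => /bndI_continuous|exact: bndI_fsum].
rewrite -lee_fin -ipI_EFin// (@integral_itv_bndoo _ 0 1 _ true false); last first.
  apply/measurable_EFinP; apply: measurable_funS (measurable_funM br.1 br.1).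
    exact: measurable_I01.
  exact: subset_itv_oo_cc.
(* The shift by m makes the upper index at least m for every K, while keeping it odd as in
   [cvg_fourier]. *)
pose s K x := \sum_(m <= j < (K + m).*2.+1) fcoef h j * trig j x.
have bs K : bndI (s K) by apply: bndI_sum => j; apply: bndIZ; exact: bndI_trig.
have sr (x : R) : x \in `]0, 1[ -> s K x @[K --> \oo] --> r x.
  move=> x01; have sE K : s K x = \sum_(j < (K + m).*2.+1) fcoef h j * trig j x - fsum h m x.
    rewrite /fsum -!(big_mkord predT (fun j => fcoef h j * trig j x)).
    rewrite (@big_cat_nat _ _ _ m 0 (K + m).*2.+1)//=; last lia.
    by rewrite addrAC subrr add0r.
  under eq_fun do rewrite sE.
  apply: cvgB; last exact: cvg_cst.
  have := cvg_fourier x01 Ch; rewrite -(cvg_shiftn m); exact.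
have mf K : measurable_fun `](0 : R), 1[ (fun x : R => (s K x * s K x)%:E).
  apply/measurable_EFinP; apply: measurable_funS (measurable_funM (bs K).1 (bs K).1).
    exact: measurable_I01.
  exact: subset_itv_oo_cc.
have f0 K (x : R) : `](0 : R), 1[%classic x -> (0 <= (s K x * s K x)%:E)%E.
  by move=> _; rewrite lee_fin -expr2 sqr_ge0.
have lE (x : R) : x \in `]0, 1[ ->
    limn_einf (fun K => (s K x * s K x)%:E) = (r x * r x)%:E.
  move=> x01; have c2 : s K x * s K x @[K --> \oo] --> r x * r x.
    by apply: cvgM; exact: sr.
  have [|-> //] := @cvg_limn_einf_sup R (fun K => (s K x * s K x)%:E) (r x * r x)%:E.
  by apply: cvg_EFin => //; exact: nearW.
have F := fatou mu (measurable_itv `](0 : R), 1[) mf f0.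
pose D : set R := `](0 : R), 1[%classic.
have E : (\int[mu]_(x in D) limn_einf (fun K => (s K x * s K x)%:E) =
    \int[mu]_(x in D) (r x * r x)%:E)%E.
  by apply: eq_integral => x /[!inE] /lE.
rewrite -E; apply: (le_trans F).
rewrite limn_einf_lim; apply: lime_le; first exact: is_cvg_einfs.
apply: nearW => K; rewrite /einfs/=.
apply: (@le_trans _ _ (\int[mu]_(x in `]0%R, 1%R[) (s K x * s K x)%:E)%E).
  by apply: ereal_inf_lbound; exists K => //=.
rewrite -(@integral_itv_bndoo _ 0 1 _ true false); last exact: mf.
rewrite ipI_EFin// lee_fin (sqnorm_orthonormal_sum bndI_trig trig_orthonormal) ?HB//.
- lia.
- by rewrite /= odd_double.
- exact: iota_uniq.
Qed.

End pointwise_fourier.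

(** * Periodic Sobolev functions *)

Section derivative_relative_to_I.
Context {R : realType}.
Local Notation I := (@I01 R).
Implicit Types (g k : R -> R) (x a : R).

Lemma I01P x : I x <-> 0 <= x <= 1.
Proof. by rewrite /I01/= in_itv/=. Qed.

(** Uniqueness of the limit in [derivI] rests on this: from any point of [0, 1] one can move by up
    to 1/2 in one direction without leaving it. *)
Lemma within_I01_proper x : I x -> ProperFilter (within I x^').
Proof.
move=> /I01P /andP[x0 x1]; apply: Build_ProperFilter_ex => A /nbhs_ballP[e /= e0 eA].
pose t := Num.min (e / 2) (1 / 2).
have t0 : 0 < t by rewrite lt_min !divr_gt0.
have te : t < e by rewrite gt_min ltr_pdivrMr// ltr_pMr// ltr1n.
have t1 : t <= 1 / 2 by rewrite ge_min lexx orbT.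
have [xh|xh] := leP x (1 / 2).
  exists (x + t); apply: eA.
  - by rewrite /ball/= opprD addrA subrr add0r normrN gtr0_norm.
  - by rewrite -subr_eq0 addrAC subrr add0r gt_eqF.
  - by apply/I01P; lra.
exists (x - t); apply: eA.
- by rewrite /ball/= opprB addrC subrK gtr0_norm.
- by rewrite -subr_eq0 addrAC subrr add0r oppr_eq0 gt_eqF.
- by apply/I01P; lra.
Qed.

(** Used to compute [phi'] up to the end points, with [k] a smooth extension, and to identify the
    derivative of b with [derivnI 1 b] on [0, 1]. *)
Lemma derivI_is_derive g k x a : I x -> (forall y, I y -> g y = k y) ->
  is_derive x 1 k a -> derivI g x = a.
Proof.
move=> Ix gk /is_derive1_caratheodory[G [kG cG Ga]].
have PF := within_I01_proper Ix.
apply: cvg_lim => //.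
apply/cvgrPdist_lt => e e0; rewrite -Ga.
move/cvgrPdist_lt : cG => /(_ _ e0); rewrite !near_withinE.
apply: filterS => y H yx Iy.
by rewrite /rateI !gk// kG mulfK// subr_eq0.
Qed.

Lemma derivableI_caratheodory g x : derivableI g x ->
  exists G, [/\ forall z, g z - g x = G z * (z - x), G x = derivI g x &
    G z @[z --> within I (nbhs x)] --> G x].
Proof.
move=> dg; pose G z := if z == x then derivI g x else rateI g x z.
exists G; split.
- move=> z; rewrite /G; case: eqP => [->|/eqP zx]; first by rewrite !subrr mulr0.
  by rewrite /rateI divfK// subr_eq0.
- by rewrite /G eqxx.
- rewrite [G x]/G eqxx; apply/cvgrPdist_lt => e e0.
  move/cvgrPdist_lt : dg => /(_ _ e0); rewrite -/(derivI g x).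
  rewrite !near_withinE; apply: filterS => z /= H Iz.
  by rewrite /G; case: eqP => [_|/eqP zx]; [rewrite subrr normr0|exact: H].
Qed.

Lemma derivableI_continuous g : (forall x, I x -> derivableI g x) ->
  {within I, continuous g}.
Proof.
move=> dg; apply/subspace_continuousP => x Ix.
have [G [gG Gx cG]] := derivableI_caratheodory (dg _ Ix).
suff : (fun z => g x + G z * (z - x)) @ within I (nbhs x) --> g x + G x * (x - x).
  rewrite subrr mulr0 addr0; under eq_fun do rewrite -gG addrC subrK.
  exact.
apply: cvgD; first exact: cvg_cst.
apply: cvgM => //; apply: cvgB; last exact: cvg_cst.
exact: cvg_within.
Qed.

Lemma derivableI_is_derive g x : x \in `]0, 1[ -> derivableI g x ->
  is_derive x 1 g (derivI g x).
Proof.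
move=> x01 /derivableI_caratheodory[G [gG Gx cG]].
apply/is_derive1_caratheodory; exists G; split => //.
apply: cvg_trans cG; apply: cvg_app => A /=.
rewrite /within/= => HA; near=> z; have : I z -> A z by near: z.
apply; apply: subset_itv_oo_cc => /=; near: z.
exact: near_in_itvoo.
Unshelve. all: by end_near. Qed.

End derivative_relative_to_I.

Section periodic_sobolev.
Context {R : realType}.
Local Notation I := (@I01 R).

Lemma fcoef_deriv (h dh : R -> R) j : C1I h dh -> h 0 = h 1 ->
  fcoef dh j = - (tw j * fcoef h (tau j)).
Proof.
move=> Ch h01; have [ch _ _] := Ch.
rewrite /fcoef -ipIZr; [|exact: bndI_continuous|exact: bndI_trig].
by rewrite (ibpI Ch (C1I_trig j)) trig_periodic h01 subrr sub0r opprK.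
Qed.

Lemma leq_tau m j : (m == 0) || odd m -> (m <= tau j)%N = (m <= j)%N.
Proof.
by case/orP => [/eqP ->|om]; [rewrite !leq0n|rewrite leqNgt tau_lt// -leqNgt].
Qed.

Lemma sum_tau (V : nmodType) (F : nat -> V) m M : (m == 0) || odd m -> odd M ->
  \sum_(m <= j < M) F (tau j) = \sum_(m <= j < M) F j.
Proof.
move=> om oM; rewrite -(big_map tau predT F); apply: perm_big.
apply: uniq_perm; rewrite ?map_inj_uniq ?iota_uniq//.
  exact: inv_inj tauK.
move=> j; apply/mapP/idP => [[i + ->]|jm].
  by rewrite !mem_index_iota leq_tau// tau_lt.
exists (tau j); last by rewrite tauK.
by move: jm; rewrite !mem_index_iota leq_tau// tau_lt.
Qed.

Lemma fcoef_tail (h dh : R -> R) m M : C1I h dh -> h 0 = h 1 -> odd m -> odd M ->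
  m%:R ^+ 2 * \sum_(m <= j < M) fcoef h j ^+ 2 <= \sum_(m <= j < M) fcoef dh j ^+ 2.
Proof.
(* Coefficient j of [dh] comes from coefficient [tau j] of [h], so the left sum is reindexed first;
   then [tw j] is at least m in absolute value on the tail. *)
move=> Ch h01 om oM; rewrite -(@sum_tau _ (fun j => fcoef h j ^+ 2)) ?om ?orbT// mulr_sumr.
rewrite !big_nat; apply: ler_sum => j /andP[mj jM].
rewrite (fcoef_deriv j Ch h01) sqrrN exprMn ler_wpM2r ?sqr_ge0//.
rewrite -[leRHS]real_normK ?num_real// lerXn2r ?nnegrE//.
by apply: le_trans (natr_le_normr_tw j); rewrite ler_nat.
Qed.

Lemma fsum_deriv (h dh : R -> R) m x : C1I h dh -> h 0 = h 1 -> odd m ->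
  fsum dh m x = \sum_(j < m) fcoef h j * (tw j * trig (tau j) x).
Proof.
move=> Ch h01 om; pose F j : R := fcoef h j * (tw j * trig (tau j) x).
rewrite /fsum -(big_mkord predT F) -(big_mkord predT (fun j => fcoef dh j * trig j x)).
have e j : fcoef dh j * trig j x = F (tau j).
  by rewrite /F tauK tw_tau (fcoef_deriv j Ch h01); ring.
by under eq_bigr do rewrite e; rewrite sum_tau.
Qed.

(** Cauchy-Schwarz: the increment is the inner product of [dh] with the indicator of [x, y], whose
    squared norm is at most 1. *)
Lemma sqr_increment_le (h dh : R -> R) x y : C1I h dh -> I x -> I y ->
  (h y - h x) ^+ 2 <= ipI dh dh.
Proof.
move=> Ch; wlog xy : x y / x <= y => [H Ix Iy|].
  by have [/H|/ltW/H] := leP x y; [exact|rewrite -sqrrN opprB; exact].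
move=> /I01P/andP[x0 x1] /I01P/andP[y0 y1].
move: xy; rewrite le_eqVlt => /predU1P[->|xy].
  by rewrite subrr expr0n/= ipI_ge0.
have [ch cdh dh01] := Ch; have bdh := bndI_continuous cdh.
have sI : `[x, y] `<=` I by apply: subset_itv; rewrite bnd_simp.
have cxy : {within `[x, y], continuous h} by exact: continuous_subspaceW ch.
have cdxy : {within `[x, y], continuous dh} by exact: continuous_subspaceW cdh.
have d01 z : z \in `]x, y[ -> is_derive z 1 h (dh z).
  rewrite in_itv/= => /andP[xz zy]; apply: dh01.
  by rewrite in_itv/=; apply/andP; split; lra.
pose i : R -> R := \1_(`[x, y]%classic).
have bi : bndI i.
  split; first exact: measurable_funTS (measurable_indic _).
  by exists 1 => z _; rewrite /i indicE; case: (_ \in _); rewrite ?normr0 ?normr1.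
have E : h y - h x = ipI dh i.
  have [_ hx hy] := (continuous_within_itvP h xy).1 cxy.
  have dLR : derivable_oo_LRcontinuous h x y by split => // z /d01[].
  have dE : {in `]x, y[, derive1 h =1 dh} by move=> z /d01 [_ <-]; rewrite derive1E.
  have /(congr1 fine)/= <- := continuous_FTC2 xy cdxy dLR dE.
  rewrite -[LHS]/(\int[lebesgue_measure]_(z in `[x, y]) dh z) /ipI.
  rewrite Rintegral_mkcond [RHS]Rintegral_mkcond; apply: eq_Rintegral => z _.
  rewrite /i !patchE indicE; case: ifPn => zxy; rewrite ?mulr1 ?mulr0 ?if_same//.
  by rewrite mem_set//; apply: sI; rewrite inE in zxy.
have i1 : ipI i i <= 1.
  have := @ipI_bound _ i 1 bi; rewrite expr1n; apply => z _.
  by rewrite /i indicE; case: (_ \in _); rewrite ?normr0 ?normr1.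
rewrite E; set a := ipI dh i.
have bai := bndIZ a bi.
(* Expanding gives |dh|^2 - 2 a^2 + a^2 |i|^2 >= 0, and |i|^2 <= 1. *)
have := ipI_ge0 (fun z => dh z - a * i z).
rewrite ipIBr//; last exact: bndIB.
rewrite (ipIC _ dh) (ipIC _ (fun z => a * i z)) !ipIBr// ipIZr// -/a.
rewrite (ipIC _ dh) ipIZr// -/a ipIZr// (ipIC _ i) ipIZr//.
have := sqr_ge0 a; nra.
Qed.

Section smooth_periodic.
Variables (h : nat -> R -> R) (beta : nat) (L : R).
Hypothesis beta1 : (1 < beta)%N.
Hypothesis L0 : 0 <= L.
Hypothesis Ch : forall r, (r < beta)%N -> C1I (h r) (h r.+1).
Hypothesis h01 : forall r, (r < beta)%N -> h r 0 = h r 1.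
Hypothesis hL : ipI (h beta) (h beta) <= L ^+ 2.

Let bh r : (r <= beta)%N -> bndI (h r).
Proof.
case: r => [|r] rb; first by have [/bndI_continuous] := Ch (ltnW beta1).
by have [_ /bndI_continuous] := Ch rb.
Qed.

Lemma sobolev_tail m M r s : odd m -> odd M -> (r + s = beta)%N ->
  m%:R ^+ (s.*2) * \sum_(m <= j < M) fcoef (h r) j ^+ 2 <= L ^+ 2.
Proof.
move=> om oM; elim: s r => [|s IH] r.
  rewrite addn0 => ->; rewrite expr0 mul1r (le_trans _ hL)//.
  by apply: (bessel bndI_trig trig_orthonormal); [exact: iota_uniq|exact: bh].
rewrite addnS -addSn => /[dup] rs /IH; apply: le_trans.
rewrite doubleS -addn2 exprD -mulrA ler_wpM2l ?exprn_ge0//.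
by apply: fcoef_tail => //; [apply: Ch|apply: h01]; lia.
Qed.

Lemma sobolev_approx m r : odd m -> (r < beta)%N ->
  ipI (fun x => h r x - fsum (h r) m x) (fun x => h r x - fsum (h r) m x)
    <= L ^+ 2 / m%:R ^+ (beta - r).*2.
Proof.
move=> om rb; apply: sqnorm_fourier_remainder; first exact: Ch.
move=> M mM oM; rewrite ler_pdivlMr ?exprn_gt0 ?ltr0n ?odd_gt0//.
by rewrite mulrC sobolev_tail// subnKC// ltnW.
Qed.

Lemma derivative_zero r : (r < beta)%N -> exists2 c : R, I c & h r.+1 c = 0.
Proof.
move=> rb; have [ch cdh dh01] := Ch rb.
have dh (x : R) : x \in `]0, 1[ -> derivable (h r) x 1 by move=> /dh01[].
have [c c01 [_ dc]] := Rolle ltr01 dh ch (h01 rb).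
exists c; first exact: subset_itv_oo_cc.
by have [_ <-] := dh01 _ c01.
Qed.

(** By Rolle and periodicity each derivative vanishes somewhere. At order beta - 1, the increment
    from the zero is at most the L^2 norm of [h beta], hence at most L. Going down in order,
    integrating from a zero over a length at most 1 preserves the bound. The range starts at r = 1
    because [h 0] may have no zero. *)
Lemma sobolev_sup r x : (0 < r < beta)%N -> I x -> `|h r x| <= L.
Proof.
case: r => // r /= rb Ix.
suff H s : forall r x, (r + s).+2 = beta -> I x -> `|h r.+1 x| <= L.
  by apply: (H (beta - r.+2)%N) => //; lia.
elim: s {r x rb Ix} => [|s IH] r x rs Ix.
  have rb : (r < beta)%N by lia.
  have [c Ic hc] := derivative_zero rb.
  rewrite -(@ler_pXn2r _ 2) ?nnegrE// real_normK ?num_real// (le_trans _ hL)//.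
  have rb1 : (r.+1 < beta)%N by lia.
  have := sqr_increment_le (Ch rb1) Ic Ix.
  by rewrite hc subr0 -rs addn0.
have rb : (r < beta)%N by lia.
have [c Ic hc] := derivative_zero rb.
have rb1 : (r.+1 < beta)%N by lia.
have dL y : I y -> `|h r.+2 y| <= L by apply: IH; lia.
have := lipschitz_C1I (Ch rb1) dL Ix Ic.
rewrite hc subr0 => /le_trans; apply.
rewrite ler_piMr//; move: Ix Ic => /I01P Ix /I01P Ic.
by rewrite ler_norml; lra.
Qed.

End smooth_periodic.

Lemma Wper_C1I (b : R -> R) beta L r : Wper beta L b -> (r < beta)%N ->
  C1I (derivnI r b) (derivnI r.+1 b).
Proof.
move=> [[db cb] _ _ _] rb.
have cont j : (j <= beta)%N -> {within I, continuous (derivnI j b)}.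
  rewrite leq_eqVlt => /predU1P[->//|jb].
  by apply: derivableI_continuous => x; exact: db.
split; [exact/cont/ltnW|exact: cont|].
by move=> x x01; apply: derivableI_is_derive => //; apply/db/subset_itv_oo_cc.
Qed.

Lemma Wper_norm (b : R -> R) beta L : (0 < beta)%N -> Wper beta L b ->
  ipI (derivnI beta b) (derivnI beta b) <= L ^+ 2.
Proof.
case: beta => // beta _ W; have [_ /bndI_continuous bb _] := Wper_C1I W (ltnSn _).
have [_ _ + _] := W.
rewrite -lee_fin -ipI_EFin//; exact: le_trans.
Qed.

End periodic_sobolev.

(** * Independence and concentration *)

Section change_of_law.
Local Open Scope ereal_scope.
Import HBNNSimple.

Section one_side.
Context d (T : measurableType d) d' (S : measurableType d') (R : realType).
Variables (mu : {measure set T -> \bar R}) (Z : T -> S) (H : T -> R).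
Hypothesis mZ : measurable_fun setT Z.
Hypothesis mH : measurable_fun setT H.
Hypothesis H0 : forall x, (0 <= H x)%R.

Lemma integral_nnsfun_law (h : {nnsfun S >-> R}) :
  \int[mu]_x (h (Z x) * H x)%:E =
  \sum_(y \in range h) y%:E * \int[mu]_(x in Z @^-1` (h @^-1` [set y])) (H x)%:E.
Proof.
have mi y : measurable (Z @^-1` (h @^-1` [set y])).
  by rewrite -[X in measurable X]setTI; exact: mZ.
pose HR y := (EFin \o H) \_ (Z @^-1` (h @^-1` [set y])).
transitivity (\int[mu]_x (\sum_(y \in range h) (y%:E * HR y x))).
  apply: eq_integral => x _.
  rewrite EFinM [in LHS](fimfunE h) -fsumEFin// ge0_mule_fsuml; last first.
    by move=> y; rewrite nnfun_muleindic_ge0.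
  apply: eq_fsbigr => y _; rewrite EFinM -muleA; congr (_ * _).
  rewrite /HR patchE indicE -[x \in _]/(Z x \in h @^-1` [set y]).
  by case: ifPn => _; rewrite ?mul1e ?mul0e.
have mR y : measurable_fun setT (HR y).
  by apply/(measurable_restrictT _ (mi y)).1/measurable_funTS/measurable_EFinP.
have R0 y x : 0 <= HR y x by apply: erestrict_ge0 => t _; rewrite lee_fin.
rewrite ge0_integral_fsum//; last 2 first.
- by move=> y; apply: measurable_funeM; exact: mR.
- move=> y x _; have [y0|y0] := leP 0%R y; first by rewrite mule_ge0 ?lee_fin.
  rewrite /HR patchE; case: ifPn => [|_]; last by rewrite mule0.
  by rewrite inE/= => E; move: y0; rewrite -E ltNge fun_ge0.
apply: eq_fsbigr => y; rewrite inE => -[s _ hy].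
have y0 : (0 <= y)%R by rewrite -hy.
by rewrite ge0_integralZl// [in RHS]integral_mkcond.
Qed.

Lemma cvg_integral_nnsfun_law (g : S -> R) (mg : measurable_fun setT (EFin \o g)) :
  (forall y, 0 <= g y)%R ->
  \int[mu]_x (nnsfun_approx measurableT mg n (Z x) * H x)%:E @[n --> \oo] -->
  \int[mu]_x (g (Z x) * H x)%:E.
Proof.
move=> g0; set h := nnsfun_approx measurableT mg.
have cg x : (g (Z x) * H x)%:E = lim ((h n (Z x) * H x)%:E @[n --> \oo]).
  apply/esym/cvg_lim => //; rewrite EFinM; under eq_fun do rewrite EFinM.
  by apply: cvgeZr => //; exact: (cvg_nnsfun_approx measurableT mg (fun y _ => g0 y)).
under eq_integral do rewrite cg.
apply: cvg_monotone_convergence => //.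
- move=> n; apply/measurable_EFinP/measurable_funM => //.
  by apply: measurableT_comp.
- by move=> n x _; rewrite lee_fin mulr_ge0.
- move=> x _ a b ab; rewrite lee_fin ler_wpM2r//.
  exact/lefP/nd_nnsfun_approx.
Qed.

End one_side.

(** Monotone approximation by simple functions extends the hypothesis from sets to [g]. The weights
    cover two uses: a density ([Z1] the identity, [H1] the density, [c] equal to 1) and independence
    ([Z1] equal to [Z2], [H2] equal to 1, [c] the mean of [H1]). *)
Lemma integral_law d1 (T1 : measurableType d1) d2 (T2 : measurableType d2)
    d' (S : measurableType d') (R : realType)
    (mu1 : {measure set T1 -> \bar R}) (mu2 : {measure set T2 -> \bar R})
    (Z1 : T1 -> S) (Z2 : T2 -> S) (H1 : T1 -> R) (H2 : T2 -> R) (c : R) (g : S -> R) :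
  measurable_fun setT Z1 -> measurable_fun setT Z2 ->
  measurable_fun setT H1 -> measurable_fun setT H2 ->
  (forall x, 0 <= H1 x)%R -> (forall x, 0 <= H2 x)%R -> (0 <= c)%R ->
  (forall A, measurable A -> \int[mu1]_(x in Z1 @^-1` A) (H1 x)%:E =
     c%:E * \int[mu2]_(x in Z2 @^-1` A) (H2 x)%:E) ->
  measurable_fun setT g -> (forall y, 0 <= g y)%R ->
  \int[mu1]_x (g (Z1 x) * H1 x)%:E = c%:E * \int[mu2]_x (g (Z2 x) * H2 x)%:E.
Proof.
move=> mZ1 mZ2 mH1 mH2 H10 H20 c0 H12 mg g0.
have mEg : measurable_fun setT (EFin \o g) by exact/measurable_EFinP.
have C1 := @cvg_integral_nnsfun_law _ _ _ _ _ mu1 _ _ mZ1 mH1 H10 g mEg g0.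
have C2 := @cvg_integral_nnsfun_law _ _ _ _ _ mu2 _ _ mZ2 mH2 H20 g mEg g0.
have := cvgeZl (isT : c%:E \is a fin_num) C2.
move=> /cvg_lim <- //; apply/esym/cvg_lim => //.
apply: cvg_trans C1; apply: near_eq_cvg; apply: nearW => n.
rewrite !integral_nnsfun_law//; set h := nnsfun_approx _ _ n.
rewrite ge0_mule_fsumr; last first.
  move=> y; have [y0|y0] := leP 0%R y.
    by rewrite mule_ge0 ?lee_fin// integral_ge0// => x _; rewrite lee_fin.
  rewrite [X in _ * X](_ : _ = 0) ?mule0//.
  rewrite (_ : _ @^-1` _ = set0) ?integral_set0//.
  apply/seteqP; split => // x /= E; move: y0; rewrite -E ltNge.
  by rewrite fun_ge0.
apply: eq_fsbigr => y _; rewrite muleCA H12//.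
Qed.

End change_of_law.

Section independence_tools.
Context d (T : measurableType d) (R : realType) (P : probability T R).
Local Open Scope ereal_scope.

Lemma integral_factor (Z H : T -> R) (c : R) (g : R -> R) :
  measurable_fun setT Z -> measurable_fun setT H ->
  (forall x, 0 <= H x)%R -> (0 <= c)%R ->
  (forall A, measurable A -> \int[P]_(x in Z @^-1` A) (H x)%:E = c%:E * P (Z @^-1` A)) ->
  measurable_fun setT g -> (forall y, 0 <= g y)%R ->
  \int[P]_x (g (Z x) * H x)%:E = c%:E * \int[P]_x (g (Z x))%:E.
Proof.
move=> mZ mH H0 c0 HA mg g0.
rewrite (@integral_law _ _ _ _ _ _ _ P P Z Z H (cst 1%R) c g)//.
  by under [in LHS]eq_integral do rewrite mulr1.
move=> A mA; rewrite HA//; congr (_ * _).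
rewrite -[LHS]mul1e -integral_cst//.
by rewrite -[X in measurable X]setTI; exact: mZ.
Qed.

Lemma integral_bigprod_indep n (Z : 'I_n -> T -> R) (g : 'I_n -> R -> R) :
  (forall i, measurable_fun setT (Z i)) ->
  (forall A : 'I_n -> set R, (forall i, measurable (A i)) ->
    P (\bigcap_i (Z i @^-1` A i)) = \prod_(i < n) P (Z i @^-1` A i)) ->
  (forall i, measurable_fun setT (g i)) -> (forall i y, 0 <= g i y)%R ->
  (forall i, \int[P]_x (g i (Z i x))%:E < +oo) ->
  \int[P]_x (\prod_(i < n) g i (Z i x))%:E = \prod_(i < n) \int[P]_x (g i (Z i x))%:E.
Proof.
move=> mZ indep mg0 g00 gfin0.
have mZA i A : measurable A -> measurable (Z i @^-1` A).
  by move=> mA; rewrite -[X in measurable X]setTI; exact: mZ.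
(* Induction on k, the factors of index at least k being indicators. For k = 0 this is the
   independence of events. In the inductive step factor k becomes free: [HE] replaces it by an
   indicator, where the induction hypothesis applies, and [integral_factor] with the remaining
   product as weight extends the result to a general function. *)
suff H k (F : 'I_n -> R -> R) : (forall i, measurable_fun setT (F i)) ->
    (forall i y, 0 <= F i y)%R -> (forall i, \int[P]_x (F i (Z i x))%:E < +oo) ->
    (forall i : 'I_n, (k <= i)%N -> exists2 A, measurable A & F i = \1_A) ->
    \int[P]_x (\prod_(i < n) F i (Z i x))%:E = \prod_(i < n) \int[P]_x (F i (Z i x))%:E.
  by apply: (H n) => // i; rewrite leqNgt ltn_ord.
have indicZ i A x : (\1_A (Z i x) : R) = \1_(Z i @^-1` A) x by rewrite !indicE.
elim: k F => [|k IH] F mF F0 finF FA.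
  have [A HA] := @choice _ _ (fun i A => measurable A /\ F i = \1_A)
    (fun i => let: ex_intro2 A mA e := FA i (leq0n _) in ex_intro _ A (conj mA e)).
  under [RHS]eq_bigr => i _.
    under eq_integral do rewrite (HA i).2 indicZ.
    rewrite integral_indic ?setIT; [over|exact: measurableT|apply: mZA; exact: (HA i).1].
  rewrite -indep; last by move=> i; exact: (HA i).1.
  rewrite -[X in _ = P X]setIT -integral_indic//; last first.
    by apply: fin_bigcap_measurable => // i _; apply: mZA; exact: (HA i).1.
  apply: eq_integral => x _; congr EFin.
  under eq_bigr do rewrite (HA _).2 indicZ indicE.
  rewrite indicE; have [xA|xA] := boolP (x \in \bigcap_i Z i @^-1` A i).
    by rewrite big1// => i _; rewrite mem_set//; rewrite inE in xA; exact: xA.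
  move: xA; rewrite notin_setE /bigcap/= => /existsNP[i /not_implyP[_ xi]].
  by rewrite (bigD1 i)//= memNset// mul0r.
have [nk|kn] := leqP n k.
  by apply: IH => // i /(leq_trans nk); rewrite leqNgt ltn_ord.
pose i0 := Ordinal kn.
have rest0 x : (0 <= \prod_(i < n | i != i0) F i (Z i x))%R by exact: prodr_ge0.
have mrest : measurable_fun setT (fun x => \prod_(i < n | i != i0) F i (Z i x))%R.
  rewrite (_ : (fun x => _) = fun x => \prod_(i <- [seq i <- index_enum 'I_n | i != i0]) F i (Z i x))%R.
    by apply: measurable_prod => i _; apply: measurableT_comp.
  by apply/funext => x; rewrite big_filter.
pose c := \prod_(i < n | i != i0) \int[P]_x (F i (Z i x))%:E.
have c0 : 0 <= c by apply: prode_ge0 => i _; apply: integral_ge0 => x _; rewrite lee_fin.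
have cfin : c \is a fin_num.
  apply: prode_fin_num => i _; rewrite ge0_fin_numE//.
  by apply: integral_ge0 => x _; rewrite lee_fin.
have HE A : measurable A -> \int[P]_(x in Z i0 @^-1` A)
    (\prod_(i < n | i != i0) F i (Z i x))%:E = (fine c)%:E * P (Z i0 @^-1` A).
  move=> mA; pose F' i := if i == i0 then \1_A else F i.
  have e1 : \int[P]_x (F' i0 (Z i0 x))%:E = P (Z i0 @^-1` A).
    under eq_integral do rewrite /F' eqxx indicZ.
    by rewrite integral_indic ?setIT//; exact: mZA.
  have mF' i : measurable_fun setT (F' i).
    by rewrite /F'; case: eqP => // _; exact: measurable_indic.
  have F'0 i y : (0 <= F' i y)%R by rewrite /F'; case: eqP => // _; rewrite indicE.
  have finF' i : \int[P]_x (F' i (Z i x))%:E < +oo.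
    have [->|ii0] := eqVneq i i0; last by rewrite /F' (negbTE ii0).
    by rewrite e1 (le_lt_trans (probability_le1 _ _)) ?ltry//; exact: mZA.
  have F'A (i : 'I_n) : (k <= i)%N -> exists2 A, measurable A & F' i = \1_A.
    move=> ki; rewrite /F'; case: eqP => [_|/eqP ii0]; first by exists A.
    apply: FA; rewrite ltn_neqAle ki andbT; apply: contra_neq ii0 => ki0.
    exact: val_inj.
  have := IH F' mF' F'0 finF' F'A; rewrite (bigD1 i0)//= e1 fineK// muleC.
  have -> : \prod_(i < n | i != i0) \int[P]_x (F' i (Z i x))%:E = c.
    by apply: eq_bigr => i ii0; rewrite /F' (negbTE ii0).
  move=> <-; rewrite integral_mkcond; apply: eq_integral => x _.
  have -> : (\prod_(i < n) F' i (Z i x) =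
      \1_A (Z i0 x) * \prod_(i < n | i != i0) F i (Z i x))%R.
    rewrite (bigD1 i0)//= /F' eqxx; congr (_ * _)%R.
    by apply: eq_bigr => i ii0; rewrite (negbTE ii0).
  by rewrite patchE indicZ indicE; case: ifPn => _; rewrite ?mul0r// mul1r.
rewrite [RHS](bigD1 i0)//= -/c muleC -(fineK cfin) -(integral_factor _ mrest rest0 _ HE)//.
- by apply: eq_integral => x _; rewrite (bigD1 i0).
- exact: fine_ge0.
Qed.

End independence_tools.

(** * Exponential concentration and centered products *)

Section concentration.
Context d (T : measurableType d) (R : realType) (P : probability T R).
Implicit Types (f g : T -> R).

Local Notation intble f := (P.-integrable setT (EFin \o f)).

Lemma EFin_Rintegral f : intble f ->
  (\int[P]_x (f x)%:E)%E = (\int[P]_x f x)%:E.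
Proof. by move=> fi; rewrite /Rintegral fineK// integrable_fin_num. Qed.

Lemma bounded_intble f M : measurable_fun setT f -> (forall x, `|f x| <= M) -> intble f.
Proof.
move=> mf fM; apply: measurable_bounded_integrable => //.
  by rewrite [X in (X < _)%E]probability_setT ltry.
by exists M; split; [exact: num_real|move=> y My x _; exact: le_trans (fM x) (ltW My)].
Qed.

Lemma Rintegral_prob_cst (c : R) : \int[P]_x c = c.
Proof. by rewrite Rintegral_cst// [X in fine X]probability_setT mulr1. Qed.

Lemma intbleD f g : intble f -> intble g -> intble (fun x => f x + g x).
Proof. exact: integrableD. Qed.

Lemma intbleZ (c : R) f : intble f -> intble (fun x => c * f x).
Proof. exact: integrableZl. Qed.

Lemma intble_cst (c : R) : intble (cst c).
Proof. by apply: (@bounded_intble _ `|c|). Qed.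

Lemma intble_sum (J : eqType) (s : seq J) (F : J -> T -> R) :
  (forall i, intble (F i)) -> intble (fun x => \sum_(i <- s) F i x).
Proof.
move=> FI; rewrite (_ : EFin \o _ = fun x => (\sum_(i <- s) (F i x)%:E)%E).
  by apply: integrable_sum => // i _; exact: FI.
by apply/funext => x /=; rewrite sumEFin.
Qed.

Lemma Rintegral_sum (J : eqType) (s : seq J) (F : J -> T -> R) :
  (forall i, intble (F i)) ->
  \int[P]_x (\sum_(i <- s) F i x) = \sum_(i <- s) \int[P]_x F i x.
Proof.
move=> FI; elim: s => [|i s IH].
  rewrite big_nil -[RHS](Rintegral_prob_cst 0).
  by apply: eq_Rintegral => x _; rewrite big_nil.
rewrite big_cons -IH -RintegralD//; last exact: intble_sum.
by apply: eq_Rintegral => x _; rewrite big_cons.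
Qed.

(** exp x <= 1 / (1 - x), and (1 - x) (1 + x + 2 x^2) = 1 + x^2 (1 - 2 x) is at least 1 for x <=
    1/2. *)
Lemma expR_le_quadratic (x : R) : `|x| <= 1 / 2 -> expR x <= 1 + x + 2 * x ^+ 2.
Proof.
rewrite ler_norml => /andP[x1 x2].
have e1 : 1 - x <= expR (- x) by exact: expR_ge1Dx.
have x0 : 0 < 1 - x by lra.
rewrite -[x in expR x]opprK expRN.
apply: (@le_trans _ _ (1 - x)^-1); first by rewrite lef_pV2 ?posrE ?expR_gt0.
rewrite -[leLHS]mul1r ler_pdivrMr//.
have : 0 <= x ^+ 2 * (1 - 2 * x) by rewrite mulr_ge0 ?sqr_ge0//; lra.
by lra.
Qed.

(** The bounds 4 and 1/8 give |s Y| <= 1/2, the range of the quadratic bound. Its linear term has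
    mean 0 and its quadratic term is at most 2 (4 s)^2 = 32 s^2. *)
Lemma exp_moment_bounded (Y : T -> R) (s : R) : measurable_fun setT Y ->
  (forall x, `|Y x| <= 4) -> \int[P]_x Y x = 0 -> `|s| <= 1 / 8 ->
  (\int[P]_x (expR (s * Y x))%:E <= (expR (32 * s ^+ 2))%:E)%E.
Proof.
move=> mY Y4 Y0 s8.
have IY := bounded_intble mY Y4.
have sY x : `|s * Y x| <= 1 / 2.
  rewrite normrM (_ : 1 / 2 = 1 / 8 * 4); last by field.
  by apply: ler_pM.
have mexp : measurable_fun setT (fun x => expR (s * Y x)).
  by apply: measurableT_comp => //; exact: measurable_funM.
rewrite EFin_Rintegral; last first.
  apply: (@bounded_intble _ (expR (1 / 2))) => // x.
  by rewrite ger0_norm ?expR_ge0// ler_expR (le_trans (ler_norm _)).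
rewrite lee_fin; apply: (@le_trans _ _ (\int[P]_x ((1 + 32 * s ^+ 2) + s * Y x))).
  apply: le_Rintegral => //.
  - apply: (@bounded_intble _ (expR (1 / 2))) => // x.
    by rewrite ger0_norm ?expR_ge0// ler_expR (le_trans (ler_norm _)).
  - by apply: intbleD; [exact: intble_cst|exact: intbleZ].
  - move=> x _; rewrite (le_trans (expR_le_quadratic (sY x)))//.
    have : (s * Y x) ^+ 2 <= (4 * s) ^+ 2.
      rewrite !exprMn mulrC ler_wpM2r ?sqr_ge0// -real_normK ?num_real//.
      by rewrite lerXn2r ?nnegrE.
    by rewrite exprMn; lra.
rewrite RintegralD//; [|exact: intble_cst|exact: intbleZ].
rewrite Rintegral_prob_cst RintegralZl// Y0 mulr0 addr0.
exact: expR_ge1Dx.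
Qed.

Section hoeffding.
Variables (n : nat) (X : 'I_n -> T -> R) (g : R -> R) (mean : R).
Hypothesis n0 : (0 < n)%N.
Hypothesis mX : forall i, measurable_fun setT (X i).
Hypothesis indep : forall A : 'I_n -> set R, (forall i, measurable (A i)) ->
  P (\bigcap_i (X i @^-1` A i)) = (\prod_(i < n) P (X i @^-1` A i))%E.
Hypothesis mg : measurable_fun setT g.
Hypothesis g2 : forall x, `|g x| <= 2.
Hypothesis gmean : forall i, \int[P]_x g (X i x) = mean.

Let mgX i : measurable_fun setT (fun x => g (X i x)).
Proof. exact: measurableT_comp. Qed.

Let gX2 i x : `|g (X i x)| <= 2. Proof. exact: g2. Qed.

Let mean2 : `|mean| <= 2.
Proof.
have i0 : 'I_n by exact: Ordinal n0.
rewrite -(gmean i0); apply: (le_trans (le_normr_Rintegral _ _)) => //.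
  exact: bounded_intble (mgX i0) (gX2 i0).
apply: (@le_trans _ _ (\int[P]_x 2)); last by rewrite Rintegral_prob_cst.
apply: le_Rintegral => //; last exact: intble_cst.
apply: (@bounded_intble _ 2) => [|x]; last by rewrite normr_id.
by apply: measurableT_comp.
Qed.

Let Y i x := g (X i x) - mean.

Let mY i : measurable_fun setT (Y i).
Proof. by apply: measurable_funB. Qed.

Let Y4 i x : `|Y i x| <= 4.
Proof.
rewrite (le_trans (ler_normB _ _))// (_ : 4 = 2 + 2); last by ring.
by rewrite lerD.
Qed.

Let Y0 i : \int[P]_x Y i x = 0.
Proof.
rewrite RintegralB//; last 2 first.
- exact: bounded_intble (mgX i) (gX2 i).
- exact: intble_cst.
by rewrite gmean Rintegral_prob_cst subrr.
Qed.

Let msum (c : R) : measurable_fun setT (fun x => expR (c * \sum_(i < n) Y i x)).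
Proof.
apply: measurableT_comp => //; apply: measurable_funM => //.
by apply: measurable_sum.
Qed.

Let exp_sum (s : R) : `|s| <= 1 / 8 ->
  (\int[P]_x (expR (s * \sum_(i < n) Y i x))%:E <= (expR (n%:R * (32 * s ^+ 2)))%:E)%E.
Proof.
move=> s8; pose G (i : 'I_n) y := expR (s * (g y - mean)).
have mG i : measurable_fun setT (G i).
  apply: measurableT_comp => //; apply: measurable_funM => //.
  exact: measurable_funB.
have E i : (\int[P]_x (G i (X i x))%:E <= (expR (32 * s ^+ 2))%:E)%E.
  exact: exp_moment_bounded (mY i) (Y4 i) (Y0 i) s8.
rewrite (_ : (\int[P]_x _)%E = \int[P]_x (\prod_(i < n) G i (X i x))%:E)%E; last first.
  by apply: eq_integral => x _; rewrite mulr_sumr expR_sum.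
rewrite (integral_bigprod_indep mX indep mG); last 2 first.
- by move=> i y; exact: expR_ge0.
- by move=> i; rewrite (le_lt_trans (E i))// ltry.
rewrite expRM_natl -[X in (_ ^+ X)%R]card_ord -prodr_const -prodEFin.
suff /andP[] : (0 <= \prod_(i < n) \int[P]_x (G i (X i x))%:E <=
    \prod_(i < n) (expR (32 * s ^+ 2))%:E)%E by [].
elim/big_ind2 : _ => [|x1 x2 y1 y2 /andP[? ?] /andP[? ?]|i _]; first by rewrite lexx lee01.
  by rewrite mule_ge0//= lee_pmul.
by rewrite E andbT integral_ge0// => x _; rewrite lee_fin expR_ge0.
Qed.

Lemma hoeffding_type (t : R) : 0 < t <= 8 ->
  (P [set x : T | (t < `|n%:R^-1 * (\sum_(i < n) g (X i x)) - mean|)%R]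
     <= (2 * expR (- (n%:R * t ^+ 2 / 128)))%:E)%E.
Proof.
move=> /andP[t0 t8]; set A := [set x | _].
have nR : 0 < n%:R :> R by rewrite ltr0n.
pose W (x : T) : R := \sum_(i < n) Y i x.
have WE (x : T) : n%:R^-1 * (\sum_(i < n) g (X i x)) - mean = n%:R^-1 * W x.
  rewrite /W /Y sumrB sumr_const card_ord mulrBr -[X in _ - _ * X]mulr_natl mulKf//.
  by rewrite gt_eqF.
have mA : measurable A.
  rewrite (_ : A = (fun x => `|n%:R^-1 * W x|) @^-1` `]t, +oo[); last first.
    by apply/seteqP; split => x; rewrite /A/= in_itv/= andbT WE.
  rewrite -[X in measurable X]setTI.
  have mW : measurable_fun setT (fun x => `|n%:R^-1 * W x|).
    apply: measurableT_comp => //; apply: measurable_funM => //.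
    exact: measurable_sum.
  exact: mW.
(* The minimizer of 32 s^2 - s t, with minimum - t^2 / 128; t <= 8 keeps s <= 1/8. *)
pose s := t / 64.
have s0 : 0 < s by rewrite divr_gt0.
have s8 : `|s| <= 1 / 8 by rewrite gtr0_norm// /s; lra.
have s8' : `|- s| <= 1 / 8 by rewrite normrN.
pose c := expR (- (s * (n%:R * t))).
have := @integral_indic _ _ _ P setT measurableT _ mA.
rewrite setIT => <-.
have mE (r : R) : measurable_fun setT (fun x => (expR (r * W x))%:E).
  by apply/measurable_EFinP; exact: msum.
(* Chernoff's bound as a pointwise domination of the indicator of [A]; the sum of two exponentials
   covers both signs of [W]. *)
apply: (@le_trans _ _ (\int[P]_x (c%:E * ((expR (s * W x))%:E + (expR (- s * W x))%:E)))%E).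
  apply: ge0_le_integral => //.
  - by apply/measurable_EFinP; exact: measurable_indic.
  - by apply: measurable_funeM; apply: emeasurable_funD; exact: mE.
  - move=> x _; rewrite -EFinD -EFinM lee_fin indicE.
    case: (boolP (x \in A)) => [|_]; last by rewrite mulr_ge0 ?addr_ge0 ?expR_ge0.
    rewrite inE /A/= WE normrM gtr0_norm ?invr_gt0// mulrC ltr_pdivlMr// => tW.
    have key r : t * n%:R <= r -> 1 <= c * expR (s * r).
      move=> nr; rewrite /c -expRD -[leLHS]expR0 ler_expR.
      have -> : - (s * (n%:R * t)) + s * r = s * (r - t * n%:R) by ring.
      by rewrite mulr_ge0 ?subr_ge0// ltW.
    rewrite mulrDr; have [W0|W0] := ger0P (W x).
      rewrite ger0_norm// in tW.
      by rewrite (le_trans (key _ (ltW tW)))// lerDl mulr_ge0 ?expR_ge0.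
    rewrite ltr0_norm// in tW.
    rewrite mulNr -mulrN (le_trans (key _ (ltW tW)))// lerDr mulr_ge0 ?expR_ge0//.
have e0 (r : R) x : (0 <= (expR (r * W x))%:E)%E by rewrite lee_fin expR_ge0.
have mEE : measurable_fun setT (fun x => (expR (s * W x))%:E + (expR (- s * W x))%:E)%E.
  by apply: emeasurable_funD; exact: mE.
rewrite (ge0_integralZl P measurableT mEE); last 2 first.
- by move=> x _; rewrite adde_ge0.
- by rewrite lee_fin expR_ge0.
rewrite (ge0_integralD P measurableT (fun x _ => e0 s x) (mE s) (fun x _ => e0 (- s) x) (mE (- s))).
have -> : 2 * expR (- (n%:R * t ^+ 2 / 128)) =
    c * (expR (n%:R * (32 * s ^+ 2)) + expR (n%:R * (32 * (- s) ^+ 2))).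
  have -> : (- s) ^+ 2 = s ^+ 2 by rewrite sqrrN.
  transitivity (2 * (c * expR (n%:R * (32 * s ^+ 2)))); last by ring.
  rewrite /c -expRD; congr (2 * expR _).
  by rewrite /s; field.
rewrite EFinM lee_wpmul2l ?lee_fin ?expR_ge0// EFinD.
by apply: leeD; exact: exp_sum.
Qed.

End hoeffding.

Section centered_product.
Definition posp (y : R) := Num.max y 0.
Definition negp (y : R) := Num.max (- y) 0.

Lemma posp_ge0 y : 0 <= posp y. Proof. by rewrite le_max lexx orbT. Qed.
Lemma negp_ge0 y : 0 <= negp y. Proof. by rewrite le_max lexx orbT. Qed.

Lemma pospBnegp y : posp y - negp y = y.
Proof. by rewrite /posp /negp /Num.max; case: ltP => ?; case: ltP => ?; lra. Qed.

Lemma posp_le y : posp y <= `|y|.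
Proof. by rewrite /posp ge_max ler_norm normr_ge0. Qed.
Lemma negp_le y : negp y <= `|y|.
Proof. by rewrite /negp ge_max -normrN ler_norm normr_ge0. Qed.

Lemma measurable_posp : measurable_fun setT posp.
Proof. exact: measurable_maxr. Qed.
Lemma measurable_negp : measurable_fun setT negp.
Proof. by apply: measurable_maxr => //; exact: measurable_funN. Qed.

Variables U W Z : T -> R.
Hypothesis mU : measurable_fun setT U.
Hypothesis mW : measurable_fun setT W.
Hypothesis mZ : measurable_fun setT Z.
Hypothesis indep : forall A B C : set R, measurable A -> measurable B -> measurable C ->
  P (U @^-1` A `&` W @^-1` B `&` Z @^-1` C) =
  (P (U @^-1` A) * P (W @^-1` B) * P (Z @^-1` C))%E.
Hypothesis IU : intble U.
Hypothesis IW : intble W.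
Hypothesis IZ : intble Z.
Hypothesis Z0 : \int[P]_x Z x = 0.

(** The third entry is the default value of [nth]. *)
Let V (i : 'I_3) : T -> R := nth Z [:: U; W] i.

Let indepV (A : 'I_3 -> set R) : (forall i, measurable (A i)) ->
  P (\bigcap_i (V i @^-1` A i)) = (\prod_(i < 3) P (V i @^-1` A i))%E.
Proof.
move=> mA; rewrite !big_ord_recl big_ord0 mule1 muleA.
rewrite -indep//; congr (P _); apply/seteqP; split => x /=.
  by move=> H; split; [split|]; exact: H.
move=> [[H0 H1] H2] [[|[|[|//]]] i3] _.
- by rewrite (_ : Ordinal i3 = ord0)//; exact: val_inj.
- by rewrite (_ : Ordinal i3 = lift ord0 ord0)//; exact: val_inj.
- by rewrite (_ : Ordinal i3 = lift ord0 (lift ord0 ord0))//; exact: val_inj.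
Qed.

Let half_intble (f : T -> R) (h : R -> R) : measurable_fun setT f -> intble f ->
  measurable_fun setT h -> (forall y, 0 <= h y <= `|y|) -> intble (fun x => h (f x)).
Proof.
move=> mf If mh hle; apply: le_integrable If => //.
  by apply/measurable_EFinP; exact: measurableT_comp.
by move=> x _ /=; rewrite lee_fin ger0_norm; have /andP[] := hle (f x).
Qed.

Let prodE (h1 h2 h3 : R -> R) : measurable_fun setT h1 -> measurable_fun setT h2 ->
  measurable_fun setT h3 -> (forall y, 0 <= h1 y <= `|y|) ->
  (forall y, 0 <= h2 y <= `|y|) -> (forall y, 0 <= h3 y <= `|y|) ->
  (\int[P]_x (h1 (U x) * h2 (W x) * h3 (Z x))%:E =
    (\int[P]_x h1 (U x) * \int[P]_x h2 (W x) * \int[P]_x h3 (Z x))%:E)%E.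
Proof.
move=> m1 m2 m3 b1 b2 b3; pose h (i : 'I_3) : R -> R := nth h3 [:: h1; h2] i.
have mV i : measurable_fun setT (V i) by case: i => [[|[|[|//]]] ?].
have mh i : measurable_fun setT (h i) by case: i => [[|[|[|//]]] ?].
have bh i y : 0 <= h i y <= `|y| by case: i => [[|[|[|//]]] ?]; rewrite /h/=.
have IV i : intble (V i) by case: i => [[|[|[|//]]] ?].
have IhV i : intble (fun x => h i (V i x)) by apply: half_intble.
have := integral_bigprod_indep mV indepV mh (fun i y => proj1 (andP (bh i y))).
have fin i : (\int[P]_x (h i (V i x))%:E < +oo)%E.
  by rewrite EFin_Rintegral ?ltry//; exact: IhV.
move=> /(_ fin); rewrite !big_ord_recl big_ord0 mule1.
rewrite (EFin_Rintegral (IhV ord0)) (EFin_Rintegral (IhV (lift ord0 ord0))).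
rewrite (EFin_Rintegral (IhV (lift ord0 (lift ord0 ord0)))) muleA -!EFinM => <-.
by apply: eq_integral => x _; rewrite !big_ord_recl big_ord0 mulr1 mulrA.
Qed.

(** The factorization of integrals is available for nonnegative functions, so the three variables
    are split into positive and negative parts. The two parts of Z have equal means, which cancels
    the products in pairs. In use, U depends on the design, and W and Z are noises at different
    indices. *)
Lemma integral_centered_product :
  intble (fun x => U x * W x * Z x) /\ \int[P]_x (U x * W x * Z x) = 0.
Proof.
have bp y : 0 <= posp y <= `|y| by rewrite posp_ge0 posp_le.
have bn y : 0 <= negp y <= `|y| by rewrite negp_ge0 negp_le.
have mp := measurable_posp; have mn := measurable_negp.
have pn : \int[P]_x posp (Z x) = \int[P]_x negp (Z x).
  apply/eqP; rewrite -subr_eq0 -RintegralB//; try exact: half_intble.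
  rewrite -[X in _ == X]Z0; apply/eqP; apply: eq_Rintegral => x _.
  exact: pospBnegp.
have H (h1 h2 : R -> R) : measurable_fun setT h1 -> measurable_fun setT h2 ->
    (forall y, 0 <= h1 y <= `|y|) -> (forall y, 0 <= h2 y <= `|y|) ->
    intble (fun x => h1 (U x) * h2 (W x) * Z x) /\
    \int[P]_x (h1 (U x) * h2 (W x) * Z x) = 0.
  move=> m1 m2 b1 b2.
  have I3 (h3 : R -> R) : measurable_fun setT h3 -> (forall y, 0 <= h3 y <= `|y|) ->
      intble (fun x => h1 (U x) * h2 (W x) * h3 (Z x)).
    move=> m3 b3; apply/integrableP; split.
      apply/measurable_EFinP; apply: measurable_funM; last exact: measurableT_comp.
      by apply: measurable_funM; exact: measurableT_comp.
    under eq_integral => x _.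
      rewrite gee0_abs; last first.
        rewrite lee_fin !mulr_ge0//; first by have /andP[] := b1 (U x).
          by have /andP[] := b2 (W x).
        by have /andP[] := b3 (Z x).
      over.
    by rewrite prodE// ltry.
  have E : (fun x => h1 (U x) * h2 (W x) * Z x) =
     (fun x => h1 (U x) * h2 (W x) * posp (Z x) - h1 (U x) * h2 (W x) * negp (Z x)).
    by apply/funext => x; rewrite -mulrBr pospBnegp.
  have Ip := I3 _ mp bp; have In := I3 _ mn bn.
  split; first by rewrite E; exact: (integrableB measurableT Ip In).
  rewrite E RintegralB//; rewrite /Rintegral !prodE//= pn.
  by rewrite subrr.
have [[I1 E1] [I2 E2]] := (H _ _ mp mp bp bp, H _ _ mp mn bp bn).
have [[I3 E3] [I4 E4]] := (H _ _ mn mp bn bp, H _ _ mn mn bn bn).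
have E : (fun x => U x * W x * Z x) = (fun x =>
   (posp (U x) * posp (W x) * Z x - posp (U x) * negp (W x) * Z x) -
   (negp (U x) * posp (W x) * Z x - negp (U x) * negp (W x) * Z x)).
  by apply/funext => x; rewrite -{1}(pospBnegp (U x)) -{1}(pospBnegp (W x)); ring.
have I12 := integrableB measurableT I1 I2; have I34 := integrableB measurableT I3 I4.
split; first by rewrite E; exact: (integrableB measurableT I12 I34).
by rewrite E !RintegralB// E1 E2 E3 E4 !subrr.
Qed.

End centered_product.
End concentration.

(** * Least squares in the trigonometric basis *)

Section least_squares.
Context {R : realType}.

(** Lagrange's identity: twice the defect is a double sum of squares. *)
Lemma cauchy_schwarz_sum (J : finType) (a b : J -> R) :
  (\sum_i a i * b i) ^+ 2 <= (\sum_i a i ^+ 2) * (\sum_i b i ^+ 2).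
Proof.
have E : \sum_i \sum_j (a i * b j - a j * b i) ^+ 2 =
    2 * ((\sum_i a i ^+ 2) * (\sum_i b i ^+ 2) - (\sum_i a i * b i) ^+ 2).
  have E1 : (\sum_i a i ^+ 2) * (\sum_i b i ^+ 2) = \sum_i \sum_j a i ^+ 2 * b j ^+ 2.
    by rewrite mulr_suml; apply: eq_bigr => i _; rewrite mulr_sumr.
  have E2 : (\sum_i a i * b i) ^+ 2 = \sum_i \sum_j (a i * b i) * (a j * b j).
    by rewrite expr2 mulr_suml; apply: eq_bigr => i _; rewrite mulr_sumr.
  have E3 : \sum_i \sum_j a i ^+ 2 * b j ^+ 2 = \sum_i \sum_j a j ^+ 2 * b i ^+ 2.
    by rewrite exchange_big.
  transitivity (\sum_i \sum_j a i ^+ 2 * b j ^+ 2 + \sum_i \sum_j a j ^+ 2 * b i ^+ 2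
      - 2 * \sum_i \sum_j (a i * b i) * (a j * b j)).
    rewrite mulr_sumr -big_split/= -sumrB; apply: eq_bigr => i _.
    rewrite mulr_sumr -big_split/= -sumrB; apply: eq_bigr => j _; ring.
  by rewrite -E3 -E1 -E2; ring.
have : 0 <= \sum_i \sum_j (a i * b j - a j * b i) ^+ 2.
  by apply: sumr_ge0 => i _; apply: sumr_ge0 => j _; exact: sqr_ge0.
by rewrite E pmulr_rge0// subr_ge0.
Qed.

Lemma sqr_sum_le (J : finType) (a : J -> R) :
  (\sum_i a i) ^+ 2 <= #|J|%:R * \sum_i a i ^+ 2.
Proof.
have := cauchy_schwarz_sum (fun=> 1) a.
under eq_bigr do rewrite mul1r.
by rewrite expr1n sumr_const.
Qed.

Definition dotv k (u v : 'cV[R]_k) : R := \sum_i u i 0 * v i 0.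

Definition sqn k (v : 'cV[R]_k) : R := dotv v v.

Lemma sqnE k (v : 'cV[R]_k) : sqn v = \sum_i v i 0 ^+ 2.
Proof. by apply: eq_bigr => i _; rewrite expr2. Qed.

Lemma sqn_ge0 k (v : 'cV[R]_k) : 0 <= sqn v.
Proof. by rewrite sqnE sumr_ge0// => i _; exact: sqr_ge0. Qed.

Lemma sqn_eq0 k (v : 'cV[R]_k) : sqn v <= 0 -> v = 0.
Proof.
rewrite sqnE => v0; apply/matrixP => i j; rewrite (ord1 j) mxE.
apply/eqP; rewrite -sqrf_eq0 eq_le sqr_ge0 andbT (le_trans _ v0)//.
by rewrite (bigD1 i)//= lerDl sumr_ge0// => k' _; exact: sqr_ge0.
Qed.

Lemma dotv_CS k (u v : 'cV[R]_k) : dotv u v ^+ 2 <= sqn u * sqn v.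
Proof. by rewrite !sqnE; exact: cauchy_schwarz_sum. Qed.

Lemma dotvE k (u v : 'cV[R]_k) : dotv u v = (u^T *m v) 0 0.
Proof. by rewrite mxE; apply: eq_bigr => i _; rewrite mxE. Qed.

Lemma dotv_mulmx k l (A : 'M[R]_(k, l)) (u : 'cV[R]_k) (v : 'cV[R]_l) :
  dotv (A^T *m u) v = dotv u (A *m v).
Proof. by rewrite !dotvE trmx_mul trmxK mulmxA. Qed.

Lemma dotvC k (u v : 'cV[R]_k) : dotv u v = dotv v u.
Proof. by apply: eq_bigr => i _; rewrite mulrC. Qed.

Lemma dotvZr k (c : R) (u v : 'cV[R]_k) : dotv u (c *: v) = c * dotv u v.
Proof. by rewrite /dotv mulr_sumr; apply: eq_bigr => i _; rewrite mxE mulrCA. Qed.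

Lemma sqnZ k (c : R) (v : 'cV[R]_k) : sqn (c *: v) = c ^+ 2 * sqn v.
Proof. by rewrite !sqnE mulr_sumr; apply: eq_bigr => i _; rewrite mxE exprMn. Qed.

Lemma sqnD_le k (u v : 'cV[R]_k) : sqn (u + v) <= 2 * (sqn u + sqn v).
Proof.
rewrite !sqnE mulrDr !mulr_sumr -big_split/=; apply: ler_sum => i _; rewrite mxE.
have := sqr_ge0 (u i 0 - v i 0); lra.
Qed.

Lemma sqn_mulmx_le k l (A : 'M[R]_(k, l)) (c : R) (v : 'cV[R]_l) :
  (forall i j, A i j ^+ 2 <= c) -> sqn (A *m v) <= c * l%:R * k%:R * sqn v.
Proof.
move=> Ac; rewrite [leLHS]sqnE.
apply: (@le_trans _ _ (\sum_(i < k) (c * l%:R) * sqn v)).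
  apply: ler_sum => i _; rewrite mxE (le_trans (cauchy_schwarz_sum _ _))//.
  rewrite -sqnE ler_wpM2r ?sqn_ge0//.
  rewrite (le_trans (ler_sum _ (fun j _ => Ac i j)))// sumr_const card_ord.
  by rewrite mulr_natr.
by rewrite sumr_const card_ord -[leLHS]mulr_natr mulrAC.
Qed.

Lemma norm2E k (v : 'cV[R]_k) : norm2 v = Num.sqrt (sqn v).
Proof. by rewrite sqnE. Qed.

Lemma norm2_ge0 k (v : 'cV[R]_k) : 0 <= norm2 v.
Proof. exact: sqrtr_ge0. Qed.

Lemma sqr_norm2 k (v : 'cV[R]_k) : norm2 v ^+ 2 = sqn v.
Proof. by rewrite norm2E sqr_sqrtr// sqn_ge0. Qed.

Lemma norm20 k : norm2 (0 : 'cV[R]_k) = 0.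
Proof. by rewrite norm2E -(scale0r (0 : 'cV[R]_k)) sqnZ expr0n/= mul0r sqrtr0. Qed.

Let opset k (M : 'M[R]_k) := [set norm2 (M *m v) | v in [set v : 'cV[R]_k | norm2 v <= 1]].

Lemma has_sup_opnorm k (M : 'M[R]_k) : has_sup (opset M).
Proof.
split.
  exists (norm2 (M *m 0)); exists 0 => //=.
  by rewrite norm20.
pose c := \sum_i \sum_j M i j ^+ 2.
have Mc i j : M i j ^+ 2 <= c.
  rewrite /c (bigD1 i)//= (bigD1 j)//= -addrA lerDl addr_ge0//.
    by apply: sumr_ge0 => ? _; exact: sqr_ge0.
  by apply: sumr_ge0 => ? _; apply: sumr_ge0 => ? _; exact: sqr_ge0.
have c0 : 0 <= c by apply: sumr_ge0 => ? _; apply: sumr_ge0 => ? _; exact: sqr_ge0.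
exists (Num.sqrt (c * k%:R * k%:R)) => _ [v /= v1 <-].
rewrite norm2E ler_sqrt ?mulr_ge0// (le_trans (sqn_mulmx_le v Mc))//.
rewrite ler_piMr ?mulr_ge0//.
by rewrite -sqr_norm2 expr_le1// norm2_ge0.
Qed.

Lemma opnorm_ge0 k (M : 'M[R]_k) : 0 <= opnorm M.
Proof.
apply: sup_upper_bound (has_sup_opnorm M) _ _.
by exists 0; rewrite /= ?mulmx0 norm20.
Qed.

Lemma opnormP k (M : 'M[R]_k) (v : 'cV[R]_k) : norm2 (M *m v) <= opnorm M * norm2 v.
Proof.
have [v0|v0] := eqVneq (norm2 v) 0.
  have -> : v = 0 by apply: sqn_eq0; rewrite -sqr_norm2 v0 expr0n.
  by rewrite mulmx0 norm20 mulr0.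
have v1 : 0 < norm2 v by rewrite lt_neqAle eq_sym v0 norm2_ge0.
rewrite -ler_pdivrMr//; apply: sup_upper_bound; first exact: has_sup_opnorm.
have nZ (u : 'cV[R]_k) : norm2 ((norm2 v)^-1 *: u) = norm2 u / norm2 v.
  by rewrite !norm2E sqnZ sqrtrM ?sqr_ge0// sqrtr_sqr normfV -norm2E ger0_norm ?norm2_ge0// mulrC.
exists ((norm2 v)^-1 *: v) => /=; first by rewrite nZ divff.
by rewrite -scalemxAr nZ.
Qed.

Lemma opnorm_le k (M : 'M[R]_k) (c : R) : 0 <= c ->
  (forall v, sqn (M *m v) <= c ^+ 2 * sqn v) -> opnorm M <= c.
Proof.
move=> c0 Mc; apply: ge_sup; first exact: (has_sup_opnorm M).1.
move=> _ [v /= v1 <-]; rewrite -(@ler_pXn2r _ 2) ?nnegrE ?norm2_ge0// sqr_norm2.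
rewrite (le_trans (Mc v))// ler_piMr ?sqr_ge0//.
by rewrite -sqr_norm2 expr_le1// norm2_ge0.
Qed.

Section design.
Variables (n m : nat) (F : 'M[R]_(n, m)).
Hypothesis n0 : (0 < n)%N.
Let N : R := n%:R.
Let N0 : 0 < N. Proof. by rewrite ltr0n. Qed.

Definition gram : 'M[R]_m := N^-1 *: (F^T *m F).

(** When [F] is the design matrix, the squared empirical norm of the function with coefficients
    d. *)
Definition qform (d : 'cV[R]_m) : R := N^-1 * sqn (F *m d).

Lemma qform_ge0 d : 0 <= qform d.
Proof. by rewrite mulr_ge0 ?sqn_ge0// invr_ge0 ltW. Qed.

Lemma qformE d : dotv d (gram *m d) = qform d.
Proof. by rewrite /gram -scalemxAl dotvZr -mulmxA dotvC dotv_mulmx. Qed.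

Lemma qform_gramE d : qform d = \sum_j \sum_k d j 0 * d k 0 * gram j k.
Proof.
rewrite -qformE; apply: eq_bigr => j _; rewrite mxE mulr_sumr.
by apply: eq_bigr => k _; rewrite mulrA mulrAC.
Qed.

Section coercive.
Variable lam : R.
Hypothesis lam0 : 0 < lam.
Hypothesis qlam : forall d, lam * sqn d <= qform d.

Lemma gram_unit : gram \in unitmx.
Proof.
rewrite unitmxE unitfE; apply/det0P => -[v v0 vg].
move/eqP: v0; apply; apply: trmx_inj; rewrite trmx0; apply: sqn_eq0.
rewrite -(@pmulr_rle0 _ lam)// (le_trans (qlam _))//.
by rewrite -qformE dotvE trmxK mulmxA vg mul0mx mxE.
Qed.

(** With a the preimage of v, lam |a|^2 <= <a, v> <= |a| |v|; the proof works with squares. *)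
Lemma sqn_invgram_le v : sqn (invmx gram *m v) <= lam^-1 ^+ 2 * sqn v.
Proof.
set a := invmx gram *m v.
have av : gram *m a = v by rewrite mulKVmx// gram_unit.
have qa : qform a = dotv a v by rewrite -qformE av.
have [a0|a0] := leP (sqn a) 0.
  by rewrite (le_trans a0)// mulr_ge0 ?sqr_ge0 ?sqn_ge0.
rewrite exprVn ler_pdivlMl ?exprn_gt0// -(ler_pM2l a0).
rewrite (le_trans _ (dotv_CS a v))// -qa.
rewrite (_ : sqn a * _ = (lam * sqn a) ^+ 2); last by ring.
by rewrite lerXn2r ?nnegrE ?qform_ge0 ?qlam// mulr_ge0 ?sqn_ge0// ltW.
Qed.

Lemma opnorm_invgram_le : opnorm (invmx gram) <= lam^-1.
Proof. by apply: opnorm_le; [rewrite invr_ge0 ltW|exact: sqn_invgram_le]. Qed.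

End coercive.

(** An operator and its adjoint have the same norm, here between the Euclidean and the empirical
    norm: |v|^2 = <u, F v> / N, then Cauchy-Schwarz. A two-sided control of [qform] thus bounds the
    projected bias without a factor m. *)
Lemma sqn_design_bounded Lam u : 0 <= Lam -> (forall d, qform d <= Lam * sqn d) ->
  sqn (N^-1 *: (F^T *m u)) <= Lam * (N^-1 * sqn u).
Proof.
move=> Lam0 qLam; set v := N^-1 *: _.
have E : sqn v = N^-1 * dotv u (F *m v).
  by rewrite -dotv_mulmx {1}/sqn {1}/v dotvC dotvZr dotvC.
have [v0|v0] := leP (sqn v) 0.
  by rewrite (le_trans v0)// !mulr_ge0 ?sqn_ge0// invr_ge0 ltW.
rewrite -(ler_pM2l v0) {1 2}E -expr2 exprMn.
rewrite (@le_trans _ _ (N^-1 ^+ 2 * (sqn u * sqn (F *m v))))//.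
  by rewrite ler_wpM2l ?sqr_ge0// dotv_CS.
rewrite (_ : N^-1 ^+ 2 * _ = (N^-1 * sqn u) * qform v); last by rewrite /qform; ring.
rewrite (_ : sqn v * _ = (N^-1 * sqn u) * (Lam * sqn v)); last by ring.
by rewrite ler_wpM2l// mulr_ge0 ?sqn_ge0// invr_ge0 ltW.
Qed.

Hypothesis F2 : forall i j, F i j ^+ 2 <= 2.

Lemma qform_le d : qform d <= 2 * m%:R * sqn d.
Proof.
rewrite /qform ler_pdivrMl// (le_trans (sqn_mulmx_le d F2))//.
by rewrite mulrAC (mulrC N).
Qed.

Lemma sqn_design_le u : sqn (N^-1 *: (F^T *m u)) <= 2 * m%:R * (N^-1 * sqn u).
Proof. by apply: sqn_design_bounded; [rewrite mulr_ge0|exact: qform_le]. Qed.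

Lemma qform_near (Psi : 'M[R]_m) (t : R) d :
  (forall j k, `|gram j k - Psi j k| <= t) ->
  `|qform d - \sum_j \sum_k d j 0 * d k 0 * Psi j k| <= t * m%:R * sqn d.
Proof.
move=> Pt; rewrite qform_gramE -sumrB.
apply: (@le_trans _ _ (t * (\sum_j `|d j 0|) ^+ 2)).
  rewrite expr2 mulr_suml mulr_sumr (le_trans (ler_norm_sum _ _ _))//.
  apply: ler_sum => j _; rewrite -sumrB mulr_sumr mulr_sumr.
  rewrite (le_trans (ler_norm_sum _ _ _))//; apply: ler_sum => k _.
  by rewrite -mulrBr !normrM mulrC ler_wpM2r// mulr_ge0.
(* The sign of t is read from an entry, so dimension 0 is treated apart. *)
have [m0|/prednK m0] := posnP m.
  by rewrite m0 in d *; rewrite big_ord0 expr0n/= !mulr0 mul0r.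
have t0 : 0 <= t.
  by rewrite (le_trans _ (Pt (cast_ord m0 ord0) (cast_ord m0 ord0))).
rewrite -mulrA ler_wpM2l// (le_trans (sqr_sum_le _))// card_ord sqnE.
by rewrite ler_wpM2l//; apply: ler_sum => j _; rewrite real_normK ?num_real.
Qed.

End design.
End least_squares.

(** * The estimators and their pointwise error *)

Section trigonometric_estimator.
Context {R : realType}.
Local Notation I := (@I01 R).
Local Notation phi := (@phi R).

Lemma phi_I j x : I x -> phi j.+1 x = trig j x.
Proof. by move=> Ix; rewrite phiE indicE mem_set// mul1r. Qed.

Lemma phi_notI j x : ~ I x -> phi j.+1 x = 0.
Proof. by move=> Ix; rewrite phiE indicE memNset// mul0r. Qed.

Lemma sqr_phi_le2 j x : phi j.+1 x ^+ 2 <= 2.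
Proof.
have [Ix|Ix] := pselect (I x); first by rewrite phi_I// sqr_trig_le2.
by rewrite phi_notI// expr0n.
Qed.

Lemma phi'E j x : phi' j.+1 x = tw j * phi (tau j).+1 x.
Proof.
rewrite /phi'; have [Ix|Ix] := pselect (I x); last first.
  by rewrite phi_notI// indicE memNset// mul0r mulr0.
rewrite indicE mem_set// mul1r phi_I//.
apply: (derivI_is_derive (k := trig j)) => // [y|]; first exact: phi_I.
exact: is_derive_trig.
Qed.

Section odd_dimension.
Variable m : nat.
Hypothesis om : odd m.

Definition tauO (j : 'I_m) : 'I_m := Ordinal (etrans (tau_lt j om) (ltn_ord j)).

Lemma tauOK : involutive tauO.
Proof. by move=> j; apply: val_inj; rewrite /= tauK. Qed.

Lemma sum_tauO (V : nmodType) (F : 'I_m -> V) : \sum_j F (tauO j) = \sum_j F j.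
Proof. by rewrite [RHS](reindex_inj (inv_inj tauOK)). Qed.

Let D0 : 'M[R]_m := \matrix_(j, k) (if k == tauO j then tw j else 0).

Let D0_sum (j : 'I_m) (F : 'I_m -> R) : \sum_k D0 j k * F k = tw j * F (tauO j).
Proof.
rewrite (bigD1 (tauO j))//= mxE eqxx big1 ?addr0// => k /negbTE kj.
by rewrite mxE kj mul0r.
Qed.

Lemma DeltaE : Delta m = D0.
Proof.
have isD0 : is_Delta D0.
  by move=> j x Ix; rewrite phi'E (D0_sum j (fun k => phi k.+1 x)).
rewrite /Delta; case: xgetP => [D _ isD|/(_ D0)//].
apply/matrixP => j k.
(* Orthonormality determines each entry of a solution, so the matrix chosen by [xget] is [D0]. *)
have E (M : 'M[R]_m) : is_Delta M -> M j k = ipI (trig k) (fun x => phi' j.+1 x).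
  move=> isM; transitivity (ipI (trig k) (fun x => \sum_(l < m) M j l * trig l x)).
    rewrite ipI_sumr; [|exact: bndI_trig|by move=> l; apply: bndIZ; exact: bndI_trig].
    rewrite (bigD1 k)//= big1 => [|l lk]; rewrite ipIZr; try exact: bndI_trig.
      by rewrite trig_orthonormal eqxx mulr1 addr0.
    by rewrite trig_orthonormal eq_sym (inj_eq val_inj) (negbTE lk) mulr0.
  apply: eq_ipI => // x Ix; rewrite isM//.
  by apply: eq_bigr => l _; rewrite phi_I.
by rewrite (E D)// (E D0).
Qed.

End odd_dimension.

Lemma frakL_bounds m : (0 < m)%N -> 1 <= (frakL m : R) <= 2 * m%:R.
Proof.
move=> m0; set S := [set \sum_(j < m) phi j.+1 x ^+ 2 | x in I].
have ub : ubound S (2 * m%:R).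
  move=> _ [x _ <-]; apply: (@le_trans _ _ (\sum_(j < m) 2)).
    by apply: ler_sum => j _; exact: sqr_phi_le2.
  by rewrite sumr_const card_ord mulr_natr.
have I0 : I 0 by apply/I01P; rewrite lexx ler01.
have S0 : S (\sum_(j < m) phi j.+1 0 ^+ 2) by exists 0.
apply/andP; split; last by apply: ge_sup => //; eexists; exact: S0.
have hub : has_ubound S by exists (2 * m%:R).
apply: le_trans (ub_le_sup hub S0).
rewrite (bigD1 (Ordinal m0))//= phi_I// trig0 expr1n lerDl.
by apply: sumr_ge0 => j _; exact: sqr_ge0.
Qed.

Lemma frakc_gt0 : 0 < (frakc : R).
Proof.
rewrite divr_gt0// subr_gt0 -ltr_pdivrMl// mulr1.
(* The claim is ln (3 / 2) > 1/3, that is exp (- 1/3) > 2/3; it follows from exp (- 1/6) >= 5/6,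
   since 25/36 > 2/3. *)
have e6 : 5 / 6 <= expR (- (1 / 6) : R).
  by apply: le_trans (expR_ge1Dx _); lra.
have e3 : expR (- 3^-1 : R) = expR (- (1 / 6)) ^+ 2.
  by rewrite -expRM_natl; congr expR; field.
rewrite -[ltLHS]expRK ltr_ln ?posrE ?expR_gt0//.
rewrite -[3^-1]opprK expRN invf_plt ?posrE ?expR_gt0// e3.
by apply: (@lt_le_trans _ _ ((5 / 6) ^+ 2)); [lra|rewrite lerXn2r ?nnegrE ?expR_ge0].
Qed.

Section estimator.
Context {d : measure_display} {T : measurableType d} {P : probability T R}.
Variables (n m : nat) (X eps : 'I_n -> {RV P >-> R}) (b : R -> R).
Hypothesis om : odd m.
Hypothesis n0 : (0 < n)%N.
Implicit Types (w : T).

Lemma bhat'1E w x :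
  bhat'1 X eps b m w x = \sum_(j < m) theta1 X eps b m w j 0 * (tw j * phi (tau j).+1 x).
Proof. by apply: eq_bigr => j _; rewrite phi'E. Qed.

Lemma bhat'2E w x : bhat'2 X eps b m w x = bhat'1 X eps b m w x.
Proof.
rewrite bhat'1E -(sum_tauO om); apply: eq_bigr => j _ /=.
rewrite tauK tw_tau mulrA; congr (_ * _).
have -> : theta2 X eps b m w = - (Delta m *m theta1 X eps b m w).
  by rewrite /theta2 /theta1 -scalemxAr !mulmxA.
rewrite mxE mxE (DeltaE om) (bigD1 (tauO om j))//= big1 ?addr0.
  by rewrite mxE eqxx mulrN mulrC.
by move=> k /negbTE kj; rewrite mxE kj mul0r.
Qed.

Let N : R := n%:R.
Let F w := Phihat X m w.
Let c : 'cV[R]_m := \col_j fcoef b j.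

Definition bias_fun (h : R -> R) (x : R) : R := \1_I x * (h x - fsum h m x).

Definition bias_vec w : 'cV[R]_n := \col_i bias_fun b (X i w).
Definition noise_vec w : 'cV[R]_n := \col_i eps i w.

(** An observation outside [0, 1] meets a zero row of the design matrix, so only b on [0, 1]
    matters; this is why [bias_fun] carries an indicator. *)
Lemma design_residual w : (F w)^T *m (Yvec X eps b w - F w *m c) =
  (F w)^T *m (bias_vec w + noise_vec w).
Proof.
apply/matrixP => j k; rewrite !mxE; apply: eq_bigr => i _; rewrite !mxE.
have [Ix|Ix] := pselect (I (X i w)); last by rewrite phi_notI// !mul0r.
congr (_ * _); rewrite /Yobs /bias_fun indicE mem_set// mul1r addrAC; congr (_ - _ + _).
by apply: eq_bigr => l _; rewrite !mxE phi_I// mulrC.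
Qed.

Definition design_error w : 'cV[R]_m :=
  N^-1 *: ((F w)^T *m (bias_vec w + noise_vec w)).

Lemma theta1E w : Psihat X m w \in unitmx ->
  theta1 X eps b m w = c + invmx (Psihat X m w) *m design_error w.
Proof.
move=> uP; rewrite /design_error -design_residual mulmxBr scalerBr mulmxBr.
rewrite (mulmxA (F w)^T) [N^-1 *: (_ *m _ *m c)]scalemxAl -/(Psihat X m w) mulKmx//.
by rewrite addrCA subrr addr0 -scalemxAr mulmxA.
Qed.

(** The rule of [fcoef_deriv] applied to the coefficient error in [theta1E]: the coefficients of the
    derivative of that error function. *)
Definition coef_error w : 'cV[R]_m :=
  \col_j (- tw j * (invmx (Psihat X m w) *m design_error w) (tauO om j) 0).

Lemma sqn_coef_error w : sqn (coef_error w) <=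
  (8 * m%:R) ^+ 2 * sqn (invmx (Psihat X m w) *m design_error w).
Proof.
rewrite !sqnE mulr_sumr -[leRHS](sum_tauO om); apply: ler_sum => j _.
rewrite mxE exprMn sqrrN ler_wpM2r ?sqr_ge0// (le_trans (sqr_tw_le _))//.
by rewrite lerXn2r ?nnegrE ?mulr_ge0// ler_wpM2l// ler_nat ltnW.
Qed.

Variable h1 : R -> R.
Hypothesis Cb : C1I b h1.
Hypothesis b01 : b 0 = b 1.
Hypothesis b'h1 : forall x, I x -> derive1 b x = h1 x.

Lemma bhat'1_error w i : Psihat X m w \in unitmx ->
  bhat'1 X eps b m w (X i w) - b' b (X i w) =
  (F w *m coef_error w) i 0 - bias_fun h1 (X i w).
Proof.
move=> uP; rewrite bhat'1E theta1E// mxE.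
have [Ix|Ix] := pselect (I (X i w)); last first.
  rewrite /b' /bias_fun indicE memNset// !mul0r.
  rewrite big1 ?[in RHS]big1//= => j _; first by rewrite mxE phi_notI ?mul0r.
  by rewrite phi_notI// !mulr0.
rewrite /b' /bias_fun indicE mem_set// !mul1r b'h1//.
rewrite (fsum_deriv _ Cb b01 om).
under eq_bigr do rewrite mxE mulrDl.
rewrite big_split/=; set S1 := \sum_(j < m) _; set S2 := \sum_(j < m) _.
have -> : S1 = \sum_(j < m) fcoef b j * (tw j * trig (tau j) (X i w)).
  by apply: eq_bigr => j _; rewrite mxE phi_I.
have -> : S2 = \sum_(j < m) F w i j * coef_error w j 0.
  rewrite /S2 -(sum_tauO om); apply: eq_bigr => j _ /=.
  by rewrite tauK tw_tau !mxE; ring.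
by ring.
Qed.

Lemma sqnormn_error w : Psihat X m w \in unitmx ->
  sqnormn X (fun x => bhat'1 X eps b m w x - b' b x) w <=
  2 * qform (F w) (coef_error w) + 2 * sqnormn X (bias_fun h1) w.
Proof.
move=> uP; rewrite /sqnormn /qform sqnE !(mulrCA 2) -mulrDr.
rewrite ler_wpM2l ?invr_ge0// !mulr_sumr -big_split/=; apply: ler_sum => i _.
rewrite bhat'1_error//.
have := sqr_ge0 ((F w *m coef_error w) i 0 + bias_fun h1 (X i w)); lra.
Qed.

Section pointwise.
Variables (L f0 finf cn : R) (Psi : 'M[R]_m) (w : T) (Nw : R).
Hypothesis n2 : (1 < n)%N.
Hypothesis f00 : 0 < f0.
Hypothesis Psi_lower : forall v : 'cV[R]_m,
  f0 * sqn v <= \sum_j \sum_k v j 0 * v k 0 * Psi j k.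
Hypothesis Psi_upper : forall v : 'cV[R]_m,
  \sum_j \sum_k v j 0 * v k 0 * Psi j k <= finf * sqn v.
Hypothesis finf0 : 0 <= finf.
Hypothesis bL : forall x, I x -> `|h1 x| <= L.
Hypothesis uL : forall x, bias_fun b x ^+ 2 <= L ^+ 2.
Hypothesis cn0 : 0 <= cn.
Hypothesis Nw0 : 0 <= Nw.
Let t := f0 / (2 * m%:R).
Hypothesis HN : (forall j k, `|Psihat X m w j k - Psi j k| <= t) \/ 1 <= Nw.
Let K : R := frakc * n%:R / ln n%:R.
(* cn = 1 is needed when Lambda may fail although Psihat is close to Psi. *)
Hypothesis Hc : 2 * m%:R * Num.max (2 / f0) 1 <= K \/ 1 <= cn.

Let lam := finf + f0 / 2.
Let Av := sqnormn X (bias_fun b) w.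
Let Bv := sqnormn X (bias_fun h1) w.
Let Vv := sqn (N^-1 *: ((F w)^T *m noise_vec w)).
Let Rv := N^-1 * sqn (noise_vec w).

Let m0 : 0 < m%:R :> R. Proof. by rewrite ltr0n odd_gt0. Qed.

Let sqnormn_ge0 psi : 0 <= sqnormn X psi w.
Proof.
rewrite /sqnormn mulr_ge0 ?invr_ge0// sumr_ge0// => i _; exact: sqr_ge0.
Qed.

Let Av_bias : Av = N^-1 * sqn (bias_vec w).
Proof.
rewrite /Av /sqnormn sqnE -/N; congr (_ * _).
by apply: eq_bigr => i _; rewrite /bias_vec mxE.
Qed.

Let Av_le : Av <= L ^+ 2.
Proof.
rewrite /Av /sqnormn ler_pdivrMl ?ltr0n//.
apply: (@le_trans _ _ (\sum_(i < n) L ^+ 2)); first by apply: ler_sum.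
by rewrite sumr_const card_ord mulr_natl.
Qed.

Let Vv0 : 0 <= Vv. Proof. exact: sqn_ge0. Qed.
Let Rv0 : 0 <= Rv. Proof. by rewrite mulr_ge0 ?sqn_ge0// invr_ge0 ler0n. Qed.
Let lam0 : 0 <= lam. Proof. by rewrite addr_ge0// divr_ge0// ltW. Qed.

Let K0 : 0 < K.
Proof.
apply: divr_gt0; first by rewrite mulr_gt0 ?frakc_gt0 ?ltr0n.
by apply: ln_gt0; rewrite ltr1n.
Qed.

Let F2 i j : F w i j ^+ 2 <= 2. Proof. by rewrite mxE sqr_phi_le2. Qed.

(** In [T1], 1024 = 2 * 8^2 * 2^2 * 2: the split in [sqnormn_error], the frequencies at most 8 m,
    the inverse at most 2 / f0, the split of bias and noise. In [T2] the inverse is at most [K], and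
    the two bounds 2 m of [qform_le] and [sqn_design_le] supply the remaining 4 m^2. *)
Let T1 := 1024 * lam * m%:R ^+ 2 / f0 ^+ 2 * (lam * Av + Vv).
Let T2 := 1024 * m%:R ^+ 4 * K ^+ 2 * (L ^+ 2 + Rv).

Let T10 : 0 <= T1.
Proof.
apply: mulr_ge0; last first.
  by apply: addr_ge0 => //; apply: mulr_ge0 => //; exact: sqnormn_ge0.
have f2 : 0 <= f0 ^+ 2 by exact: sqr_ge0.
have m2 : 0 <= m%:R ^+ 2 :> R by exact: sqr_ge0.
have c0 : 0 <= 1024 :> R by exact: ler0n.
exact: (divr_ge0 (mulr_ge0 (mulr_ge0 c0 lam0) m2) f2).
Qed.

Let T20 : 0 <= T2.
Proof.
have L2 : 0 <= L ^+ 2 by exact: sqr_ge0.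
have K2 : 0 <= K ^+ 2 by exact: sqr_ge0.
have m4 : 0 <= m%:R ^+ 4 :> R by exact: exprn_ge0.
have c0 : 0 <= 1024 :> R by exact: ler0n.
exact: (mulr_ge0 (mulr_ge0 (mulr_ge0 c0 m4) K2) (addr_ge0 L2 Rv0)).
Qed.

Let concentrated := forall j k, `|Psihat X m w j k - Psi j k| <= t.

Let qform_two_sided : concentrated ->
  forall v, f0 / 2 * sqn v <= qform (F w) v <= lam * sqn v.
Proof.
move=> conc v; have := qform_near v conc.
have -> : t * m%:R = f0 / 2 by rewrite /t; field; rewrite gt_eqF.
have := Psi_lower v; have := Psi_upper v.
by rewrite ler_norml /lam => H1 H2 /andP[H3 H4]; apply/andP; split; lra.
Qed.

Let concentrated_Lambda : concentrated -> 2 * m%:R * Num.max (2 / f0) 1 <= K ->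
  Lambda X m w.
Proof.
move=> conc mK; rewrite /Lambda/=.
have f20 : 0 < f0 / 2 by rewrite divr_gt0.
have ql v : f0 / 2 * sqn v <= qform (F w) v by have /andP[] := qform_two_sided conc v.
rewrite /opnorm_inv (gram_unit f20 ql) -EFin_max -EFinM lee_fin (le_trans _ mK)//.
have /andP[L1 L2] := frakL_bounds (odd_gt0 om).
apply: ler_pM => //; first by rewrite (le_trans _ L1).
  by rewrite le_max ler01 orbT.
rewrite ge_max !le_max lexx orbT andbT (le_trans (opnorm_invgram_le n0 f20 ql))//.
by rewrite invfM invrK mulrC.
Qed.

Let sqn_design_error : sqn (design_error w) <=
  2 * (sqn (N^-1 *: ((F w)^T *m bias_vec w)) + Vv).
Proof. by rewrite /design_error mulmxDr scalerDr sqnD_le. Qed.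

Let error_concentrated : concentrated -> 2 * qform (F w) (coef_error w) <= T1.
Proof.
move=> conc; have qq := qform_two_sided conc.
have f20 : 0 < f0 / 2 by rewrite divr_gt0.
have ql v : f0 / 2 * sqn v <= qform (F w) v by have /andP[] := qq v.
have qu v : qform (F w) v <= lam * sqn v by have /andP[] := qq v.
set a := invmx (Psihat X m w) *m design_error w.
have H1 := qu (coef_error w).
have H2 : lam * sqn (coef_error w) <= lam * ((8 * m%:R) ^+ 2 * sqn a).
  by rewrite ler_wpM2l// sqn_coef_error.
have H3 : sqn a <= (f0 / 2)^-1 ^+ 2 * sqn (design_error w).
  exact: (sqn_invgram_le n0 f20 ql).
have H4 : sqn (design_error w) <= 2 * (lam * Av + Vv).
  rewrite (le_trans sqn_design_error)// ler_wpM2l// lerD2r Av_bias.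
  exact: (sqn_design_bounded n0).
have -> : T1 = 2 * (lam * ((8 * m%:R) ^+ 2 * ((f0 / 2)^-1 ^+ 2 * (2 * (lam * Av + Vv))))).
  by rewrite /T1; field; rewrite gt_eqF.
rewrite ler_wpM2l// (le_trans H1)// (le_trans H2)//.
rewrite ler_wpM2l// ler_wpM2l ?sqr_ge0// (le_trans H3)//.
by rewrite ler_wpM2l ?sqr_ge0.
Qed.

Let error_crude : Lambda X m w ->
  Psihat X m w \in unitmx /\ 2 * qform (F w) (coef_error w) <= T2.
Proof.
have /andP[L1 L2] := frakL_bounds (odd_gt0 om).
have L0 : 0 < (frakL m : R) by rewrite (lt_le_trans _ L1).
(* In the singular case the left side is +oo because [frakL m] is positive, so the truncation
   excludes it. Otherwise [frakL m] at least 1 leaves [K] as a bound on the inverse. *)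
rewrite /Lambda/= /opnorm_inv; case: ifPn => [uP|_]; last first.
  by rewrite maxye gt0_muley ?lte_fin// leye_eq.
rewrite -EFin_max -EFinM lee_fin -/K => LK; split=> //.
have opK : opnorm (invmx (Psihat X m w)) <= K.
  apply: le_trans LK; rewrite -[leLHS]mul1r; apply: ler_pM => //.
    exact: opnorm_ge0.
  by rewrite le_max lexx.
set a := invmx (Psihat X m w) *m design_error w.
have H1 := qform_le n0 F2 (coef_error w).
have H2 := sqn_coef_error w; rewrite -/a in H2.
have H3 : sqn a <= K ^+ 2 * sqn (design_error w).
  have aK : norm2 a <= K * norm2 (design_error w).
    apply: (le_trans (opnormP (invmx (Psihat X m w)) (design_error w))).
    by rewrite ler_wpM2r ?norm2_ge0.
  rewrite -!sqr_norm2 -exprMn; apply: lerXn2r aK; rewrite nnegrE ?norm2_ge0//.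
  by rewrite mulr_ge0 ?norm2_ge0// ltW.
have H4 : sqn (design_error w) <= 2 * m%:R * (2 * (L ^+ 2 + Rv)).
  rewrite (le_trans (sqn_design_le n0 F2 _))// ler_wpM2l ?mulr_ge0//.
  rewrite (@le_trans _ _ (N^-1 * (2 * (sqn (bias_vec w) + sqn (noise_vec w)))))//.
    by rewrite ler_wpM2l ?invr_ge0// sqnD_le.
  by rewrite mulrCA ler_wpM2l// mulrDr -Av_bias lerD2r.
have -> : T2 = 2 * (2 * m%:R * ((8 * m%:R) ^+ 2 * (K ^+ 2 * (2 * m%:R * (2 * (L ^+ 2 + Rv)))))).
  by rewrite /T2; ring.
rewrite ler_wpM2l// (le_trans H1)// ler_wpM2l ?mulr_ge0// (le_trans H2)//.
by rewrite ler_wpM2l ?sqr_ge0// (le_trans H3)// ler_wpM2l ?sqr_ge0.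
Qed.

(** [Nw] dominates the indicator of a failed concentration and [cn] that of a rejection in spite of
    concentration. All cases thus enter one sum, whose expectation can be taken term by term. *)
Lemma pointwise_bound : sqnormn X (fun x => btilde'1 X eps b m w x - b' b x) w <=
  2 * Bv + 1024 * lam * m%:R ^+ 2 / f0 ^+ 2 * (lam * Av + Vv)
  + Nw * (1024 * m%:R ^+ 4 * K ^+ 2 * (L ^+ 2 + Rv) + L ^+ 2) + cn * L ^+ 2.
Proof.
rewrite -/T1 -/T2; have T1p := T10; have T2p := T20; have B0 : 0 <= Bv by exact: sqnormn_ge0.
have NL : 0 <= Nw * (T2 + L ^+ 2) by rewrite mulr_ge0 ?addr_ge0 ?sqr_ge0.
have cL : 0 <= cn * L ^+ 2 by rewrite mulr_ge0 ?sqr_ge0.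
have [wL|wL] := pselect (Lambda X m w).
  have [uP crude] := error_crude wL.
  have -> : (fun x => btilde'1 X eps b m w x - b' b x) =
            (fun x => bhat'1 X eps b m w x - b' b x).
    by apply/funext => x; rewrite /btilde'1 indicE mem_set// mulr1.
  rewrite (le_trans (sqnormn_error uP))// -/Bv.
  case: HN => [/error_concentrated H|N1]; first by lra.
  have : 1 * (T2 + L ^+ 2) <= Nw * (T2 + L ^+ 2).
    by rewrite ler_wpM2r// addr_ge0 ?sqr_ge0.
  by have := sqr_ge0 L; lra.
have -> : (fun x => btilde'1 X eps b m w x - b' b x) = (fun x => - b' b x).
  by apply/funext => x; rewrite /btilde'1 indicE memNset// mulr0 sub0r.
have bound : sqnormn X (fun x => - b' b x) w <= L ^+ 2.
  rewrite /sqnormn ler_pdivrMl ?ltr0n//.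
  apply: (@le_trans _ _ (\sum_(i < n) L ^+ 2)); last first.
    by rewrite sumr_const card_ord mulr_natl.
  apply: ler_sum => i _; rewrite sqrrN /b'.
  have [Ix|Ix] := pselect (I (X i w)); last first.
    by rewrite indicE memNset// mul0r expr0n sqr_ge0.
  rewrite indicE mem_set// mul1r b'h1// -real_normK ?num_real//.
  by rewrite lerXn2r ?nnegrE ?bL// (le_trans _ (bL Ix)).
case: HN => [conc|N1]; last first.
  have : 1 * (T2 + L ^+ 2) <= Nw * (T2 + L ^+ 2).
    by rewrite ler_wpM2r// addr_ge0 ?sqr_ge0.
  by lra.
case: Hc => [mK|c1]; first by case: wL; exact: concentrated_Lambda.
have : 1 * L ^+ 2 <= cn * L ^+ 2 by rewrite ler_wpM2r ?sqr_ge0.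
by lra.
Qed.

End pointwise.
End estimator.

End trigonometric_estimator.

(** * Moments of noise and design *)

Section generated_sigma_algebra.
Context d (T : measurableType d) (R : realType) (P : probability T R).
Variables (n : nat) (Z : 'I_n -> {RV P >-> R}).

Definition familyG := \bigcup_i preimage_set_system setT (Z i : T -> R) measurable.

(** The sample space with the sigma-algebra of the family: measurability on [familyT X] expresses
    being a function of the design. *)
Definition familyT := g_sigma_algebraType familyG.

Lemma familyT_measurable (i : 'I_n) : measurable_fun (setT : set familyT) (Z i : familyT -> R).
Proof.
by move=> _ A mA; apply: sub_sigma_algebra; exists i => //; exists A.
Qed.

Lemma sigma_family_preimage (h : familyT -> R) (B : set R) :
  measurable_fun (setT : set familyT) h -> measurable B ->
  sigma_family Z (h @^-1` B).
Proof. by move=> mh mB; have := mh measurableT B mB; rewrite setTI. Qed.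

Lemma sigma_familyI A B : sigma_family Z A -> sigma_family Z B -> sigma_family Z (A `&` B).
Proof. exact: (@measurableI _ familyT A B). Qed.

End generated_sigma_algebra.

Section integral_tools.
Context d (T : measurableType d) (R : realType) (mu : {measure set T -> \bar R}).
Local Open Scope ereal_scope.
Import HBNNSimple.

(** The integral of a nonnegative function is a supremum over simple functions below it. In this
    form monotonicity applies to the integrand of [risk] without first establishing its
    measurability. *)
Lemma le_nonneg_integral (f g : T -> \bar R) : (forall x, 0 <= f x) ->
  (forall x, f x <= g x) -> \int[mu]_x f x <= \int[mu]_x g x.
Proof.
move=> f0 fg; have g0 x : 0 <= g x by exact: le_trans (f0 x) (fg x).
rewrite !ge0_integralTE//; apply: ereal_sup_le => _ [h hf <-].
by exists h => // x; exact: le_trans (hf x) (fg x).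
Qed.

End integral_tools.

Section regression.
Context d (T : measurableType d) (R : realType) (P : probability T R).
Variables (n : nat) (X eps : 'I_n -> {RV P >-> R}) (b f : R -> R) (sigma2 : R).
Hypothesis model : regression_model X eps b f sigma2.
Local Notation I := (@I01 R).
Local Notation phi := (@phi R).
Local Notation mu := (@lebesgue_measure R).
Local Notation intble h := (P.-integrable setT (EFin \o h)).

Let mX i : measurable_fun setT (X i). Proof. exact: measurable_funPT. Qed.
Let meps i : measurable_fun setT (eps i). Proof. exact: measurable_funPT. Qed.

Section noise_moments.
Variable i : 'I_n.

Lemma integral_sqr_noise : (\int[P]_x ((eps i x) ^+ 2)%:E = sigma2%:E)%E.
Proof.
have := eps_variance model i; rewrite /variance unlock (eps_centered model) unlock/=.
move=> <-; apply: eq_integral => x _; congr EFin.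
by rewrite !fctE/= subr0 expr2.
Qed.

Lemma intble_sqr_noise : intble (fun x => (eps i x) ^+ 2).
Proof.
apply/integrableP; split; first exact/measurable_EFinP/measurable_funX.
under eq_integral do rewrite /= ger0_norm ?sqr_ge0//.
by rewrite integral_sqr_noise ltry.
Qed.

Lemma Rintegral_sqr_noise : \int[P]_x (eps i x) ^+ 2 = sigma2.
Proof. by rewrite /Rintegral integral_sqr_noise. Qed.

Lemma sigma2_ge0 : 0 <= sigma2.
Proof. by rewrite -Rintegral_sqr_noise Rintegral_ge0// => x _; exact: sqr_ge0. Qed.

Lemma intble_noise : intble (eps i).
Proof.
have I1 := intbleD (intble_cst P 1) intble_sqr_noise.
apply: le_integrable I1 => //; first exact/measurable_EFinP.
move=> x _ /=; rewrite lee_fin [leRHS]ger0_norm ?addr_ge0 ?sqr_ge0//.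
rewrite -(real_normK (num_real (eps i x))).
have := sqr_ge0 (`|eps i x| - 2^-1); lra.
Qed.

Lemma Rintegral_noise : \int[P]_x eps i x = 0.
Proof. by have := eps_centered model i; rewrite unlock /Rintegral => ->. Qed.

End noise_moments.

Lemma noise_pair_indep (i k : 'I_n) (B C : set R) : i != k -> measurable B -> measurable C ->
  P (eps i @^-1` B `&` eps k @^-1` C) = (P (eps i @^-1` B) * P (eps k @^-1` C))%E.
Proof.
move=> ik mB mC.
pose A (l : 'I_n) : set R := if l == i then B else if l == k then C else setT.
have mA l : measurable (A l) by rewrite /A; case: eqP => // _; case: eqP.
have := eps_indep model mA.
rewrite (bigD1 i)//= (bigD1 k) ?(eq_sym k)//= big1; last first.
  move=> l /andP[li lk]; rewrite /A (negbTE li) (negbTE lk) preimage_setT.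
  exact: probability_setT.
rewrite mule1 /A eqxx (eq_sym k) (negbTE ik) eqxx => <-.
congr (P _); apply/seteqP; split => x /=.
  by move=> [xB xC] l _ /=; case: eqP => [->//|_]; case: eqP => [->|].
move=> H; split; first by have := H i Logic.I; rewrite /= eqxx.
by have := H k Logic.I; rewrite /= (eq_sym k) (negbTE ik) eqxx.
Qed.

Lemma design_noise_indep (U : familyT X -> R) (i k : 'I_n) (A B C : set R) :
  measurable_fun (setT : set (familyT X)) U -> i != k ->
  measurable A -> measurable B -> measurable C ->
  P (U @^-1` A `&` eps i @^-1` B `&` eps k @^-1` C) =
  (P (U @^-1` A) * P (eps i @^-1` B) * P (eps k @^-1` C))%E.
Proof.
move=> mU ik mA mB mC; rewrite -setIA (X_eps_indep model).
- by rewrite noise_pair_indep// muleA.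
- exact: sigma_family_preimage.
- by apply: sigma_familyI; apply: sigma_family_preimage => //; exact: familyT_measurable.
Qed.

Lemma Rintegral_indic_sqr_noise (i : 'I_n) (A : set T) : measurable A -> sigma_family X A ->
  intble (fun x => \1_A x * (eps i x) ^+ 2) /\
  \int[P]_x (\1_A x * (eps i x) ^+ 2) = fine (P A) * sigma2.
Proof.
move=> mA sA.
have E : (\int[P]_x (\1_A x * (eps i x) ^+ 2)%:E = (fine (P A) * sigma2)%:E)%E.
  under eq_integral do rewrite mulrC.
  rewrite EFinM -(integral_sqr_noise i).
  apply: (@integral_factor _ _ _ P (eps i) \1_A _ (fun y => y ^+ 2)) => //.
  - exact: fine_ge0.
  - move=> B mB; have mB' : measurable (eps i @^-1` B).
      by rewrite -[X in measurable X]setTI; exact: meps.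
    rewrite integral_indic// fineK ?fin_num_measure//.
    apply: (X_eps_indep model) => //.
    by apply: sigma_family_preimage => //; exact: familyT_measurable.
  - by move=> y; exact: sqr_ge0.
have IA : intble (fun x => \1_A x * (eps i x) ^+ 2).
  apply/integrableP; split.
    apply/measurable_EFinP/measurable_funM; first exact: measurable_indic.
    exact: measurable_funX.
  have h0 x : 0 <= \1_A x * (eps i x) ^+ 2 by rewrite mulr_ge0 ?sqr_ge0// indicE.
  under eq_integral do rewrite /= ger0_norm//.
  by rewrite E ltry.
by split=> //; rewrite /Rintegral E.
Qed.

Section law.
Variables (f0 finf : R).
Hypothesis f_bounds : forall x, 0 <= x <= 1 -> f0 <= f x <= finf.
Hypothesis f00 : 0 <= f0.

Lemma integral_density (i : 'I_n) (g : R -> R) : measurable_fun setT g ->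
  (forall x, 0 <= g x) ->
  (\int[mu]_x (g x * f x)%:E = \int[P]_x (g (X i x))%:E)%E.
Proof.
move=> mg g0; have [mf fp fA] := X_density model i.
rewrite (@integral_law _ _ _ _ _ _ _ mu P id (X i) f (cst 1%R) 1 g)//.
- by apply: etrans (mul1e _) _; apply: eq_integral => x _; rewrite mulr1.
- exact: mX.
- move=> A mA; apply: esym; apply: etrans (mul1e _) _; rewrite preimage_id -fA//.
  rewrite -[RHS]mul1e -integral_cst//.
  by rewrite -[X in measurable X]setTI; exact: mX.
Qed.

(** The indicator confines the integral to [0, 1], where the bounds on the density compare the norm
    for the law of the design with that of L^2([0, 1]). *)
Lemma Rintegral_sqr_law (i : 'I_n) (k : R -> R) : bndI k ->
  let h x := \1_I x * k x in
  intble (fun x => h (X i x) ^+ 2) /\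
  f0 * ipI k k <= \int[P]_x (h (X i x) ^+ 2) <= finf * ipI k k.
Proof.
move=> bk h; have [mf fp _] := X_density model i.
have finf0 : 0 <= finf.
  have /f_bounds/andP[f1 f2] : 0 <= (0 : R) <= 1 by rewrite lexx ler01.
  exact: le_trans f00 (le_trans f1 f2).
have hE : h = k \_ I.
  apply/funext => x; rewrite /h patchE indicE.
  by case: (_ \in _); [exact: mul1r|exact: mul0r].
have mh : measurable_fun setT h.
  by rewrite hE; apply: (measurable_restrictT k (@measurable_I01 R)).1 bk.1.
have mh2 : measurable_fun setT (fun x => h x ^+ 2) by exact: measurable_funX.
have h20 x : 0 <= h x ^+ 2 by exact: sqr_ge0.
have E : (\int[P]_x (h (X i x) ^+ 2)%:E = \int[mu]_(x in I) (k x * k x * f x)%:E)%E.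
  rewrite -(integral_density i mh2 h20) integral_mkcond [RHS]integral_mkcond.
  apply: eq_integral => x _; rewrite hE !patchE in_setT.
  by case: ifPn => _; rewrite ?expr2 ?mul0r.
have mk : measurable_fun I (fun x => k x * k x) by case: (bndIM bk bk).
have k0 x : 0 <= k x * k x by rewrite -expr2 sqr_ge0.
have scale (r : R) : 0 <= r -> (\int[mu]_(x in I) (r%:E * (k x * k x)%:E) = (r * ipI k k)%:E)%E.
  move=> r0; have mEk : measurable_fun I (fun x => (k x * k x)%:E).
    exact/measurable_EFinP.
  rewrite (ge0_integralZl mu (@measurable_I01 R) mEk) ?ipI_EFin//.
  by move=> x _; rewrite lee_fin.
have mkf : measurable_fun I (fun x => (k x * k x * f x)%:E).
  by apply/measurable_EFinP/measurable_funM => //; exact: measurable_funTS.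
have mck : forall r : R, measurable_fun I (fun x => (r%:E * (k x * k x)%:E)%E).
  by move=> r; apply: measurable_funeM; exact/measurable_EFinP.
have lower : ((f0 * ipI k k)%:E <= \int[P]_x (h (X i x) ^+ 2)%:E)%E.
  rewrite E -scale//; apply: ge0_le_integral;
    [exact: measurable_I01| |exact: mck|exact: mkf|].
  - by move=> x _; rewrite -EFinM lee_fin mulr_ge0.
  - move=> x Ix; have /andP[f1 _] := f_bounds ((I01P x).1 Ix); rewrite -EFinM lee_fin mulrC.
    by rewrite ler_wpM2l.
have upper : (\int[P]_x (h (X i x) ^+ 2)%:E <= (finf * ipI k k)%:E)%E.
  rewrite E -scale//; apply: ge0_le_integral;
    [exact: measurable_I01| |exact: mkf|exact: mck|].
  - by move=> x _; rewrite lee_fin mulr_ge0.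
  - move=> x Ix; have /andP[_ f2] := f_bounds ((I01P x).1 Ix); rewrite -EFinM lee_fin [leRHS]mulrC.
    by rewrite ler_wpM2l.
have Ih : intble (fun x => h (X i x) ^+ 2).
  apply/integrableP; split.
    by apply/measurable_EFinP; exact: measurableT_comp mh2 (mX i).
  under eq_integral do rewrite /= ger0_norm//.
  by rewrite (le_lt_trans upper)// ltry.
split=> //; move: lower upper; rewrite EFin_Rintegral// !lee_fin => -> ->.
by [].
Qed.

Lemma Rintegral_law_eq (i k : 'I_n) (g : R -> R) : measurable_fun setT g ->
  (exists M, forall x, `|g x| <= M) ->
  \int[P]_x g (X i x) = \int[P]_x g (X k x).
Proof.
move=> mg [M gM].
have Ig l : intble (fun x => g (X l x)).
  by apply: (@bounded_intble _ _ _ P _ M) => //; exact: measurableT_comp.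
have gM0 x : 0 <= g x + M.
  by have := gM x; rewrite ler_norml => /andP[? _]; lra.
have mgM : measurable_fun setT (fun x => g x + M) by exact: measurable_funD.
have E l : \int[P]_x (g (X l x) + M) = \int[P]_x g (X l x) + M.
  by rewrite RintegralD//; [rewrite Rintegral_prob_cst|exact: intble_cst].
apply: (addIr M); rewrite -!E /Rintegral.
by rewrite -(integral_density i mgM gM0) -(integral_density k mgM gM0).
Qed.

End law.
End regression.

Section expected_bound.
Context d (T : measurableType d) (R : realType) (P : probability T R).
Variables (n : nat) (X eps : 'I_n -> {RV P >-> R}) (b f : R -> R) (sigma2 : R).
Hypothesis model : regression_model X eps b f sigma2.
Hypothesis n0 : (0 < n)%N.
Variables (f0 finf : R).
Hypothesis f_bounds : forall x, 0 <= x <= 1 -> f0 <= f x <= finf.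
Hypothesis f00 : 0 < f0.
Variable m : nat.
Local Notation I := (@I01 R).
Local Notation phi := (@phi R).
Local Notation intble h := (P.-integrable setT (EFin \o h)).

Let mX i : measurable_fun setT (X i). Proof. exact: measurable_funPT. Qed.
Let meps i : measurable_fun setT (eps i). Proof. exact: measurable_funPT. Qed.
Let N : R := n%:R.
Let N0 : 0 < N. Proof. by rewrite ltr0n. Qed.

Lemma measurable_phi j : measurable_fun setT (phi j.+1).
Proof.
rewrite (_ : phi j.+1 = fun x => \1_I x * trig j x); last first.
  by apply/funext => x; rewrite phiE.
apply: measurable_funM; first by apply: measurable_indic; exact: measurable_I01.
by apply: continuous_measurable_fun; exact: continuous_trig.
Qed.

Lemma normr_phi_le j k x y : `|phi j.+1 x * phi k.+1 y| <= 2.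
Proof.
have := sqr_phi_le2 j x; have := sqr_phi_le2 k y.
have := sqr_ge0 (phi j.+1 x - phi k.+1 y); have := sqr_ge0 (phi j.+1 x + phi k.+1 y).
by move=> h1 h2 h3 h4; rewrite ler_norml; apply/andP; split; lra.
Qed.

Lemma Rintegral_sqnormn k : bndI k ->
  let h x := \1_I x * k x in
  intble (fun w => sqnormn X h w) /\ \int[P]_w sqnormn X h w <= finf * ipI k k.
Proof.
move=> bk h.
have H i := Rintegral_sqr_law model f_bounds (ltW f00) i bk.
have Ih : intble (fun w => \sum_(i < n) h (X i w) ^+ 2).
  by apply: intble_sum => i; have [] := H i.
split; first exact: intbleZ.
rewrite RintegralZl// Rintegral_sum; last by move=> i; have [] := H i.
rewrite ler_pdivrMl//; apply: (@le_trans _ _ (\sum_(i < n) finf * ipI k k)).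
  by apply: ler_sum => i _; have [_ /andP[]] := H i.
by rewrite sumr_const card_ord mulr_natl.
Qed.

Definition noise_proj (w : T) : 'cV[R]_m :=
  N^-1 *: ((Phihat X m w)^T *m noise_vec eps w).

Lemma sqn_noise_proj w : sqn (noise_proj w) =
  \sum_(j < m) \sum_(i < n) \sum_(k < n)
    N^-1 ^+ 2 * (phi j.+1 (X i w) * phi j.+1 (X k w) * eps i w * eps k w).
Proof.
rewrite sqnE; apply: eq_bigr => j _; rewrite !mxE exprMn [X in _ * X]expr2 mulr_suml mulr_sumr.
apply: eq_bigr => i _; rewrite mulr_sumr mulr_sumr; apply: eq_bigr => k _.
by rewrite !mxE; congr (_ * _); ring.
Qed.

Lemma Rintegral_noise_term j (i k : 'I_n) :
  let Y w := phi j.+1 (X i w) * phi j.+1 (X k w) * eps i w * eps k w in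
  intble Y /\ \int[P]_w Y w <= (i == k)%:R * (2 * sigma2).
Proof.
move=> Y; have [ik|ik] := eqVneq i k.
  have mY : measurable_fun setT Y.
    apply: measurable_funM => //; apply: measurable_funM => //.
    by apply: measurable_funM; exact: measurableT_comp (measurable_phi j) (mX _).
  have Ys w : Y w = phi j.+1 (X i w) ^+ 2 * (eps i w) ^+ 2 by rewrite /Y -ik; ring.
  have Yle w : Y w <= 2 * (eps i w) ^+ 2.
    by rewrite Ys ler_wpM2r ?sqr_ge0// sqr_phi_le2.
  have Y0 w : 0 <= Y w by rewrite Ys mulr_ge0 ?sqr_ge0.
  have I2 := intbleZ 2 (intble_sqr_noise model i).
  have IY : intble Y.
    apply: le_integrable I2 => //; first exact/measurable_EFinP.
    by move=> w _ /=; rewrite lee_fin (ger0_norm (Y0 w)) (le_trans (Yle w))// ler_norm.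
  have E2 : \int[P]_w (2 * (eps i w) ^+ 2) = 2 * sigma2.
    rewrite (RintegralZl 2 measurableT (intble_sqr_noise model i)).
    by rewrite (Rintegral_sqr_noise model).
  split=> //; rewrite mul1r -E2; apply: le_Rintegral => // w _; exact: Yle.
pose U w := phi j.+1 (X i w) * phi j.+1 (X k w).
have mU : measurable_fun (setT : set (familyT X)) (U : familyT X -> R).
  by apply: measurable_funM; apply: measurableT_comp (measurable_phi j) _;
    exact: familyT_measurable.
have mU' : measurable_fun setT U.
  by apply: measurable_funM; exact: measurableT_comp (measurable_phi j) (mX _).
have IU : intble U by apply: (@bounded_intble _ _ _ P U 2) => // w; exact: normr_phi_le.
have [IY ->] := integral_centered_product mU' (meps i) (meps k)
  (fun A B C mA mB mC => design_noise_indep model mU ik mA mB mC)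
  IU (intble_noise model i) (intble_noise model k) (Rintegral_noise model k).
by split=> //; rewrite mul0r.
Qed.

Lemma Rintegral_sqn_noise_proj : intble (fun w => sqn (noise_proj w)) /\
  \int[P]_w sqn (noise_proj w) <= 2 * m%:R * sigma2 / N.
Proof.
pose Y j (i k : 'I_n) w := phi j.+1 (X i w) * phi j.+1 (X k w) * eps i w * eps k w.
have H j i k : intble (Y j i k) /\ \int[P]_w Y j i k w <= (i == k)%:R * (2 * sigma2).
  exact: Rintegral_noise_term.
have I3 (j : 'I_m) i k : intble (fun w => N^-1 ^+ 2 * Y j i k w).
  by apply: intbleZ; have [] := H j i k.
have I2 (j : 'I_m) i : intble (fun w => \sum_(k < n) N^-1 ^+ 2 * Y j i k w).
  exact: intble_sum.
have I1 (j : 'I_m) : intble (fun w => \sum_(i < n) \sum_(k < n) N^-1 ^+ 2 * Y j i k w).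
  exact: intble_sum.
rewrite (_ : (fun w => sqn (noise_proj w)) = fun w =>
   \sum_(j < m) \sum_(i < n) \sum_(k < n) N^-1 ^+ 2 * Y j i k w); last first.
  by apply/funext => w; rewrite sqn_noise_proj.
split; first exact: intble_sum.
rewrite Rintegral_sum//.
apply: (@le_trans _ _ (\sum_(j < m) \sum_(i < n) N^-1 ^+ 2 * (2 * sigma2))).
  apply: ler_sum => j _; rewrite Rintegral_sum//; apply: ler_sum => i _.
  rewrite Rintegral_sum//.
  apply: (@le_trans _ _ (\sum_(k < n) N^-1 ^+ 2 * ((i == k)%:R * (2 * sigma2)))).
    apply: ler_sum => k _; have [IY leY] := H j i k; rewrite RintegralZl//.
    by rewrite ler_wpM2l ?sqr_ge0.
  rewrite (bigD1 i)//= eqxx mul1r big1 ?addr0// => k ik.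
  by rewrite eq_sym (negbTE ik) mul0r mulr0.
rewrite !sumr_const !card_ord (_ : _ *+ n *+ m = N^-1 ^+ 2 * (2 * sigma2) * N * m%:R); last first.
  by rewrite /N !mulr_natr.
by rewrite le_eqVlt; apply/orP; left; apply/eqP; field; rewrite gt_eqF.
Qed.

Let i0 : 'I_n := Ordinal n0.

Definition mean_gram : 'M[R]_m :=
  \matrix_(j, k) \int[P]_w (phi j.+1 (X i0 w) * phi k.+1 (X i0 w)).

(** The quadratic form is the mean of g(X)^2 for the trigonometric sum g with coefficients v, whose
    squared L^2 norm is |v|^2. *)
Lemma mean_gram_bounds (v : 'cV[R]_m) :
  f0 * sqn v <= \sum_j \sum_k v j 0 * v k 0 * mean_gram j k <= finf * sqn v.
Proof.
pose g x := \sum_(j < m) v j 0 * trig j x.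
have bg : bndI g by apply: bndI_sum => j; apply: bndIZ; exact: bndI_trig.
have gv : ipI g g = sqn v.
  rewrite {2}/g ipI_sumr//; last by move=> j; apply: bndIZ; exact: bndI_trig.
  rewrite sqnE; apply: eq_bigr => j _; rewrite ipIZr//; last exact: bndI_trig.
  rewrite ipIC ipI_sumr; [|exact: bndI_trig|by move=> k; apply: bndIZ; exact: bndI_trig].
  rewrite (bigD1 j)//= ipIZr; [|exact: bndI_trig..].
  rewrite trig_orthonormal eqxx mulr1 big1 ?addr0 ?expr2// => k kj.
  rewrite ipIZr; [|exact: bndI_trig..].
  by rewrite trig_orthonormal eq_sym (inj_eq val_inj) (negbTE kj) mulr0.
have Iphi (j k : 'I_m) : intble (fun w => phi j.+1 (X i0 w) * phi k.+1 (X i0 w)).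
  apply: (@bounded_intble _ _ _ P _ 2) => [|w]; last exact: normr_phi_le.
  by apply: measurable_funM; exact: measurableT_comp (measurable_phi _) (mX _).
have Iphi' (j k : 'I_m) : intble (fun w => v j 0 * v k 0 *
    (phi j.+1 (X i0 w) * phi k.+1 (X i0 w))) by exact: intbleZ.
have [_] := Rintegral_sqr_law model f_bounds (ltW f00) i0 bg.
suff -> : \int[P]_w ((\1_I (X i0 w) * g (X i0 w)) ^+ 2) =
  \sum_j \sum_k v j 0 * v k 0 * mean_gram j k by rewrite gv.
rewrite (_ : (fun w => _) = fun w => \sum_(j < m) \sum_(k < m) v j 0 * v k 0 *
    (phi j.+1 (X i0 w) * phi k.+1 (X i0 w))); last first.
  apply/funext => w; rewrite /g mulr_sumr expr2 mulr_suml; apply: eq_bigr => j _.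
  rewrite mulr_sumr; apply: eq_bigr => k _; rewrite !phiE; ring.
rewrite Rintegral_sum; last by move=> j; exact: intble_sum.
apply: eq_bigr => j _; rewrite Rintegral_sum//; apply: eq_bigr => k _.
by rewrite RintegralZl// mxE.
Qed.

Lemma PsihatE w (j k : 'I_m) : Psihat X m w j k =
  N^-1 * \sum_(i < n) phi j.+1 (X i w) * phi k.+1 (X i w).
Proof.
rewrite /Psihat !mxE; congr (_ * _); apply: eq_bigr => i _; by rewrite !mxE.
Qed.

Section deviation.
Variable t : R.
Hypothesis t08 : 0 < t <= 8.

Definition deviation (j k : 'I_m) : set T :=
  [set w | t < `|Psihat X m w j k - mean_gram j k|].

Let p : R := 2 * expR (- (N * t ^+ 2 / 128)).

Let dev (j k : 'I_m) (w : T) : R :=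
  `|N^-1 * (\sum_(i < n) phi j.+1 (X i w) * phi k.+1 (X i w)) - mean_gram j k|.

Let deviationE j k : deviation j k = dev j k @^-1` `]t, +oo[.
Proof.
by apply/seteqP; split => w; rewrite /deviation/= in_itv/= andbT /dev PsihatE.
Qed.

Lemma measurable_deviation j k : measurable (deviation j k).
Proof.
rewrite deviationE -[X in measurable X]setTI.
have mdev : measurable_fun setT (dev j k).
  apply: measurableT_comp => //; apply: measurable_funB => //.
  apply: measurable_funM => //; apply: measurable_sum => i.
  by apply: measurable_funM; exact: measurableT_comp (measurable_phi _) (mX _).
exact: mdev.
Qed.

Lemma sigma_family_deviation j k : sigma_family X (deviation j k).
Proof.
rewrite deviationE; apply: sigma_family_preimage => //.
apply: measurableT_comp => //; apply: measurable_funB => //.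
apply: measurable_funM => //; apply: measurable_sum => i.
by apply: measurable_funM; apply: measurableT_comp (measurable_phi _) _;
  exact: familyT_measurable.
Qed.

Lemma deviation_le j k : fine (P (deviation j k)) <= p.
Proof.
rewrite -lee_fin fineK ?fin_num_measure//; last exact: measurable_deviation.
pose g x := phi j.+1 x * phi k.+1 x.
have mg : measurable_fun setT g by apply: measurable_funM; exact: measurable_phi.
have g2 x : `|g x| <= 2 by exact: normr_phi_le.
have gmean i : \int[P]_w g (X i w) = mean_gram j k.
  by rewrite mxE; apply: (Rintegral_law_eq model) => //; exists 2.
have := hoeffding_type n0 mX (X_indep model) mg g2 gmean t08.
rewrite deviationE (_ : dev j k @^-1` `]t, +oo[ = [set x : T |
  t < `|n%:R^-1 * (\sum_(i < n) g (X i x)) - mean_gram j k|])//.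
by apply/seteqP; split => w; rewrite /= in_itv/= andbT.
Qed.

(* At least the indicator of the event that some entry deviates by more than t;
   unlike it, a sum of indicators, so that its mean is bounded term by term. *)
Definition deviation_count (w : T) : R := \sum_(j < m) \sum_(k < m) \1_(deviation j k) w.

Lemma deviation_count_ge0 w : 0 <= deviation_count w.
Proof.
by apply: sumr_ge0 => j _; apply: sumr_ge0 => k _; rewrite indicE.
Qed.

Lemma deviation_countP w :
  (forall j k, `|Psihat X m w j k - mean_gram j k| <= t) \/ 1 <= deviation_count w.
Proof.
have [|/existsNP[j /existsNP[k /negP]]] :=
  pselect (forall j k, `|Psihat X m w j k - mean_gram j k| <= t); first by left.
rewrite -ltNge => tjk; right; rewrite /deviation_count (bigD1 j)//= (bigD1 k)//=.
rewrite indicE mem_set// -addrA lerDl addr_ge0//.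
  by apply: sumr_ge0 => ? _; rewrite indicE.
by apply: sumr_ge0 => ? _; apply: sumr_ge0 => ? _; rewrite indicE.
Qed.

Variables (C D : R).
Hypothesis C0 : 0 <= C.
Hypothesis D0 : 0 <= D.

Lemma Rintegral_deviation_count :
  let G w := deviation_count w * (D + C * (N^-1 * sqn (noise_vec eps w))) in
  intble G /\ \int[P]_w G w <= m%:R ^+ 2 * p * (D + C * sigma2).
Proof.
move=> G; pose H j k w : R := D * \1_(deviation j k) w +
  C * N^-1 * \sum_(i < n) \1_(deviation j k) w * eps i w ^+ 2.
have I1 j k : intble (\1_(deviation j k) : T -> R).
  apply: (@bounded_intble _ _ _ P _ 1) => [|w].
    exact/measurable_indic/measurable_deviation.
  by rewrite indicE; case: (_ \in _); rewrite ?normr1 ?normr0.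
have I2 j k i : intble (fun w => \1_(deviation j k) w * eps i w ^+ 2) /\
   \int[P]_w (\1_(deviation j k) w * eps i w ^+ 2) = fine (P (deviation j k)) * sigma2.
  apply: (Rintegral_indic_sqr_noise model); first exact: measurable_deviation.
  exact: sigma_family_deviation.
have I2s j k : intble (fun w => \sum_(i < n) \1_(deviation j k) w * eps i w ^+ 2).
  by apply: intble_sum => i; have [] := I2 j k i.
have E1 j k : \int[P]_w \1_(deviation j k) w = fine (P (deviation j k)).
  by rewrite /Rintegral integral_indic ?setIT//; exact: measurable_deviation.
have IH j k : intble (H j k) by apply: intbleD; exact: intbleZ.
have EH j k : \int[P]_w H j k w <= p * (D + C * sigma2).
  rewrite RintegralD//; [|exact: intbleZ|exact: intbleZ].
  rewrite !RintegralZl// E1 Rintegral_sum; last by move=> i; have [] := I2 j k i.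
  under eq_bigr do rewrite (I2 _ _ _).2.
  rewrite sumr_const card_ord -mulr_natl -/N.
  have -> : C * N^-1 * (N * (fine (P (deviation j k)) * sigma2)) =
     C * (fine (P (deviation j k)) * sigma2) by field; rewrite gt_eqF.
  have -> : D * fine (P (deviation j k)) + C * (fine (P (deviation j k)) * sigma2) =
     fine (P (deviation j k)) * (D + C * sigma2) by ring.
  rewrite ler_wpM2r ?deviation_le// addr_ge0// mulr_ge0//.
  exact: sigma2_ge0 model i0.
have GE : G = fun w => \sum_(j < m) \sum_(k < m) H j k w.
  apply/funext => w; rewrite /G /deviation_count mulr_suml; apply: eq_bigr => j _.
  rewrite mulr_suml; apply: eq_bigr => k _; rewrite /H sqnE.
  under [in RHS]eq_bigr do rewrite -/(noise_vec eps w).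
  rewrite -mulr_sumr mulrDr mulrC; congr (_ + _).
  under [in LHS]eq_bigr do rewrite mxE.
  by ring.
rewrite GE; split; first by apply: intble_sum => j; exact: intble_sum.
rewrite Rintegral_sum; last by move=> j; exact: intble_sum.
apply: (@le_trans _ _ (\sum_(j < m) \sum_(k < m) p * (D + C * sigma2))).
  apply: ler_sum => j _; rewrite Rintegral_sum//.
  by apply: ler_sum.
rewrite !sumr_const card_ord (_ : _ *+ m *+ m = p * (D + C * sigma2) * m%:R * m%:R); last first.
  by rewrite !mulr_natr.
by rewrite le_eqVlt; apply/orP; left; apply/eqP; ring.
Qed.

End deviation.
End expected_bound.

(** * Uniform bound on the Fourier remainder *)

Section fourier_remainder_sup.
Context {R : realType}.
Local Notation I := (@I01 R).

Lemma C1ID (g dg h dh : R -> R) : C1I g dg -> C1I h dh ->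
  C1I (fun x => g x + h x) (fun x => dg x + dh x).
Proof.
move=> [cg cdg gd] [ch cdh hd]; split.
- by move=> x; apply: continuousD; [exact: cg|exact: ch].
- by move=> x; apply: continuousD; [exact: cdg|exact: cdh].
- by move=> x x01; have ? := gd x x01; have ? := hd x x01; exact: is_deriveD.
Qed.

Lemma C1IZ (a : R) (g dg : R -> R) : C1I g dg -> C1I (fun x => a * g x) (fun x => a * dg x).
Proof.
move=> [cg cdg gd]; split.
- by move=> x; apply: continuousM; [exact: cvg_cst|exact: cg].
- by move=> x; apply: continuousM; [exact: cvg_cst|exact: cdg].
- by move=> x x01; have ? := gd x x01; exact: is_deriveZ.
Qed.

Lemma C1I_fsum (c : nat -> R) m : C1I (fun x => \sum_(j < m) c j * trig j x)
  (fun x => \sum_(j < m) c j * (tw j * trig (tau j) x)).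
Proof.
elim: m => [|m IH].
  by under eq_fun do rewrite big_ord0; under [X in C1I _ X]eq_fun do rewrite big_ord0;
    exact: C1I_cst.
under eq_fun do rewrite big_ord_recr/=.
under [X in C1I _ X]eq_fun do rewrite big_ord_recr/=.
by apply: C1ID => //; apply: C1IZ; exact: C1I_trig.
Qed.

(** The remainder r has mean 0, as m >= 1 removes coefficient 0. So r x is the mean of the
    increments r x - r y over y, each bounded through [sqr_increment_le] by the norm of the
    derivative of r; Bessel with the single index 0 bounds the square of that mean. *)
Lemma fourier_remainder_sup (h dh : R -> R) m x : C1I h dh -> h 0 = h 1 -> odd m -> I x ->
  (h x - fsum h m x) ^+ 2 <=
  ipI (fun y => dh y - fsum dh m y) (fun y => dh y - fsum dh m y).
Proof.
move=> Ch h01 om Ix; set r := fun y => h y - fsum h m y.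
set dr := fun y => dh y - fsum dh m y.
have Cr : C1I r dr.
  have -> : r = fun y => h y + (-1) * fsum h m y by apply/funext => y; rewrite mulN1r.
  have -> : dr = fun y => dh y + (-1) * fsum dh m y by apply/funext => y; rewrite mulN1r.
  apply: C1ID => //; apply: C1IZ.
  have -> : fsum dh m = fun y => \sum_(j < m) fcoef h j * (tw j * trig (tau j) y).
    by apply/funext => y; exact: fsum_deriv.
  exact: C1I_fsum.
have [cr _ _] := Cr; have br := bndI_continuous cr.
have bh : bndI h by case: Ch => /bndI_continuous.
have r0 : ipI (trig 0) r = 0.
  have A : ipI (trig 0) (fsum h m) = fcoef h 0.
    rewrite (@eq_ipI _ (trig 0) (trig 0) _
      (fun y => \sum_(0 <= j < m) fcoef h j * trig j y))//; last first.
      by move=> y _; rewrite big_mkord.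
    rewrite (ipI_orthonormal_sum bndI_trig trig_orthonormal (fcoef h)).
      by rewrite mem_index_iota/= odd_gt0.
    exact: iota_uniq.
  have A' : ipI (trig 0) h = fcoef h 0 by rewrite ipIC.
  rewrite /r ipIBr; [|exact: bndI_trig|exact: bh|exact: bndI_fsum].
  by rewrite A A' subrr.
pose g y := r x - r y.
have bg : bndI g by apply: bndIB => //; exact: bndI_cst.
have E : ipI g (trig 0) = r x.
  rewrite ipIC ipIBr//; [|exact: bndI_trig|exact: bndI_cst].
  rewrite r0 subr0 (@eq_ipI _ (trig 0) (trig 0) _ (fun y => r x * trig 0 y))//.
    by rewrite ipIZr; [rewrite trig_orthonormal mulr1|exact: bndI_trig..].
  by move=> y _; rewrite trig0 mulr1.
set B := ipI dr dr.
have B0 : 0 <= B by exact: ipI_ge0.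
have := bessel bndI_trig trig_orthonormal (s := [:: 0%N]) isT bg.
rewrite big_seq1 E => /le_trans; apply.
rewrite -(sqr_sqrtr B0); apply: ipI_bound => // y Iy.
rewrite -(@ler_pXn2r _ 2) ?nnegrE ?sqrtr_ge0// real_normK ?num_real// sqr_sqrtr//.
exact: sqr_increment_le Cr Iy Ix.
Qed.

End fourier_remainder_sup.

(** * Risk bound and rates *)

Section risk_bound.
Context d (T : measurableType d) (R : realType) (P : probability T R).
Variables (n : nat) (X eps : 'I_n -> {RV P >-> R}) (b f : R -> R) (sigma2 : R).
Hypothesis model : regression_model X eps b f sigma2.
Hypothesis n2 : (1 < n)%N.
Variables (f0 finf L cn : R) (m beta : nat).
Hypothesis f_bounds : forall x, 0 <= x <= 1 -> f0 <= f x <= finf.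
Hypothesis f01 : 0 < f0 <= 1.
Hypothesis om : odd m.
Hypothesis beta1 : (1 < beta)%N.
Hypothesis L0 : 0 <= L.
Hypothesis Wb : Wper beta L b.
Hypothesis cn0 : 0 <= cn.
Local Notation I := (@I01 R).

Let K : R := frakc * n%:R / ln n%:R.
Hypothesis Hcn : 2 * m%:R * Num.max (2 / f0) 1 <= K \/ 1 <= cn.
Let lam := finf + f0 / 2.
Let t := f0 / (2 * m%:R).
Let p : R := 2 * expR (- (n%:R * t ^+ 2 / 128)).
(* Abstract, to keep conversion from unfolding the literal 1024. *)
Variables Cc C4 : R.
Hypothesis CcE : Cc = 1024 * lam * m%:R ^+ 2 / f0 ^+ 2.
Hypothesis C4E : C4 = 1024 * m%:R ^+ 4 * K ^+ 2.
Let h1 := derivnI 1 b.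

Let n0 : (0 < n)%N. Proof. exact: ltnW. Qed.
Let f00 : 0 < f0. Proof. by case/andP: f01. Qed.
Let m0 : 0 < m%:R :> R. Proof. by rewrite ltr0n odd_gt0. Qed.
Let m1 : 1 <= m%:R :> R. Proof. by rewrite ler1n odd_gt0. Qed.

Let finf0 : 0 <= finf.
Proof.
have /f_bounds/andP[f1 f2] : 0 <= (0 : R) <= 1 by rewrite lexx ler01.
exact: ltW (lt_le_trans f00 (le_trans f1 f2)).
Qed.

Let Cb : C1I b h1. Proof. by have := Wper_C1I Wb (ltnW beta1). Qed.

Let bper r : (r < beta)%N -> derivnI r b 0 = derivnI r b 1.
Proof. by case: Wb => _ _ _; apply. Qed.

Let b'h1 x : I x -> derive1 b x = h1 x.
Proof.
move=> Ix; apply/esym/(derivI_is_derive (k := b)) => //.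
by apply: DeriveDef; [exact: (b_derivable model)|rewrite derive1E].
Qed.

Let h1L x : I x -> `|h1 x| <= L.
Proof.
apply: (sobolev_sup (h := fun r => derivnI r b) (beta := beta)) => //.
- by move=> r rb; exact: Wper_C1I Wb rb.
- exact: Wper_norm (ltnW beta1) Wb.
Qed.

Let approx r : (r < beta)%N ->
  ipI (fun x => derivnI r b x - fsum (derivnI r b) m x)
      (fun x => derivnI r b x - fsum (derivnI r b) m x)
    <= L ^+ 2 / m%:R ^+ (beta - r).*2.
Proof.
move=> rb; apply: (sobolev_approx (h := fun r => derivnI r b)) => //.
- by move=> r' rb'; exact: Wper_C1I Wb rb'.
- exact: Wper_norm (ltnW beta1) Wb.
Qed.

Let biasL x : bias_fun m b x ^+ 2 <= L ^+ 2.
Proof.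
rewrite /bias_fun; have [Ix|Ix] := pselect (I x); last first.
  by rewrite indicE memNset// mul0r expr0n sqr_ge0.
rewrite indicE mem_set// mul1r.
rewrite (le_trans (fourier_remainder_sup Cb (bper (ltnW beta1)) om Ix))//.
rewrite (le_trans (approx beta1))// ler_pdivrMr ?exprn_gt0//.
by rewrite ler_peMr ?sqr_ge0// exprn_ege1.
Qed.

Let t08 : 0 < t <= 8.
Proof.
have /andP[_ f1] := f01; rewrite divr_gt0 ?mulr_gt0//= ler_pdivrMr ?mulr_gt0//.
by have := m1; lra.
Qed.

Let lam0 : 0 <= lam. Proof. by rewrite addr_ge0// divr_ge0// ltW. Qed.

Let Cc0 : 0 <= Cc.
Proof.
have f2 : 0 <= f0 ^+ 2 by exact: sqr_ge0.
have m2 : 0 <= m%:R ^+ 2 :> R by exact: sqr_ge0.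
have c0 : 0 <= 1024 :> R by exact: ler0n.
rewrite CcE; exact: (divr_ge0 (mulr_ge0 (mulr_ge0 c0 lam0) m2) f2).
Qed.

Let C40 : 0 <= C4.
Proof.
have K2 : 0 <= K ^+ 2 by exact: sqr_ge0.
have m4 : 0 <= m%:R ^+ 4 :> R by exact: exprn_ge0.
have c0 : 0 <= 1024 :> R by exact: ler0n.
rewrite C4E; exact: (mulr_ge0 (mulr_ge0 c0 m4) K2).
Qed.

Let D : R := C4 * L ^+ 2 + L ^+ 2.

Let D0 : 0 <= D.
Proof. exact: (addr_ge0 (mulr_ge0 C40 (sqr_ge0 L)) (sqr_ge0 L)). Qed.

Let pointwise w : sqnormn X (fun x => btilde'1 X eps b m w x - b' b x) w <=
  2 * sqnormn X (bias_fun m h1) w +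
  Cc * (lam * sqnormn X (bias_fun m b) w + sqn (noise_proj X eps m w)) +
  deviation_count X n0 m t w * (D + C4 * (n%:R^-1 * sqn (noise_vec eps w))) + cn * L ^+ 2.
Proof.
have H := @pointwise_bound R d T P n m X eps b om n0 h1 Cb (bper (ltnW beta1)) b'h1
  L f0 finf cn (mean_gram X n0 m) w (deviation_count X n0 m t w) n2 f00.
have Hl (v : 'cV[R]_m) := proj1 (andP (mean_gram_bounds model n0 f_bounds f00 v)).
have Hu (v : 'cV[R]_m) := proj2 (andP (mean_gram_bounds model n0 f_bounds f00 v)).
have := H Hl Hu finf0 h1L biasL cn0 (deviation_count_ge0 X n0 m t w)
  (deviation_countP X n0 m t w) Hcn.
rewrite -/lam -/K -CcE -C4E.
have -> : D + C4 * (n%:R^-1 * sqn (noise_vec eps w)) =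
  C4 * (L ^+ 2 + n%:R^-1 * sqn (noise_vec eps w)) + L ^+ 2.
  by rewrite /D; ring.
exact.
Qed.

Lemma risk_le : (risk X b (btilde'1 X eps b m) <=
  (2 * (finf * (L ^+ 2 / m%:R ^+ (beta - 1).*2)) +
   Cc * (lam * (finf * (L ^+ 2 / m%:R ^+ beta.*2)) + 2 * m%:R * sigma2 / n%:R) +
   m%:R ^+ 2 * p * (D + C4 * sigma2) + cn * L ^+ 2)%:E)%E.
Proof.
pose Bf w := sqnormn X (bias_fun m h1) w.
pose Af w := sqnormn X (bias_fun m b) w.
pose Vf w := sqn (noise_proj X eps m w).
pose Gf w := deviation_count X n0 m t w * (D + C4 * (n%:R^-1 * sqn (noise_vec eps w))).
have br1 : bndI (fun x => h1 x - fsum h1 m x).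
  by apply: bndIB; [case: Cb => _ /bndI_continuous|exact: bndI_fsum].
have br0 : bndI (fun x => b x - fsum b m x).
  by apply: bndIB; [case: Cb => /bndI_continuous|exact: bndI_fsum].
have [IB EB] := Rintegral_sqnormn model n0 f_bounds f00 br1.
have [IA EA] := Rintegral_sqnormn model n0 f_bounds f00 br0.
have [IV EV] := Rintegral_sqn_noise_proj model n0 m.
have [IG EG] := Rintegral_deviation_count model n0 m t08 C40 D0.
have I1 := intbleZ 2 IB.
have I2 := intbleZ Cc (intbleD (intbleZ lam IA) IV).
have I12 := intbleD I1 I2.
have I123 := intbleD I12 IG.
have Ic := intble_cst P (cn * L ^+ 2).
have I1234 := intbleD I123 Ic.
apply: (@le_trans _ _ (\int[P]_w (2 * Bf w + Cc * (lam * Af w + Vf w) + Gf w + cn * L ^+ 2)%:E)%E).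
  rewrite /risk unlock; apply: le_nonneg_integral => w; last by rewrite lee_fin; exact: pointwise.
  rewrite lee_fin /sqnormn mulr_ge0 ?invr_ge0// sumr_ge0// => i _; exact: sqr_ge0.
rewrite (EFin_Rintegral I1234) lee_fin.
rewrite (RintegralD measurableT I123 Ic) (RintegralD measurableT I12 IG).
rewrite (RintegralD measurableT I1 I2) Rintegral_prob_cst.
rewrite (RintegralZl _ measurableT IB).
rewrite (RintegralZl _ measurableT (intbleD (intbleZ lam IA) IV)).
rewrite (RintegralD measurableT (intbleZ lam IA) IV) (RintegralZl _ measurableT IA).
rewrite lerD2r; apply: lerD; last first.
  rewrite /p; exact EG.
apply: lerD.
  by rewrite ler_wpM2l// (le_trans EB)// ler_wpM2l//; exact: approx.
rewrite ler_wpM2l// lerD//.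
rewrite ler_wpM2l// (le_trans EA)// ler_wpM2l//.
by have := approx (ltnW beta1); rewrite subn0.
Qed.

End risk_bound.

Section rates.
Variable R : realType.
Implicit Types (x y m : R) (e r : nat).

(** exp u = exp (u / r)^r, which is at least (u / r)^r for u >= 0. *)
Lemma expRN_le_invX (kap y : R) r : 0 < kap -> 0 < y -> (0 < r)%N ->
  expR (- (kap * y)) <= (r%:R / kap) ^+ r / y ^+ r.
Proof.
move=> k0 y0 r0; have r0' : 0 < r%:R :> R by rewrite ltr0n.
rewrite expRN -expr_div_n -[leRHS]invrK lef_pV2 ?posrE ?invr_gt0 ?expR_gt0//; last first.
  by rewrite exprn_gt0// !divr_gt0.
have -> : ((r%:R / kap / y) ^+ r)^-1 = (kap * y / r%:R) ^+ r.
  by rewrite -exprVn; congr (_ ^+ _); field; rewrite !gt_eqF.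
have -> : expR (kap * y) = expR (kap * y / r%:R) ^+ r.
  by rewrite -expRM_natl; congr expR; field; rewrite gt_eqF.
apply: lerXn2r; rewrite ?nnegrE ?expR_ge0 ?divr_ge0 ?mulr_ge0 ?(ltW k0) ?(ltW y0)//.
by apply: le_trans (expR_ge1Dx _); rewrite lerDr.
Qed.

Variables (lo hi y m : R) (e : nat).
Hypotheses (lo0 : 0 < lo) (hi0 : 0 < hi) (y1 : 1 <= y).
Hypotheses (lom : lo * y <= m) (mhi : m <= hi * y).

Let y0 : 0 < y. Proof. exact: lt_le_trans y1. Qed.
Let m0 : 0 < m. Proof. by apply: lt_le_trans lom; exact: mulr_gt0. Qed.
Let ye0 : 0 < y ^+ e. Proof. exact: exprn_gt0. Qed.

Lemma invX_le_rate : (m ^+ e)^-1 <= lo ^- e / y ^+ e.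
Proof.
rewrite -invfM -exprMn lef_pV2 ?posrE ?exprn_gt0 ?mulr_gt0//.
by by apply: lerXn2r; rewrite ?nnegrE ?(ltW m0) ?mulr_ge0 ?(ltW y0) ?(ltW lo0).
Qed.

Lemma sqr_invX_rate : m ^+ 2 / m ^+ (e + 2) <= lo ^- e / y ^+ e.
Proof.
apply: le_trans invX_le_rate; rewrite exprD invfM mulrCA divff ?mulr1//.
by rewrite sqrf_eq0 gt_eqF.
Qed.

Lemma cube_rate : m ^+ 3 / y ^+ (e + 3) <= hi ^+ 3 / y ^+ e.
Proof.
have -> : hi ^+ 3 / y ^+ e = (hi * y) ^+ 3 / y ^+ (e + 3).
  by rewrite exprMn exprD; field; rewrite !gt_eqF.
rewrite ler_pM2r ?invr_gt0 ?exprn_gt0//.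
by apply: lerXn2r; rewrite ?nnegrE ?(ltW m0) ?mulr_ge0 ?(ltW y0) ?(ltW hi0).
Qed.

Let m_sqr : m ^+ 2 <= hi ^+ 2 * y ^+ 2.
Proof.
rewrite -exprMn.
by apply: lerXn2r; rewrite ?nnegrE ?(ltW m0) ?mulr_ge0 ?(ltW y0) ?(ltW hi0).
Qed.

Variables (f0 q A L s : R).
Hypotheses (f00 : 0 < f0) (q0 : 0 < q) (A0 : 0 <= A) (s0 : 0 <= s).
Let N := y ^+ (e + 3).
Hypothesis N2 : 2 <= N.
Let K := q * N / ln N.
(** The exponent of [p] is at least kap y because m <= hi y and N >= y^3; 512 = 128 * 2^2. *)
Let kap := f0 ^+ 2 / 512 / hi ^+ 2.
Let p := 2 * expR (- (N * (f0 / (2 * m)) ^+ 2 / 128)).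
Let k := q / ln 2.
(** The factors m^2, m^4 and K^2 grow at most like y^2, y^4 and y^(2 (e + 3)), in total y^(2 e +
    12); the remaining e powers give the rate. *)
Let r := (3 * e + 12)%N.

Let N0 : 0 < N. Proof. exact: exprn_gt0. Qed.
Let kap0 : 0 < kap. Proof.
have c0 : 0 < 512 :> R by rewrite ltr0n.
exact: divr_gt0 (divr_gt0 (exprn_gt0 2 f00) c0) (exprn_gt0 2 hi0).
Qed.

Let K_ge0 : 0 <= K.
Proof. by rewrite divr_ge0 ?mulr_ge0 ?(ltW q0) ?(ltW N0)// ln_ge0 ?(le_trans _ N2)// ler1n. Qed.

Let K_le : K <= k * N.
Proof.
rewrite /K /k mulrAC ler_pM2r// ler_pM2l// lef_pV2 ?posrE ?ln_gt0 ?ltr1n//.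
  by rewrite ler_ln ?posrE.
by rewrite (lt_le_trans _ N2)// ltr1n.
Qed.

Lemma p_rate : p <= 2 * ((r%:R / kap) ^+ r / y ^+ r).
Proof.
have c0 : 0 <= f0 ^+ 2 / 512 by exact: divr_ge0 (sqr_ge0 f0) (ler0n R 512).
rewrite /p ler_wpM2l//; apply: le_trans (expRN_le_invX kap0 y0 _); last by rewrite /r addnC.
rewrite ler_expR lerN2.
have -> : N * (f0 / (2 * m)) ^+ 2 / 128 = f0 ^+ 2 / 512 * (N / m ^+ 2).
  by field; rewrite gt_eqF.
have -> : kap * y = f0 ^+ 2 / 512 * (y / hi ^+ 2) by rewrite /kap -mulrA [in LHS](mulrC _ y).
rewrite ler_wpM2l ?c0//.
rewrite ler_pdivlMr ?exprn_gt0// mulrAC ler_pdivrMr ?exprn_gt0//.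
apply: (@le_trans _ _ (y * (hi ^+ 2 * y ^+ 2))); first by rewrite ler_wpM2l// ltW.
have -> : y * (hi ^+ 2 * y ^+ 2) = hi ^+ 2 * y ^+ 3 by ring.
by rewrite mulrC ler_wpM2r ?sqr_ge0// /N ler_weXn2l// leq_addl.
Qed.

Lemma deviation_rate :
  m ^+ 2 * p * (A * m ^+ 4 * K ^+ 2 * L ^+ 2 + L ^+ 2 + A * m ^+ 4 * K ^+ 2 * s) <=
  hi ^+ 2 * (2 * (r%:R / kap) ^+ r) *
    (A * hi ^+ 4 * k ^+ 2 * (L ^+ 2 + s) + L ^+ 2) / y ^+ e.
Proof.
have K2 : K ^+ 2 <= k ^+ 2 * N ^+ 2.
  by rewrite -exprMn; apply: lerXn2r; rewrite ?nnegrE ?K_ge0// (le_trans K_ge0).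
have m4 : m ^+ 4 <= hi ^+ 4 * y ^+ 4.
  by rewrite -exprMn; apply: lerXn2r; rewrite ?nnegrE ?(ltW m0) ?mulr_ge0 ?(ltW y0) ?(ltW hi0).
set Z := (X in _ * X <= _).
have Z_le : Z <= (A * hi ^+ 4 * k ^+ 2 * (L ^+ 2 + s) + L ^+ 2) * y ^+ (2 * e + 10).
  have -> : Z = A * (m ^+ 4 * K ^+ 2) * (L ^+ 2 + s) + L ^+ 2 by rewrite /Z; ring.
  rewrite mulrDl; apply: lerD; last by rewrite ler_peMr ?sqr_ge0 ?exprn_ege1.
  have -> : A * hi ^+ 4 * k ^+ 2 * (L ^+ 2 + s) * y ^+ (2 * e + 10) =
    A * (hi ^+ 4 * y ^+ 4 * (k ^+ 2 * N ^+ 2)) * (L ^+ 2 + s).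
    have -> : N ^+ 2 = y ^+ ((e + 3) * 2) by rewrite exprM.
    have -> : (2 * e + 10)%N = (4 + (e + 3) * 2)%N by rewrite mulnDl addnCA mulnC.
    rewrite (exprD y 4).
    ring.
  rewrite ler_wpM2r ?addr_ge0 ?sqr_ge0// ler_wpM2l// ler_pM// ?sqr_ge0//.
  exact: exprn_ge0 (ltW m0).
have p0 : 0 <= p by rewrite mulr_ge0 ?expR_ge0.
have Z0 : 0 <= Z.
  have c0 : 0 <= A * m ^+ 4 * K ^+ 2.
    exact: mulr_ge0 (mulr_ge0 A0 (exprn_ge0 4 (ltW m0))) (sqr_ge0 K).
  exact: addr_ge0 (addr_ge0 (mulr_ge0 c0 (sqr_ge0 L)) (sqr_ge0 L)) (mulr_ge0 c0 s0).
apply: (@le_trans _ _ (hi ^+ 2 * y ^+ 2 * (2 * ((r%:R / kap) ^+ r / y ^+ r)) *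
  ((A * hi ^+ 4 * k ^+ 2 * (L ^+ 2 + s) + L ^+ 2) * y ^+ (2 * e + 10)))).
  apply: ler_pM => //; first by rewrite mulr_ge0 ?sqr_ge0.
  by apply: ler_pM; [exact: sqr_ge0|by []|exact: m_sqr|exact: p_rate].
have rE : r = (e + (2 + (2 * e + 10)))%N by rewrite (addnCA e) (addnA e) -mulSn addnCA.
have -> : y ^+ r = y ^+ e * (y ^+ 2 * y ^+ (2 * e + 10)) by rewrite rE (exprD y e) (exprD y 2).
rewrite le_eqVlt; apply/orP; left; apply/eqP.
by field; rewrite !gt_eqF// exprn_gt0.
Qed.

(** Since m <= hi y and ln N <= (e + 3) y, the hypothesis q N / ln N < 2 m M bounds y^(e + 1), a
    fortiori y^e. A loss of order 1 is then within a constant of the rate. *)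
Lemma truncation_rate (M : R) : 0 < M -> K < 2 * m * M ->
  1 <= 2 * hi * M * (e + 3)%:R / q / y ^+ e.
Proof.
move=> M0 KM.
have lnN0 : 0 < ln N by rewrite ln_gt0// (lt_le_trans _ N2)// ltr1n.
have lnN : ln N <= (e + 3)%:R * y.
  have -> : ln N = (e + 3)%:R * ln y by rewrite /N lnXn// mulr_natl.
  by rewrite ler_wpM2l ?ler0n//; exact/ltW/ln_sublinear.
rewrite -mulrA -invfM ler_pdivlMr ?mulr_gt0// mul1r.
have y2 : 0 < y ^+ 2 by exact: exprn_gt0.
rewrite -(ler_pM2r y2).
apply: (@le_trans _ _ (q * N)).
  rewrite -mulrA ler_wpM2l ?(ltW q0)// -exprD /N ler_weXn2l//.
  by rewrite leq_add2l.
rewrite ltr_pdivrMr// in KM; apply: le_trans (ltW KM) _.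
have -> : 2 * hi * M * (e + 3)%:R * y ^+ 2 = 2 * (hi * y) * M * ((e + 3)%:R * y) by ring.
have mM : 0 <= 2 * m * M by rewrite !mulr_ge0// ltW.
apply: ler_pM => //; first exact: ltW.
by rewrite ler_wpM2r ?(ltW M0)// ler_wpM2l.
Qed.

Lemma risk_rate (finf lam M cn : R) : 0 <= finf -> 0 <= lam -> 0 < M ->
  cn = (if 2 * m * M <= K then 0 else 1) ->
  2 * (finf * (L ^+ 2 / m ^+ e)) +
  A * lam * m ^+ 2 / f0 ^+ 2 * (lam * (finf * (L ^+ 2 / m ^+ (e + 2))) + 2 * m * s / N) +
  m ^+ 2 * p * (A * m ^+ 4 * K ^+ 2 * L ^+ 2 + L ^+ 2 + A * m ^+ 4 * K ^+ 2 * s) +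
  cn * L ^+ 2 <=
  (2 * (finf * L ^+ 2) * lo ^- e +
   A * lam / f0 ^+ 2 * (lam * finf * L ^+ 2 * lo ^- e + 2 * s * hi ^+ 3) +
   hi ^+ 2 * (2 * (r%:R / kap) ^+ r) * (A * hi ^+ 4 * k ^+ 2 * (L ^+ 2 + s) + L ^+ 2) +
   2 * hi * M * (e + 3)%:R / q * L ^+ 2) / y ^+ e.
Proof.
move=> finf0 lam0 M0 cnE.
have L2 := sqr_ge0 L.
rewrite [leRHS]mulrDl; apply: lerD; last first.
  rewrite [leRHS]mulrAC ler_wpM2r// cnE; case: ifP => [_|/negbT]; last first.
    by rewrite -ltNge => /(truncation_rate M0).
  by rewrite !mulr_ge0 ?invr_ge0 ?ler0n ?(ltW ye0) ?(ltW q0) ?(ltW M0) ?(ltW hi0).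
rewrite [leRHS]mulrDl; apply: lerD; last exact: deviation_rate.
rewrite [leRHS]mulrDl; apply: lerD.
  rewrite -[leRHS]mulrA (mulrA finf) (mulrA 2).
  rewrite ler_wpM2l ?invX_le_rate//.
  exact: mulr_ge0 (ler0n R 2) (mulr_ge0 finf0 L2).
rewrite -[leRHS]mulrA [in leRHS]mulrDl.
have -> : A * lam * m ^+ 2 / f0 ^+ 2 *
    (lam * (finf * (L ^+ 2 / m ^+ (e + 2))) + 2 * m * s / N) =
  A * lam / f0 ^+ 2 *
    (lam * finf * L ^+ 2 * (m ^+ 2 / m ^+ (e + 2)) + 2 * s * (m ^+ 3 / N)).
  by rewrite !mulrA; ring.
have c0 : 0 <= A * lam / f0 ^+ 2 by exact: divr_ge0 (mulr_ge0 A0 lam0) (sqr_ge0 f0).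
rewrite ler_wpM2l//; apply: lerD.
  rewrite -[leRHS]mulrA ler_wpM2l ?sqr_invX_rate//.
  exact: mulr_ge0 (mulr_ge0 lam0 finf0) L2.
rewrite -[leRHS]mulrA ler_wpM2l ?cube_rate//.
exact: mulr_ge0 (ler0n R 2) s0.
Qed.

End rates.

(* lo, hi: "m is an odd integer of order n^(1/(2 beta + 1))" is read as
   lo n^(1/(2 beta + 1)) <= m <= hi n^(1/(2 beta + 1)).
   finf: bound for f on [0, 1], in the role of the sup norm of f. *)
Theorem corollary4p2 (R : realType) (beta : nat)
    (L finf f0 sigma2 lo hi : R)
    (hbeta : (1 < beta)%N) (hL : 0 < L) (hf0 : 0 < f0)
    (hlo : 0 < lo) (hhi : 0 < hi) :
  exists c1 c2 : R, 0 < c1 /\ 0 < c2 /\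
  forall (d : measure_display) (T : measurableType d) (P : probability T R)
    (n m : nat) (X eps : 'I_n -> {RV P >-> R}) (b f : R -> R),
    (2 <= n)%N ->
    regression_model X eps b f sigma2 ->
    (forall x, 0 <= x <= 1 -> f0 <= f x <= finf) ->
    (forall i, ('E_P[(fun w => (b' b (X i w)) ^+ 4)%R] < +oo)%E) ->
    (forall i, ('E_P[(fun w => (Yobs X eps b i w) ^+ 4)%R] < +oo)%E) ->
    Wper beta L b ->
    b 0 = b 1 ->
    odd m ->
    lo * n%:R `^ (1 / (2 * beta%:R + 1)) <= m%:R
      <= hi * n%:R `^ (1 / (2 * beta%:R + 1)) ->
    (risk X b (btilde'1 X eps b m)
       <= (c1 * n%:R `^ (- (2 * (beta%:R - 1) / (2 * beta%:R + 1))))%:E)%E /\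
    (risk X b (btilde'2 X eps b m)
       <= (c2 * n%:R `^ (- (2 * (beta%:R - 1) / (2 * beta%:R + 1))))%:E)%E.
Proof.
(* With y^(2 beta + 1) = n and e + 3 = 2 beta + 1, the rate is y^(-e). *)
set e := (beta - 1).*2.
have e3n : (e + 3 = 2 * beta + 1)%N by rewrite /e; clear -hbeta; lia.
have eb : beta.*2 = (e + 2)%N by rewrite /e; clear -hbeta; lia.
(* Lowering f0 to at most 1 keeps the threshold g / (2 m) in the range of [hoeffding_type]; g is
   still a lower bound of the density. *)
set g := Num.min f0 1.
have g01 : 0 < g <= 1 by rewrite lt_min hf0 ltr01 ge_min lexx orbT.
have g0 : 0 < g by case/andP: g01.
have q0 : 0 < frakc :> R := frakc_gt0.
(* An abstract A keeps conversion from unfolding the literal 1024. *)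
have : exists A : R, A = 1024 by exists 1024.
case=> A AE.
have A0 : 0 <= A by rewrite AE; exact: ler0n.
pose lam := finf + g / 2.
pose M := Num.max (2 / g) 1.
have M0 : 0 < M by rewrite lt_max ltr01 orbT.
pose c :=
  2 * (finf * L ^+ 2) * lo ^- e +
   A * lam / g ^+ 2 * (lam * finf * L ^+ 2 * lo ^- e + 2 * sigma2 * hi ^+ 3) +
   hi ^+ 2 * (2 * ((3 * e + 12)%:R / (g ^+ 2 / 512 / hi ^+ 2)) ^+ (3 * e + 12)) *
     (A * hi ^+ 4 * (frakc / ln 2) ^+ 2 * (L ^+ 2 + sigma2) + L ^+ 2) +
   2 * hi * M * (e + 3)%:R / frakc * L ^+ 2.
suff risk1 (d : measure_display) (T : measurableType d) (P : probability T R)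
    (n m : nat) (X eps : 'I_n -> {RV P >-> R}) (b f : R -> R) :
    (2 <= n)%N -> regression_model X eps b f sigma2 ->
    (forall x, 0 <= x <= 1 -> f0 <= f x <= finf) -> Wper beta L b -> odd m ->
    lo * n%:R `^ (1 / (2 * beta%:R + 1)) <= m%:R
      <= hi * n%:R `^ (1 / (2 * beta%:R + 1)) ->
    (risk X b (btilde'1 X eps b m) <=
      ((`|c| + 1) * n%:R `^ (- (2 * (beta%:R - 1) / (2 * beta%:R + 1))))%:E)%E.
  (* The signs of [sigma2] and [finf] follow only from a model, which is not yet given; the absolute
     value and 1 make the constant positive beforehand. *)
  exists (`|c| + 1), (`|c| + 1); split; first by rewrite ltr_wpDl.
  split; first by rewrite ltr_wpDl.
  move=> d T P n m X eps b f n2 model fb _ _ Wb _ om mb.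
  have H := risk1 d T P n m X eps b f n2 model fb Wb om mb.
  split=> //; suff -> : btilde'2 X eps b m = btilde'1 X eps b m by [].
  apply/funext => w; apply/funext => x; rewrite /btilde'2 /btilde'1.
  by rewrite bhat'2E// ltnW.
move=> n2 model fb Wb om; set y : R := n%:R `^ _ => /andP[lom mhi].
have n0 : 0 < n%:R :> R by rewrite ltr0n ltnW.
have yX j : y ^+ j = n%:R `^ (j%:R / (2 * beta%:R + 1)).
  by rewrite -powR_mulrn ?powR_ge0// -powRrM mulrAC mul1r.
have beta_pos : 0 < 2 * beta%:R + 1 :> R by rewrite ltr_wpDl ?mulr_ge0.
have e3 : (e + 3)%:R = 2 * beta%:R + 1 :> R.
  by rewrite e3n natrD natrM.
have eR : e%:R = 2 * (beta%:R - 1) :> R.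
  by rewrite /e -muln2 natrM natrB ?(ltnW hbeta)// mulrC.
have yN : y ^+ (e + 3) = n%:R by rewrite yX e3 divff ?powRr1 ?ler0n// gt_eqF.
have y1 : 1 <= y.
  rewrite -(powRr0 n%:R) /y ler_powR ?divr_ge0 ?(ltW beta_pos)//.
  by rewrite ler1n ltnW.
have -> : n%:R `^ (- (2 * (beta%:R - 1) / (2 * beta%:R + 1))) = (y ^+ e)^-1.
  by rewrite powRN yX eR.
have s0 : 0 <= sigma2 := sigma2_ge0 model (Ordinal (ltnW n2)).
have finf0 : 0 <= finf.
  have /fb/andP[f1 f2] : 0 <= (0 : R) <= 1 by rewrite lexx ler01.
  exact: ltW (lt_le_trans hf0 (le_trans f1 f2)).
have lam0 : 0 <= lam by rewrite addr_ge0// divr_ge0// ltW.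
have gb x : 0 <= x <= 1 -> g <= f x <= finf.
  by move=> /fb/andP[f1 ->]; rewrite andbT ge_min f1.
pose K : R := frakc * n%:R / ln n%:R.
(* The coefficient is 0 as soon as n and m alone ensure that a concentrated sample passes the
   truncation. *)
pose cn : R := if 2 * m%:R * M <= K then 0 else 1.
have cn0 : 0 <= cn by rewrite /cn; case: ifP.
have Hcn : 2 * m%:R * M <= K \/ 1 <= cn.
  by rewrite /cn; case: ifP => H; [left|right].
have N2 : 2 <= y ^+ (e + 3) by rewrite yN ler_nat.
have CcE : A * lam * m%:R ^+ 2 / g ^+ 2 = 1024 * lam * m%:R ^+ 2 / g ^+ 2 by rewrite AE.
have C4E : A * m%:R ^+ 4 * K ^+ 2 = 1024 * m%:R ^+ 4 * K ^+ 2 by rewrite AE.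
have H1 := risk_le model n2 gb g01 om hbeta (ltW hL) Wb cn0 Hcn CcE C4E.
apply: (le_trans H1); rewrite lee_fin.
apply: (@le_trans _ _ (c / y ^+ e)); last first.
  rewrite ler_wpM2r ?invr_ge0 ?exprn_ge0 ?(le_trans _ y1)//.
  by rewrite (le_trans (ler_norm c))// lerDl.
have H2 := @risk_rate R lo hi y m%:R e hlo hhi y1 lom mhi g frakc A L sigma2
  g0 q0 A0 s0 N2 finf lam M cn finf0 lam0 M0.
rewrite yN in H2; rewrite eb; apply: H2.
by [].
Qed.
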